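(* Let $\Omega$ be a bounded quasi $B$-regular domain in $\mathbb{C}^n$ and let $\phi:\Omega\to[-\infty,\infty]$ be a nearly continuous function, i.e. $E_\phi=\{z\in\overline{\Omega}:\phi^*(z)\ne\phi_*(z)\}$ is $\Omega$-pluripolar. Suppose that $\phi^*$ admits a superharmonic majorant $v\not\equiv+\infty$ on $\overline{\Omega}$ which is a strong plurisuperharmonic majorant of $\phi^*$, and that $\phi\ge\theta$ on $\Omega$ for some $\theta\in PSH^*(\Omega)$ that is bounded from below on $\Omega$. Assume, in addition, that $\phi$ is superharmonic on $\Omega$. Then $$P_{\phi^*}(z)=\sup\{u(z): u\in PSH(\Omega),\ u^*\le\phi^*\text{ on }\overline{\Omega}\},\qquad z\in\Omega,$$ is the unique quasi upper bounded solution $u$ of the Dirichlet problem $$\begin{cases}u\in MPSH(\Omega);\\ \inf_\Omega u>-\infty;\\ \lim_{\Omega\ni z\to x}u(z)=\phi(x)\ \text{ for all } x\in\partial\Omega\text{ except for an }\Omega\text{-pluripolar set,}\end{cases}$$ where for $x\in\partial\Omega\setminus E_\phi$, $\phi(x)$ denotes the common value $\phi^*(x)=\phi_*(x)$ (the exceptional set contains the points of $E_\phi\cap\partial\Omega$).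
   Context: $SH(\Omega)$, $PSH(\Omega)$ are the cones of subharmonic and plurisubharmonic functions on $\Omega$ (the function identically $-\infty$ is allowed); $SH^*(\Omega)$, $PSH^*(\Omega)$ are the subsets of those not identically $-\infty$. For a function $f$ on an open set $G$, $f^*(z)=\limsup_{G\ni\xi\to z}f(\xi)$ and $f_*(z)=\liminf_{G\ni\xi\to z}f(\xi)$ for $z\in\overline{G}$ ($\xi=z$ allowed if $z\in G$). $MPSH(\Omega)$ is the set of maximal plurisubharmonic functions: those $u\in PSH^*(\Omega)$ such that for every relatively compact open subset $G$ of $\Omega$ and every $v\in PSH(G)$ with $v^*\le u$ on $\partial G$, one has $v\le u$ on $G$. A set $A\subset\overline{\Omega}$ is $\Omega$-pluripolar if there is $w\in PSH^*(\Omega)$, $w<0$, with $w^*=-\infty$ on $A$. $u\in PSH(\Omega)$ is quasi upper bounded if there is a sequence $\{u_j\}$ of plurisubharmonic functions on $\Omega$, each bounded from above, with $u_j\nearrow u$ outside a pluripolar subset of $\Omega$. A bounded domain $\Omega$ that is regular (for the classical Dirichlet problem for harmonic functions) is quasi $B$-regular if for every continuous $\phi:\partial\Omega\to\mathbb{R}$ there exist an $\Omega$-pluripolar set $A\subset\partial\Omega$ and a quasi upper bounded $u\in PSH(\Omega)$ with $\lim_{z\to x}u(z)=\phi(x)$ for all $x\in(\partial\Omega)\setminus A$. A superharmonic majorant of $f:\overline{\Omega}\to[-\infty,\infty]$ is a lower semicontinuous $v:\overline{\Omega}\to(-\infty,\infty]$, superharmonic on $\Omega$, with $f\le v$ on $\overline{\Omega}$.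 A lower semicontinuous $\psi:\overline{\Omega}\to(-\infty,\infty]$ is a strong plurisuperharmonic majorant of $f$ if $-\psi\in PSH^*(\Omega)$, $\{f=+\infty\}\subset\{\psi=+\infty\}$, and $\psi(z)/f(z)\to+\infty$ as $f(z)\to+\infty$ (i.e. for every $M>0$ there is $N>0$ such that $\psi(z)\ge Mf(z)$ whenever $f(z)>N$). *)

(* Defs.v *)
From mathcomp Require Import all_boot all_order all_algebra.
From mathcomp Require Import complex.
From mathcomp Require Import all_classical all_reals all_analysis.
Set Implicit Arguments.
Unset Strict Implicit.
Unset Printing Implicit Defensive.
Import Order.TTheory GRing.Theory Num.Theory.
Import numFieldNormedType.Exports.
Local Open Scope classical_set_scope.
Local Open Scope ring_scope.
Local Open Scope complex_scope.

(* Functions on a subset A of C^n are represented by total functions on C^n;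
   every notion below only depends on their values on A. *)

(* The topology of R[i] is the one carried by its regular module R[i]^o. *)
Notation Cn R n := 'rV[(complex R)^o]_n.

Section Topology.
Context {R : realType} {n : nat}.
Implicit Types (A G Om : set (Cn R n)) (f : Cn R n -> \bar R).

Definition boundary A : set (Cn R n) := closure A `\` A°.

Definition bounded_in_Cn A : Prop :=
  exists M : R, forall z, A z -> forall j : 'I_n, `|z ord0 j| <= M%:C.

Definition bounded_domain Om : Prop :=
  [/\ open Om, connected Om, Om !=set0 & bounded_in_Cn Om].

Definition relatively_compact_open Om G : Prop :=
  [/\ open G, compact (closure G) & closure G `<=` Om].

Definition usc_on A f : Prop :=
  forall z, A z -> forall a : R, (f z < a%:E)%E ->
    \forall w \near within A (nbhs z), (f w < a%:E)%E.

Definition lsc_on A f : Prop :=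
  forall z, A z -> forall a : R, (a%:E < f z)%E ->
    \forall w \near within A (nbhs z), (a%:E < f w)%E.

(* f^* and f_* for f defined on G; [within G (nbhs z)] does not remove z. *)
Definition upper_reg G f (z : Cn R n) : \bar R :=
  limf_esup f (within G (nbhs z)).

Definition lower_reg G f (z : Cn R n) : \bar R :=
  limf_einf f (within G (nbhs z)).

End Topology.

Section Harmonic.
Context {R : realType} {n : nat}.
Implicit Types (G : set (Cn R n)) (h : Cn R n -> R).

(* The 2n real coordinate directions e_j and i e_j of C^n. *)
Definition real_dir (k : bool * 'I_n) : Cn R n :=
  ((if k.1 then 'i else 1) : R[i]) *: delta_mx ord0 k.2.

Definition real_line (z : Cn R n) (k : bool * 'I_n) (t : R) : Cn R n :=
  z + (t%:C : R[i]) *: real_dir k.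

Definition partial (k : bool * 'I_n) h (z : Cn R n) : R :=
  derive1 (fun t : R => h (real_line z k t)) 0.

Definition C1_on G h : Prop :=
  forall z, G z ->
    {for z, continuous h} /\
    forall k, derivable (fun t : R => h (real_line z k t)) 0 1 /\
              {for z, continuous (partial k h)}.

Definition C2_on G h : Prop :=
  C1_on G h /\ forall k, C1_on G (partial k h).

Definition harmonic_on G h : Prop :=
  C2_on G h /\
  forall z, G z -> \sum_(k : bool * 'I_n) partial k (partial k h) z = 0.

End Harmonic.

(* Omega is regular for the classical Dirichlet problem. *)
Definition dirichlet_regular {R : realType} {n : nat} (Om : set (Cn R n)) :
    Prop :=
  forall phi : Cn R n -> R, {within boundary Om, continuous phi} ->
    exists h : Cn R n -> R,
      [/\ {within closure Om, continuous h}, harmonic_on Om h &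
          forall x, boundary Om x -> h x = phi x].

(* SH(Om), Om open: upper semicontinuous functions with values in [-oo, +oo[
   that are dominated by harmonic majorants; -oo is allowed. *)
Definition SH {R : realType} {n : nat} (Om : set (Cn R n))
    (u : Cn R n -> \bar R) : Prop :=
  [/\ (forall z, Om z -> (u z < +oo)%E),
      usc_on Om u &
      forall (G : set (Cn R n)) (h : Cn R n -> R),
        relatively_compact_open Om G ->
        {within closure G, continuous h} -> harmonic_on G h ->
        (forall z, boundary G z -> (u z <= (h z)%:E)%E) ->
        forall z, G z -> (u z <= (h z)%:E)%E].

Definition superharmonic {R : realType} {n : nat} (Om : set (Cn R n))
    (u : Cn R n -> \bar R) : Prop :=
  SH Om (fun z => - u z)%E.

Section Plurisubharmonic.
Context {R : realType} {n : nat}.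
Implicit Types (A E G Om : set (Cn R n)) (f u v w : Cn R n -> \bar R).

Definition complex_line (a b : Cn R n) (l : Cn R 1) : Cn R n :=
  a + (l ord0 ord0 : R[i]) *: b.

Definition PSH Om u : Prop :=
  [/\ (forall z, Om z -> (u z < +oo)%E),
      usc_on Om u &
      forall a b : Cn R n,
        SH (complex_line a b @^-1` Om) (u \o complex_line a b)].

Definition PSHs Om u : Prop :=
  PSH Om u /\ exists2 z, Om z & u z != -oo%E.

Definition MPSH Om u : Prop :=
  PSHs Om u /\
  forall G v, relatively_compact_open Om G -> PSH G v ->
    (forall z, boundary G z -> (upper_reg G v z <= u z)%E) ->
    forall z, G z -> (v z <= u z)%E.

Definition pluripolar_in Om A : Prop :=
  A `<=` closure Om /\
  exists w, [/\ PSHs Om w, (forall z, Om z -> (w z < 0)%E) &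
                forall z, A z -> upper_reg Om w z = -oo%E].

(* Pluripolar sets in the usual (local) sense; V is connected so that w is
   not identically -oo on any component. *)
Definition pluripolar E : Prop :=
  forall a, E a -> exists V w,
    [/\ open V, connected V, V a, PSHs V w &
        forall z, E z -> V z -> w z = -oo%E].

Definition quasi_upper_bounded Om u : Prop :=
  PSH Om u /\
  exists (uj : nat -> Cn R n -> \bar R) (E : set (Cn R n)),
    [/\ (forall j, PSH Om (uj j)),
        (forall j, exists M : R, forall z, Om z -> (uj j z <= M%:E)%E),
        E `<=` Om,
        pluripolar E &
        forall z, Om z -> ~ E z ->
          (forall j, (uj j z <= uj j.+1 z)%E) /\
          (fun j => uj j z) @ \oo --> u z].

Definition quasi_B_regular Om : Prop :=
  [/\ bounded_domain Om, dirichlet_regular Om &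
      forall phi : Cn R n -> R, {within boundary Om, continuous phi} ->
        exists A u,
          [/\ A `<=` boundary Om, pluripolar_in Om A,
              quasi_upper_bounded Om u &
              forall x, boundary Om x -> ~ A x ->
                u @ within Om (nbhs x) --> (phi x)%:E]].

Definition superharmonic_majorant Om f v : Prop :=
  [/\ (forall z, closure Om z -> (-oo < v z)%E),
      lsc_on (closure Om) v,
      superharmonic Om v &
      forall z, closure Om z -> (f z <= v z)%E].

Definition strong_psuperh_majorant Om f psi : Prop :=
  [/\ (forall z, closure Om z -> (-oo < psi z)%E),
      lsc_on (closure Om) psi,
      PSHs Om (fun z => - psi z)%E,
      (forall z, closure Om z -> f z = +oo%E -> psi z = +oo%E) &
      forall M : R, 0 < M -> exists2 N : R, 0 < N &
        forall z, closure Om z ->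
          (N%:E < f z)%E -> (M%:E * f z <= psi z)%E].

Definition disc_set Om f : set (Cn R n) :=
  [set z | closure Om z /\ upper_reg Om f z <> lower_reg Om f z].

Definition nearly_continuous Om f : Prop := pluripolar_in Om (disc_set Om f).

(* P_f, for f defined on the closure of Om. *)
Definition envelope Om f (z : Cn R n) : \bar R :=
  ereal_sup [set u z | u in
    [set u | PSH Om u /\
             forall x, closure Om x -> (upper_reg Om u x <= f x)%E]].

(* Off the exceptional set A, the boundary value phi(x) is the common value of
   phi^*(x) and phi_*(x), since A contains the points of E_phi on the boundary. *)
Definition dirichlet_solution Om (phi u : Cn R n -> \bar R) : Prop :=
  [/\ MPSH Om u,
      (-oo < ereal_inf (u @` Om))%E &
      exists A,
        [/\ A `<=` boundary Om, pluripolar_in Om A,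
            boundary Om `&` disc_set Om phi `<=` A &
            forall x, boundary Om x -> ~ A x ->
              u @ within Om (nbhs x) --> upper_reg Om phi x]].

End Plurisubharmonic.

(* Main.v *)
(* No integration is used: all potential theory comes from the maximum
   principle on domains where the Dirichlet problem is solvable.

   The key tool is a comparison principle, u <= v for u subharmonic and v
   superharmonic with u <= v near the boundary.  If it fails, maximize
   u - v + eta |z|^2 at z0, copy a Dirichlet-regular domain (Omega itself!)
   into a small neighbourhood of z0, and put a harmonic function between u and
   v on the boundary of the copy.  In C^1 the unit disc plays this role; there
   the Dirichlet problem is solved by finite sums of Poisson kernels with poles
   outside the closed disc.  Comparison gives sums, the implication PSH => SH
   and Harnack's inequality, and the latter shows that plurisubharmonic
   inequalities may be checked off pluripolar sets.

   Harnack against the majorant v bounds P near each point of Omega, so that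
   the upper regularization of P competes in the supremum and P is
   plurisubharmonic.  The functions P - (v - m) / (j + 1), where m <= v, are
   bounded above because v is a strong majorant, and increase to P off
   {v = +oo}.  A competitor for the maximality of P or for the boundary values
   is perturbed by eps w - eps with w < 0 equal to -oo on the exceptional set,
   compared with the superharmonic phi, and then eps -> 0 off {w = -oo}.
   Uniqueness is the same perturbation applied to the maximality of either
   solution. *)
Require Import Defs.
From mathcomp Require Import all_boot all_order all_algebra.
From mathcomp Require Import complex.
From mathcomp Require Import all_classical all_reals all_analysis.
From mathcomp Require Import ring lra.
Import Order.TTheory GRing.Theory Num.Theory.
Import numFieldNormedType.Exports.
Set Implicit Arguments.
Unset Strict Implicit.
Unset Printing Implicit Defensive.
Local Open Scope classical_set_scope.
Local Open Scope ring_scope.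
Local Open Scope complex_scope.

(** Semicontinuous boundary data cannot be solved for, so wherever a mean value would be integrated,
    a Lipschitz function is inserted between u and a majorant on a small boundary; an approximate,
    one-sided harmonic solution for it is enough. Plurisubharmonicity is tested on lines, so most of
    the theory needs only the disc. The comparison in C^n confronts plurisubharmonic competitors
    with the superharmonic phi, and Omega can serve as model domain there because similarities
    preserve harmonicity.

    The two terms of the perturbation eps w - eps have different tasks. Near an exceptional boundary
    point, eps w pulls the competitor below a lower bound m of the other function. This works only
    for competitors bounded above, hence the role of quasi upper boundedness and of the lower bounds
    on phi and on solutions. Elsewhere w < 0 gives no uniform gap, and the constant -eps absorbs the
    errors eps / 2 of the two limits. *)

Local Notation Re := complex.Re.
Local Notation Im := complex.Im.

(** * Real-valued norms, and the topology of C^n in terms of them *)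

Section RealNorm.
Context {R : realType}.

(** The norm of [R[i]] has values in [R[i]], which is only partially ordered; a real-valued copy
    gives real radii and access to [lra]. *)
Definition cabs (c : R[i]) : R := Re `|c|.

Lemma cabsE (c : R[i]) : `|c| = (cabs c)%:C.
Proof. by rewrite /cabs normc_def. Qed.

Lemma cabs_def (c : R[i]) : cabs c = Num.sqrt (Re c ^+ 2 + Im c ^+ 2).
Proof. by rewrite /cabs normc_def. Qed.

Lemma cabs_ge0 c : 0 <= cabs c.
Proof. by rewrite cabs_def sqrtr_ge0. Qed.

Lemma cabs_sqr c : cabs c ^+ 2 = Re c ^+ 2 + Im c ^+ 2.
Proof. by rewrite cabs_def sqr_sqrtr // addr_ge0 ?sqr_ge0. Qed.

Lemma Re_le_cabs c : `|Re c| <= cabs c.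
Proof. by rewrite -lecR -cabsE normc_ge_Re. Qed.

Lemma Im_le_cabs c : `|Im c| <= cabs c.
Proof. by rewrite cabs_def -sqrtr_sqr ler_wsqrtr // lerDr sqr_ge0. Qed.

Lemma cabs_real (x : R) : cabs x%:C = `|x|.
Proof. by rewrite cabs_def /= expr0n addr0 sqrtr_sqr. Qed.

Lemma cabsM c d : cabs (c * d) = cabs c * cabs d.
Proof.
apply: complexI; rewrite -cabsE normrM !cabsE.
by rewrite -rmorphM.
Qed.

Lemma cabsD c d : cabs (c + d) <= cabs c + cabs d.
Proof. by rewrite -lecR rmorphD /= -!cabsE ler_normD. Qed.

Lemma cabs0 : cabs 0 = 0.
Proof. by rewrite /cabs normr0. Qed.

Lemma cabs_eq0 c : (cabs c == 0) = (c == 0).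
Proof. by rewrite -(inj_eq (@complexI _)) /= -cabsE normr_eq0. Qed.

Lemma cabs_le c : cabs c <= `|Re c| + `|Im c|.
Proof.
rewrite -(@ler_pXn2r _ 2) ?nnegrE ?addr_ge0 ?cabs_ge0//.
rewrite cabs_sqr sqrrD !real_normK ?num_real// addrAC lerDl.
by rewrite mulrn_wge0// mulr_ge0.
Qed.

Context {n : nat}.
Implicit Types z w : Cn R n.

(** The matrix norm is the sup norm of the coordinates, so balls for [rn] are polydiscs. The
    Euclidean norm appears later as [rdot z z]. *)
Definition rn z : R := Re (`|z| : R[i]).

Lemma rnE z : (`|z| : R[i]) = (rn z)%:C.
Proof.
have H (x : R[i]) : x \is Num.real -> x = (Re x)%:C.
  rewrite realE !lecE => /orP[] /andP[/eqP h _]; apply/eqP; rewrite eq_complex /= eqxx /=.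
    by rewrite h.
  by rewrite -h.
exact/H/normr_real.
Qed.

Lemma rn_ge0 z : 0 <= rn z.
Proof. rewrite -lecR -rnE; exact: normr_ge0. Qed.

Lemma rn0 : rn 0 = 0.
Proof. by rewrite /rn normr0. Qed.

Lemma rnN z : rn (- z) = rn z.
Proof. by rewrite /rn normrN. Qed.

Lemma rnD z w : rn (z + w) <= rn z + rn w.
Proof. by rewrite -lecR rmorphD /= -!rnE ler_normD. Qed.

Lemma rnC z w : rn (z - w) = rn (w - z).
Proof. by rewrite -rnN opprB. Qed.

Lemma rn_tri w z x : rn (z - x) <= rn (z - w) + rn (w - x).
Proof. by apply: le_trans (rnD _ _); rewrite addrA subrK. Qed.

Lemma rnZ (c : R[i]) z : rn (c *: z) = cabs c * rn z.
Proof. by apply: complexI; rewrite -rnE rmorphM/= -rnE -cabsE mx_normZ. Qed.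

Lemma rn_leP z (e : R) : 0 <= e ->
  (rn z <= e) <-> (forall j, cabs (z ord0 j) <= e).
Proof.
move=> e0; have e0' : (0 : R[i]) <= e%:C by rewrite lecR.
rewrite -lecR -rnE (_ : `|z| = mx_norm z)// mx_normE.
rewrite (_ : e%:C = (NngNum e0')%:num)// num_le.
split.
  move=> /bigmax_leP[_ H] j; move: (H (ord0, j) isT).
  by rewrite -num_le/= cabsE lecR.
move=> H; apply/bigmax_leP; split; first by rewrite -num_le.
by move=> [i j] _; rewrite -num_le/= cabsE lecR (ord1 i).
Qed.

Lemma rn_coord z j : cabs (z ord0 j) <= rn z.
Proof. by have /(rn_leP _ (rn_ge0 z)) := lexx (rn z); apply. Qed.

Lemma nbhs_rnP z (A : set (Cn R n)) :
  nbhs z A <-> exists2 e : R, 0 < e & forall w, rn (w - z) < e -> A w.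
Proof.
split.
  move=> /nbhs_ballP[e e0]; rewrite -ball_normE => H.
  move: e0; rewrite /= ltcE /= => /andP[/eqP e1 e0].
  exists (Re e) => // w wz; apply: H => /=.
  rewrite -opprB normrN rnE.
  by rewrite ltcE /= e1 eqxx.
move=> [e e0 H]; apply/nbhs_ballP; exists e%:C; first by rewrite /= ltcR.
move=> w; rewrite -ball_normE /= -opprB normrN rnE ltcR; exact: H.
Qed.

Lemma near_rn z (e : R) : 0 < e -> \forall w \near z, rn (w - z) < e.
Proof. by move=> e0; apply/nbhs_rnP; exists e. Qed.

Lemma continuous_rnP (T : Type) (F : set_system T) (FF : Filter F) (f : T -> Cn R n) z :
  (f @ F --> z) <-> (forall e : R, 0 < e -> \forall t \near F, rn (f t - z) < e).
Proof.
split.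
  by move=> fz e e0; exact: (fz _ (near_rn z e0)).
move=> H A /nbhs_rnP[e e0 eA]; apply: filterS (H e e0) => t; exact: eA.
Qed.

Lemma real_continuousP (f : Cn R n -> R) z :
  {for z, continuous f} <-> (forall e : R, 0 < e ->
    exists2 d : R, 0 < d & forall w, rn (w - z) < d -> `|f w - f z| < e).
Proof.
split.
  move=> /(@cvgrPdist_lt _ _ _ _ (nbhs_filter z)) H e e0.
  have /nbhs_rnP[d d0 Hd] := H e e0; exists d => // w wz.
  by rewrite distrC; exact: Hd.
move=> H; apply/(@cvgrPdist_lt _ _ _ _ (nbhs_filter z)) => e e0.
apply/nbhs_rnP; have [d d0 Hd] := H e e0; exists d => // w wz.
by rewrite distrC; exact: Hd.
Qed.

Lemma lipschitz_continuous (f : Cn R n -> R) (k : R) :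
  (forall z w, `|f z - f w| <= k * rn (z - w)) -> continuous f.
Proof.
move=> H z; apply/real_continuousP => e e0.
have k0 : 0 < 1 + `|k| by rewrite ltr_pwDl.
exists (e / (1 + `|k|)); first by rewrite divr_gt0.
move=> w wz; apply: le_lt_trans (H w z) _.
rewrite ltr_pdivlMr// mulrC in wz; apply: le_lt_trans wz.
rewrite ler_wpM2r ?rn_ge0//; have := ler_norm k; lra.
Qed.

Lemma continuous_rn : continuous rn.
Proof.
apply: (@lipschitz_continuous _ 1) => z w; rewrite mul1r ler_norml; apply/andP; split.
  by have := rnD (w - z) z; rewrite subrK rnC; lra.
by have := rnD (z - w) w; rewrite subrK; lra.
Qed.

Lemma open_rnP (A : set (Cn R n)) :
  open A <-> forall z, A z -> exists2 e : R, 0 < e & forall w, rn (w - z) < e -> A w.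
Proof.
rewrite openE; split => H z Az; first by apply/nbhs_rnP; exact: H.
by apply/nbhs_rnP; exact: H.
Qed.

Lemma closure_rnP (A : set (Cn R n)) z :
  closure A z <-> forall e : R, 0 < e -> exists2 w, A w & rn (w - z) < e.
Proof.
split.
  by move=> Az e e0; have [w [Aw wz]] := Az _ (near_rn z e0); exists w.
move=> H B /nbhs_rnP[e e0 eB]; have [w Aw wz] := H e e0.
by exists w; split => //; exact: eB.
Qed.

Lemma continuous_coordRe j : continuous (fun z : Cn R n => Re (z ord0 j)).
Proof.
apply: (@lipschitz_continuous _ 1) => z w; rewrite mul1r.
apply: le_trans (rn_coord _ j); rewrite !mxE.
by apply: le_trans (Re_le_cabs _); rewrite raddfB.
Qed.

Lemma continuous_coordIm j : continuous (fun z : Cn R n => Im (z ord0 j)).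
Proof.
apply: (@lipschitz_continuous _ 1) => z w; rewrite mul1r.
apply: le_trans (rn_coord _ j); rewrite !mxE.
by apply: le_trans (Im_le_cabs _); rewrite raddfB.
Qed.

(** Tychonoff for a product of segments indexed by the 2n real coordinates, carried to C^n by the
    continuous map [g]. *)
Lemma compact_box (M : R) : compact [set z : Cn R n | forall j, `|Re (z ord0 j)| <= M /\ `|Im (z ord0 j)| <= M].
Proof.
pose g (f : (bool * 'I_n) -> R) : Cn R n := \row_j ((f (false, j))%:C + 'i * (f (true, j))%:C).
have gc : continuous (g : prod_topology (fun _ : bool * 'I_n => R^o) -> Cn R n).
  move=> f; apply/(@continuous_rnP _ _ (nbhs_filter f) g (g f)) => e e0.
  have H k : \forall t \near (f : prod_topology (fun _ : bool * 'I_n => R^o)), `|t k - f k| < e / 4.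
    have B : nbhs (f k : R^o) [set x : R^o | `|x - f k| < e / 4].
      apply/nbhs_ballP; exists (e / 4); first by rewrite /= divr_gt0.
      by move=> x /=; rewrite -ball_normE/= distrC.
    exact: (@proj_continuous _ (fun _ : bool * 'I_n => R^o) k f _ B).
  have := filter_forall (nbhs_filter f) H; apply: filterS => t Ht.
  apply: (@le_lt_trans _ _ (e / 2)); last by rewrite gtr_pMr// invf_lt1// ltr1n.
  apply/rn_leP; first by rewrite divr_ge0// ltW.
  move=> j; rewrite !mxE; apply: le_trans (cabs_le _) _.
  have := Ht (false, j); have := Ht (true, j).
  rewrite /= !(mul0r, mul1r, mulr0, addr0, sub0r, subr0, add0r, oppr0).
  lra.
have -> : [set z : Cn R n | forall j, `|Re (z ord0 j)| <= M /\ `|Im (z ord0 j)| <= M] =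
   g @` [set f | forall k, [set` `[- M, M]] (f k)].
  apply/seteqP; split => z /=.
    move=> H; exists (fun k => if k.1 then Im (z ord0 k.2) else Re (z ord0 k.2)).
      by move=> [[] j]/=; rewrite in_itv/= -ler_norml; case: (H j).
    apply/rowP => j; rewrite !mxE/=; case: (z ord0 j) => a b /=.
    by apply/eqP; rewrite eq_complex/= !(mul0r, mul1r, mulr0, addr0, sub0r, subr0, add0r, oppr0) !eqxx.
  move=> [f Hf <-] j; rewrite !mxE /= !(mul0r, mul1r, mulr0, addr0, sub0r, subr0, add0r, oppr0).
  by have := Hf (false, j); have := Hf (true, j); rewrite /= !in_itv/= !ler_norml.
have cK : compact ([set f | forall k, [set` `[- M, M]] (f k)] :
    set (prod_topology (fun _ : bool * 'I_n => R^o))).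
  exact: (@tychonoff _ (fun _ : bool * 'I_n => R^o) (fun=> [set` `[- M, M]])
    (fun k => @segment_compact R (- M) M)).
exact: (@continuous_compact _ _ (g : prod_topology _ -> _) _ (continuous_subspaceT gc) cK).
Qed.

Lemma compact_rn (A : set (Cn R n)) (M : R) :
  closed A -> (forall z, A z -> rn z <= M) -> compact A.
Proof.
move=> cA AM; apply: (@subclosed_compact (Cn R n) A _ cA (@compact_box M)) => z Az j /=.
have := le_trans (rn_coord z j) (AM z Az) => h.
by split; apply: le_trans h; [exact: Re_le_cabs|exact: Im_le_cabs].
Qed.

Lemma compact_rn_bounded (A : set (Cn R n)) : compact A -> exists M : R, forall z, A z -> rn z <= M.
Proof.
move=> cA; have [->|/set0P A0] := eqVneq A set0; first by exists 0 => z [].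
have [z _ H] := @compact_EVT_max _ _ rn A A0 cA (continuous_subspaceT continuous_rn).
by exists (rn z) => w Aw; apply: H; rewrite inE.
Qed.

End RealNorm.

(** * Compactness arguments and semicontinuous functions *)

Section Compactness.
Context {R : realType}.

Lemma ereal_between (x y : \bar R) : (x < y)%E ->
  exists r : R, (x < r%:E)%E /\ (r%:E < y)%E.
Proof.
case: x => [x||]; case: y => [y||] //= xy.
- exists ((x + y) / 2); rewrite !lte_fin; rewrite lte_fin in xy; lra.
- by exists (x + 1); rewrite lte_fin ltry; split => //; lra.
- by exists (y - 1); rewrite lte_fin ltNyr; split => //; lra.
- by exists 0; rewrite ltry ltNyr.
Qed.

Lemma lee_real_lt (x y : \bar R) :
  (forall a : R, (y < a%:E)%E -> (x <= a%:E)%E) -> (x <= y)%E.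
Proof.
move=> H; rewrite leNgt; apply/negP => /ereal_between[r [yr rx]].
by have := H r yr; rewrite leNgt rx.
Qed.

(** Directedness merges a finite subcover into a single member; the Dini-type arguments below rely
    on this form of compactness. *)
Lemma compact_directed (T : ptopologicalType) (K : set T) (I : choiceType)
    (D : set I) (U : I -> set T) :
  compact K -> D !=set0 -> (forall i, D i -> open (U i)) ->
  (forall i j, D i -> D j -> exists2 k, D k & U i `|` U j `<=` U k) ->
  (forall z, K z -> exists2 i, D i & U i z) ->
  exists2 i, D i & K `<=` U i.
Proof.
rewrite compact_cover => cK [i0 Di0] oU dU cov.
have [D' D'D KD'] := cK I D U oU cov.
suff H (s : seq I) : {in s, forall i, D i} ->
    exists2 k, D k & forall i, i \in s -> U i `<=` U k.
  have [|k Dk Hk] := H (finmap.enum_fset D').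
    by move=> i iD; have := D'D i iD; rewrite inE.
  exists k => // z /KD'[i iD Uiz]; exact: (Hk i).
elim: s => [|i s IH] Hs; first by exists i0.
have [|k Dk Hk] := IH; first by move=> j js; apply: Hs; rewrite inE js orbT.
have [|l Dl Hl] := dU i k _ Dk; first by apply: Hs; rewrite inE eqxx.
exists l => // j; rewrite inE => /orP[/eqP ->|js] z Uz; apply: Hl; first by left.
by right; exact: (Hk j).
Qed.

Context {n : nat}.
Implicit Types (A K G U Om : set (Cn R n)) (f u v : Cn R n -> \bar R).

Lemma open_near (P : Cn R n -> Prop) : open [set z : Cn R n | \forall w \near z, P w].
Proof. exact: open_interior. Qed.

Lemma compact_increasing K (U : nat -> set (Cn R n)) :
  compact K -> (forall k, open (U k)) -> (forall k l, (k <= l)%N -> U k `<=` U l) ->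
  (forall z, K z -> exists k, U k z) -> exists k, K `<=` U k.
Proof.
move=> cK oU mU cov.
have [||||k _ Hk] := @compact_directed (Cn R n) K nat setT U cK.
- by exists 0%N.
- by [].
- move=> i j _ _; exists (maxn i j) => // z [] Uz.
    by apply: mU Uz; rewrite leq_maxl.
  by apply: mU Uz; rewrite leq_maxr.
- by move=> z /cov[k Uk]; exists k.
by exists k.
Qed.

(** Without a maximum, the open sets {f < a}, for a below some value of f, form a directed cover of
    K. One of them would contain K, although f exceeds a somewhere on K. *)
Lemma usc_max K f : compact K -> K !=set0 -> usc_on K f ->
  exists2 z, K z & forall w, K w -> (f w <= f z)%E.
Proof.
move=> cK [z0 Kz0] uf; apply: contrapT => H.
have NM z : K z -> exists w, K w /\ (f z < f w)%E.
  move=> Kz; apply: contrapT => Hz; apply: H; exists z => // w Kw.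
  by rewrite leNgt; apply/negP => fzw; apply: Hz; exists w.
pose D := [set a : R | exists2 w, K w & (a%:E < f w)%E].
pose U (a : R) := [set z : Cn R n | \forall w \near z, K w -> (f w < a%:E)%E].
have [||||a [w Kw aw] KU] := @compact_directed (Cn R n) K R D U cK.
- have [w [Kw /ereal_between[r [_ rw]]]] := NM _ Kz0; by exists r, w.
- by move=> a _; exact: open_near.
- move=> a b Da Db; exists (Num.max a b).
    by rewrite /D /=; case: (leP a b).
  by move=> z [] Uz; apply: filterS Uz => w H1 /H1 h; apply: lt_le_trans h _;
    rewrite lee_fin le_max lexx ?orbT.
- move=> z Kz; have [w [Kw /ereal_between[r [zr rw]]]] := NM _ Kz.
  by exists r; [exists w|exact: uf].
by have := nbhs_singleton (KU w Kw) Kw; rewrite ltNge (ltW aw).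
Qed.

Lemma usc_onN K f : lsc_on K f -> usc_on K (fun z => - f z)%E.
Proof.
move=> lf z Kz a; rewrite lteNl => za.
have H := lf z Kz (- a); rewrite EFinN in H.
by apply: filterS (H za) => w; rewrite lteNl.
Qed.

Lemma lsc_onN K f : usc_on K f -> lsc_on K (fun z => - f z)%E.
Proof.
move=> lf z Kz a; rewrite lteNr => za.
have H := lf z Kz (- a); rewrite EFinN in H.
by apply: filterS (H za) => w; rewrite lteNr.
Qed.

Lemma usc_onW A K f : K `<=` A -> usc_on A f -> usc_on K f.
Proof.
move=> KA uf z Kz a za; have := uf z (KA z Kz) a za; rewrite !near_withinE.
by apply: filterS => w H Kw; apply: H; exact: KA.
Qed.

Lemma lsc_min K f : compact K -> K !=set0 -> lsc_on K f ->
  exists2 z, K z & forall w, K w -> (f z <= f w)%E.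
Proof.
move=> cK K0 /usc_onN /(usc_max cK K0)[z Kz H]; exists z => // w /H.
by rewrite leeN2.
Qed.

Lemma lsc_bounded_below K f : compact K -> lsc_on K f -> (forall z, K z -> (-oo < f z)%E) ->
  exists m : R, forall z, K z -> (m%:E <= f z)%E.
Proof.
move=> cK lf fK; have [->|/set0P K0] := eqVneq K set0; first by exists 0 => z [].
have [z Kz H] := lsc_min cK K0 lf.
have [r [_ rz]] := ereal_between (fK z Kz).
by exists r => w /H; apply: le_trans (ltW rz).
Qed.

Lemma compact_nbhd_ball K U : compact K -> open U -> K `<=` U ->
  exists2 d : R, 0 < d & forall z w, K z -> rn (w - z) < d -> U w.
Proof.
move=> cK /open_rnP oU KU.
pose V (k : nat) := [set z : Cn R n | \forall z' \near z, forall w, rn (w - z') < k.+1%:R^-1 -> U w].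
have [|||k Hk] := @compact_increasing K V cK.
- by move=> k; exact: open_near.
- move=> k l kl z; apply: filterS => z' H w wz; apply: H; apply: lt_le_trans wz _.
  by rewrite lef_pV2 ?posrE ?ltr0Sn// ler_nat.
- move=> z /KU /oU[e e0 He].
  have [k Hk] : exists k : nat, k.+1%:R^-1 < e / 2.
    have e2 : 0 < e / 2 by rewrite divr_gt0.
    exists (Num.truncn (e / 2)^-1).
    rewrite invf_plt ?posrE ?ltr0Sn//; exact: truncnS_gt.
  exists k; apply: filterS (near_rn z (_ : 0 < e / 2)); last by rewrite divr_gt0.
  move=> z' /= z'z w wz; apply: He; apply: le_lt_trans (rn_tri z' _ _) _.
  have := lt_trans wz Hk; lra.
exists k.+1%:R^-1 => // z w Kz; exact: (nbhs_singleton (Hk z Kz)).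
Qed.

Lemma closure_ball_sub (A : set (Cn R n)) (M : R) :
  (forall z, A z -> rn z <= M) -> forall z, closure A z -> rn z <= M.
Proof.
move=> H z /closure_rnP Hz; apply/ler_addgt0Pr => e e0.
have [w Aw wz] := Hz e e0; have := H w Aw; have := rnD (z - w) w.
rewrite subrK rnC; lra.
Qed.

Lemma compact_closure_bounded (A : set (Cn R n)) (M : R) :
  (forall z, A z -> rn z <= M) -> compact (closure A).
Proof.
move=> H; apply: (@compact_rn R n _ M); first exact: closed_closure.
exact: closure_ball_sub.
Qed.

Lemma rel_compact_nbhd K U : compact K -> open U -> K `<=` U ->
  exists2 G, K `<=` G & relatively_compact_open U G.
Proof.
move=> cK oU KU; have [d d0 Hd] := compact_nbhd_ball cK oU KU.
pose G := [set w : Cn R n | exists2 z, K z & rn (w - z) < d / 2].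
have d20 : 0 < d / 2 by rewrite divr_gt0.
exists G; first by move=> z Kz; exists z => //; rewrite subrr rn0.
split.
- apply/open_rnP => w [z Kz wz]; exists (d / 2 - rn (w - z)); first lra.
  move=> x xw; exists z => //; have := rn_tri w x z; lra.
- have [M HM] := compact_rn_bounded cK.
  apply: (@compact_closure_bounded _ (M + d)) => w [z Kz wz].
  have := HM z Kz; have := rnD (w - z) z; rewrite subrK; lra.
- move=> w /closure_rnP /(_ _ d20)[x [z Kz xz] xw]; apply: (Hd z) => //.
  have := rn_tri x w z; rewrite rnC in xw; lra.
Qed.

(** K is what is left of [closure D] after removing the open set of points near which Q holds on D;
    every boundary point is removed, so K lies in D. This turns boundary conditions stated with
    filters into conditions off a compact set, where relatively compact subdomains can be used. *)
Lemma near_boundary_compact D (Q : Cn R n -> Prop) :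
  open D -> compact (closure D) ->
  (forall x, boundary D x -> \forall z \near within D (nbhs x), Q z) ->
  exists K, [/\ compact K, K `<=` D & forall z, D z -> ~ K z -> Q z].
Proof.
move=> oD cD H.
pose V := [set z : Cn R n | \forall w \near z, D w -> Q w].
exists (closure D `&` ~` V); split.
- apply: compact_closedI => //; apply: open_closedC; exact: open_near.
- move=> z [cz nV]; apply: contrapT => nDz; apply: nV; apply: H.
  by split => //; rewrite (iffLR (@interior_id _ D) oD).
- move=> z Dz nK; have Vz : V z.
    by apply: contrapT => nV; apply: nK; split => //; exact: subset_closure.
  exact: (nbhs_singleton Vz).
Qed.

End Compactness.

(** * Upper and lower regularizations, Lipschitz approximation from below *)

Section Regularization.
Context {R : realType} {n : nat}.
Implicit Types (A K G S : set (Cn R n)) (f u v g : Cn R n -> \bar R).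

Lemma upper_reg_lt G f z (a : \bar R) : (upper_reg G f z < a)%E ->
  \forall w \near within G (nbhs z), (f w < a)%E.
Proof.
move=> /ereal_inf_lt[_ [V FV <-]] H; apply: filterS FV => w Vw.
by apply: le_lt_trans H; apply: ereal_sup_ubound; exists w.
Qed.

Lemma upper_reg_le G f z (c : \bar R) :
  (\forall w \near within G (nbhs z), (f w <= c)%E) -> (upper_reg G f z <= c)%E.
Proof.
move=> H; apply: (@le_trans _ _ (ereal_sup (f @` [set w | (f w <= c)%E]))).
  by apply: ereal_inf_lbound; exists [set w | (f w <= c)%E].
by apply: ge_ereal_sup => _ [w /= wc <-].
Qed.

Lemma lower_reg_gt G f z (a : \bar R) : (a < lower_reg G f z)%E ->
  \forall w \near within G (nbhs z), (a < f w)%E.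
Proof.
rewrite /lower_reg /limf_einf lteNr => /upper_reg_lt; apply: filterS => w.
by rewrite lteN2.
Qed.

Lemma le_upper_reg G f z : G z -> (f z <= upper_reg G f z)%E.
Proof.
move=> Gz; apply: le_ereal_inf_tmp => _ [V FV <-]; apply: ereal_sup_ubound.
by exists z => //; exact: (nbhs_singleton FV Gz).
Qed.

Lemma lower_reg_le G f z : G z -> (lower_reg G f z <= f z)%E.
Proof.
move=> Gz; rewrite /lower_reg /limf_einf leeNl; exact: (@le_upper_reg G (fun z => - f z)%E).
Qed.

Lemma upper_reg_usc G f A : usc_on A (upper_reg G f).
Proof.
move=> z _ a /ereal_between[b [zb ba]]; apply: cvg_within.
have := upper_reg_lt zb; rewrite near_withinE => /nbhs_interior; apply: filterS => w H.
by apply: le_lt_trans ba; apply: upper_reg_le; apply: filterS H => x H /H /ltW.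
Qed.

Lemma upper_reg_id G f z : usc_on G f -> G z -> upper_reg G f z = f z.
Proof.
move=> uf Gz; apply/eqP; rewrite eq_le le_upper_reg// andbT.
apply: lee_real_lt => a /uf -/(_ Gz) H; apply: upper_reg_le.
by apply: filterS H => w /ltW.
Qed.

Lemma upper_reg_mono G f g z : (forall w, G w -> (f w <= g w)%E) ->
  (upper_reg G f z <= upper_reg G g z)%E.
Proof.
move=> fg; apply: lee_real_lt => a /upper_reg_lt H; apply: upper_reg_le.
near=> w; apply: (le_trans (fg w _)); first by near: w; exact: withinT.
by apply: ltW; near: w.
Unshelve. all: by end_near. Qed.

(** Together with monotonicity, this makes u^* <= phi^* on the closure a consequence of u <= phi^*
    on the open set alone. *)
Lemma upper_reg_idem G f z : (upper_reg G (upper_reg G f) z <= upper_reg G f z)%E.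
Proof.
apply: lee_real_lt => a ha; apply: upper_reg_le.
have := @upper_reg_usc G f setT z I a ha; rewrite withinET.
by move=> H; apply: cvg_within; apply: filterS H => w /ltW.
Qed.

Lemma cvg_ereal (T : Type) (F : set_system T) (FF : Filter F) (f : T -> \bar R) l :
  (forall a : R, (a%:E < l)%E -> \forall t \near F, (a%:E < f t)%E) ->
  (forall a : R, (l < a%:E)%E -> \forall t \near F, (f t < a%:E)%E) ->
  f @ F --> l.
Proof.
case: l => [r||] Ha Hb A.
- move=> nA; have /nbhs_ballP[e /= e0 eA] : nbhs r (fun x : R => A x%:E) by exact: nA.
  have h1 := Ha (r - e); have h2 := Hb (r + e); rewrite !lte_fin in h1 h2.
  apply: filterS2 (h1 _) (h2 _); [|lra|lra] => t.
  case E : (f t) => [s||] //; rewrite !lte_fin => a1 a2.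
  suff : A (f t) by []; rewrite E; apply: eA; rewrite -ball_normE /= ltr_norml; lra.
- move=> [M [Mr HM]]; apply: filterS (Ha M _); [|by rewrite ltry].
  by move=> t; exact: HM.
- move=> [M [Mr HM]]; apply: filterS (Hb M _); [|by rewrite ltNyr].
  by move=> t; exact: HM.
Qed.

(* The truncation [mine _ k] keeps [fine] away from its junk value at +oo. *)
Definition lipreg S v (k : nat) (x : Cn R n) : R :=
  inf [set fine (mine (v y) k%:R%:E) + k%:R * rn (x - y) | y in S].

Section Lipreg.
Variables (S : set (Cn R n)) (v : Cn R n -> \bar R) (m : R).
Hypothesis S0 : S !=set0.
Hypothesis mv : forall y, S y -> (m%:E <= v y)%E.

Let trunc k y : S y -> (fine (mine (v y) k%:R%:E))%:E = mine (v y) k%:R%:E.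
Proof.
move=> Sy; apply: fineK; have := mv Sy; case: (v y) => [r||]//= _.
by rewrite -EFin_min.
Qed.

Let trunc_ge k y (a : R) : S y -> (a%:E <= v y)%E -> Num.min a k%:R <= fine (mine (v y) k%:R%:E).
Proof.
move=> Sy av; rewrite -lee_fin trunc// EFin_min; exact: le_min2.
Qed.

Let lb k x : lbound [set fine (mine (v y) k%:R%:E) + k%:R * rn (x - y) | y in S] (Num.min m 0).
Proof.
move=> _ [y Sy <-]; have := @trunc_ge k _ _ Sy (mv Sy).
have : 0 <= k%:R * rn (x - y) by rewrite mulr_ge0 ?rn_ge0.
have : Num.min m 0 <= Num.min m k%:R by apply: le_min2.
lra.
Qed.

Lemma lipreg_ub k x y : S y -> lipreg S v k x <= fine (mine (v y) k%:R%:E) + k%:R * rn (x - y).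
Proof. by move=> Sy; apply: ge_inf; [exists (Num.min m 0); exact: lb|exists y]. Qed.

Lemma lipreg_lb k x (a : R) : (forall y, S y -> a <= fine (mine (v y) k%:R%:E) + k%:R * rn (x - y)) ->
  a <= lipreg S v k x.
Proof.
move=> H; apply: lb_le_inf; last by move=> _ [y Sy <-]; exact: H.
by case: S0 => y Sy; eexists; exists y.
Qed.

Lemma lipreg_lip k x x' : `|lipreg S v k x - lipreg S v k x'| <= k%:R * rn (x - x').
Proof.
wlog: x x' / lipreg S v k x' <= lipreg S v k x.
  move=> H; case: (leP (lipreg S v k x') (lipreg S v k x)); first exact: H.
  by move=> /ltW h; rewrite distrC rnC; exact: H.
move=> h; rewrite ger0_norm ?subr_ge0// lerBlDr addrC -lerBlDr.
apply: lipreg_lb => y Sy; have := lipreg_ub k x Sy.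
have : k%:R * rn (x - y) <= k%:R * rn (x - x') + k%:R * rn (x' - y).
  by rewrite -mulrDr ler_wpM2l// rn_tri.
lra.
Qed.

Lemma lipreg_le k x : S x -> ((lipreg S v k x)%:E <= v x)%E.
Proof.
move=> Sx; have := lipreg_ub k x Sx; rewrite subrr rn0 mulr0 addr0 -lee_fin trunc//.
by move=> /le_trans; apply; rewrite ge_min lexx.
Qed.

Lemma lipreg_mono k l x : (k <= l)%N -> lipreg S v k x <= lipreg S v l x.
Proof.
move=> kl; apply: lipreg_lb => y Sy; apply: le_trans (lipreg_ub k x Sy) _.
apply: lerD; last by rewrite ler_wpM2r ?rn_ge0// ler_nat.
by rewrite -lee_fin !trunc//; apply: le_min2 => //; rewrite lee_fin ler_nat.
Qed.

(** The point x need not lie in S: at a boundary point of S the regularizations reach every real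
    below the lower limit. This is how phi_* on the boundary is later approximated by continuous
    data. *)
Lemma lipreg_cvg x (a : R) : (\forall y \near within S (nbhs x), (a%:E < v y)%E) ->
  exists k, a <= lipreg S v k x.
Proof.
move=> /nbhs_rnP[d d0 Hd].
(* [|a| <= k] keeps the truncation at k from cutting below a at the points near x;
   [|a| + |m| <= k d] makes the penalty alone sufficient for points at distance at least d. *)
have [k Hk] : exists k : nat, Num.max (`|a|) ((`|a| + `|m|) / d) <= k%:R.
  by eexists; apply: ltW; exact: truncnS_gt.
move: Hk; rewrite ge_max => /andP[ak]; rewrite ler_pdivrMr// => mk.
exists k; apply: lipreg_lb => y Sy.
have [yx|yx] := ltP (rn (y - x)) d.
  have := trunc_ge k Sy (ltW (Hd y yx Sy)).
  rewrite min_l; last by apply: le_trans ak; exact: ler_norm.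
  have : 0 <= k%:R * rn (x - y) by rewrite mulr_ge0 ?rn_ge0.
  lra.
have : k%:R * d <= k%:R * rn (x - y) by rewrite ler_wpM2l// rnC.
have := @trunc_ge k _ _ Sy (mv Sy).
have : - `|m| <= Num.min m k%:R.
  rewrite le_min lerNnormlW//=.
  by apply: (@le_trans _ _ 0) => //; rewrite oppr_le0.
have := ler_norm a; lra.
Qed.

End Lipreg.

Definition lipschitz_rn (f : Cn R n -> R) : Prop :=
  exists k : R, forall x y, `|f x - f y| <= k * rn (x - y).

Lemma lipschitz_rn_continuous (f : Cn R n -> R) : lipschitz_rn f -> continuous f.
Proof. by move=> [k Hk]; exact: (@lipschitz_continuous R n f k). Qed.

(** The Lipschitz regularizations of v increase to v, so at each point of K one of them exceeds u,
    and by semicontinuity of u also nearby; compactness makes a single index work on all of K. *)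
Lemma sandwich K u v : compact K -> usc_on K u -> lsc_on K v ->
  (forall z, K z -> (u z < v z)%E) ->
  exists f : Cn R n -> R, lipschitz_rn f /\
    (forall z, K z -> (u z < (f z)%:E)%E /\ ((f z)%:E <= v z)%E).
Proof.
move=> cK uu lv uv; have [->|/set0P K0] := eqVneq K set0.
  by exists (fun=> 0); split => //; exists 0 => x y; rewrite subrr normr0 mul0r.
have [|m mv] := lsc_bounded_below cK lv.
  by move=> z Kz; exact: (le_lt_trans (leNye _) (uv z Kz)).
pose V k := [set z : Cn R n | \forall w \near z, K w -> (u w < (lipreg K v k w)%:E)%E].
have [|||k Hk] := @compact_increasing R n K V cK.
- by move=> k; exact: open_near.
- move=> k l kl z; apply: filterS => w H /H h; apply: lt_le_trans h _.
  by rewrite lee_fin (lipreg_mono K0 mv).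
- move=> z Kz; have [a [ua av]] := ereal_between (uv z Kz).
  have [a' [ua' aa']] := ereal_between ua.
  have [k Hk] := lipreg_cvg K0 mv (lv z Kz a av).
  exists k; have /real_continuousP := @lipschitz_continuous R n _ _ (lipreg_lip K0 mv k) z.
  rewrite lte_fin in aa'; move=> /(_ (a - a')); rewrite subr_gt0 => /(_ aa')[d d0 Hd].
  have := uu z Kz a' ua'; rewrite /V/= near_withinE => H; have := near_rn z d0 => H2.
  apply: filterS2 H2 H => w wz H Kw; apply: (@lt_le_trans _ _ a'%:E); first exact: H.
  by have := Hd w wz; rewrite lee_fin ltr_norml => /andP[]; lra.
exists (lipreg K v k); split; first by exists k%:R; exact: (lipreg_lip K0 mv).
move=> z Kz; split; first exact: (nbhs_singleton (Hk z Kz)).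
exact: (lipreg_le mv).
Qed.

End Regularization.

(** * Closure properties of harmonic functions *)

Section HarmonicData.
Context {R : realType} {n : nat}.
Implicit Types (G : set (Cn R n)) (h : Cn R n -> R).
Local Notation dir := (bool * 'I_n)%type.

Lemma rn_real_dir (k : dir) : rn (@real_dir R n k) <= 1.
Proof.
apply/rn_leP => // j; rewrite /real_dir !mxE.
have H : cabs (if k.1 then 'i else 1 : R[i]) <= 1.
  by case: k.1; rewrite cabs_def /= ?expr0n ?expr1n ?add0r ?addr0 ?sqrtr1.
have H2 (b : bool) : cabs (b%:R : R[i]) <= 1.
  by case: b; rewrite cabs_def /= ?expr0n ?expr1n ?add0r ?addr0 ?sqrtr1 ?sqrtr0.
by rewrite cabsM mulr_ile1 ?cabs_ge0.
Qed.

Lemma rn_real_line (z : Cn R n) k (t : R) : rn (real_line z k t - z) <= `|t|.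
Proof.
rewrite /real_line addrC addKr rnZ cabs_real.
by rewrite -[leRHS]mulr1 ler_wpM2l// rn_real_dir.
Qed.

Lemma real_line0 (z : Cn R n) k : real_line z k 0 = z.
Proof. by rewrite /real_line scale0r addr0. Qed.

Lemma real_lineD (z : Cn R n) k (t s : R) :
  real_line z k (t + s) = real_line (real_line z k t) k s.
Proof. by rewrite /real_line rmorphD scalerDl addrA. Qed.

Lemma near_real_line (P : Cn R n -> Prop) z k :
  (\forall w \near z, P w) -> \forall t \near (0 : R), P (real_line z k t).
Proof.
move=> /nbhs_rnP[e e0 He]; apply/nbhs_ballP; exists e => // t; rewrite -ball_normE /= sub0r normrN => te.
by apply: He; exact: le_lt_trans (rn_real_line _ _ _) te.
Qed.

Lemma open_nbhs_near G z : open G -> G z -> \forall w \near z, G w.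
Proof. by rewrite openE => oG /oG. Qed.

Lemma near_eq_continuous (f g : Cn R n -> R) z : (\forall w \near z, f w = g w) ->
  {for z, continuous f} -> {for z, continuous g}.
Proof.
move=> fg /real_continuousP cf; apply/real_continuousP => e e0.
have [d d0 Hd] := cf e e0; have /nbhs_rnP[d' d'0 Hd'] := fg.
exists (Num.min d d'); first by rewrite lt_min d0.
move=> w; rewrite lt_min => /andP[wd wd'].
by rewrite -Hd'// -(Hd' z) ?subrr ?rn0//; exact: Hd.
Qed.

(** First and second derivatives are given as explicit witnesses, so that harmonicity can be checked
    with the rules of differentiation instead of by unfolding [partial]. *)
Definition harmonic_data G h (D : dir -> Cn R n -> R) (DD : dir -> dir -> Cn R n -> R) : Prop :=
  (forall z, G z -> [/\ {for z, continuous h},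
    (forall k, is_derive (0 : R) 1 (fun t => h (real_line z k t)) (D k z)),
    (forall k, {for z, continuous (D k)}),
    (forall k k', is_derive (0 : R) 1 (fun t => D k' (real_line z k t)) (DD k k' z)) &
    (forall k k', {for z, continuous (DD k k')})]).

Lemma is_derive_partial h z k : derivable (fun t : R => h (real_line z k t)) 0 1 ->
  is_derive (0 : R) 1 (fun t => h (real_line z k t)) (partial k h z).
Proof. by move=> dk; split; [exact: dk|rewrite -derive1E]. Qed.

Lemma harmonic_data_of G h : harmonic_on G h ->
  harmonic_data G h (fun k => partial k h) (fun k k' => partial k (partial k' h)).
Proof.
move=> [[C1 C2] _] z Gz; have [ch dh] := C1 z Gz; split=> [|k|k|k k'|k k'].
- exact: ch.
- by have [dk _] := dh k; exact: is_derive_partial.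
- by have [_] := dh k.
- by have [_ H] := C2 k' z Gz; have [dk _] := H k; exact: is_derive_partial.
- by have [_ H] := C2 k' z Gz; have [_] := H k.
Qed.

Lemma C1_on_intro G h D : open G ->
  (forall z, G z -> [/\ {for z, continuous h},
    (forall k, is_derive (0 : R) 1 (fun t => h (real_line z k t)) (D k z)) &
    (forall k, {for z, continuous (D k)})]) ->
  C1_on G h /\ forall z k, G z -> partial k h z = D k z.
Proof.
move=> oG H; have E z k : G z -> partial k h z = D k z.
  by move=> Gz; have [_ dh _] := H z Gz; rewrite /partial derive1E; apply: derive_val.
split => // z Gz; have [ch dh cD] := H z Gz; split => // k; split.
  by apply: ex_derive; exact: dh.
apply: near_eq_continuous (cD k); apply: filterS (open_nbhs_near oG Gz) => w Gw.
by rewrite E.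
Qed.

Lemma near_is_derive_line (f g : Cn R n -> R) z k d : (\forall w \near z, f w = g w) ->
  is_derive (0 : R) 1 (fun t => f (real_line z k t)) d ->
  is_derive (0 : R) 1 (fun t => g (real_line z k t)) d.
Proof. by move=> fg; apply: near_eq_is_derive; exact: near_real_line fg. Qed.

Lemma harmonic_intro G h D DD : open G -> harmonic_data G h D DD ->
  (forall z, G z -> \sum_k DD k k z = 0) -> harmonic_on G h.
Proof.
move=> oG H tr; have [|C1 E] := @C1_on_intro G h D oG.
  by move=> z /H[].
have near_E k z : G z -> \forall w \near z, D k w = partial k h w.
  by move=> Gz; apply: filterS (open_nbhs_near oG Gz) => w Gw; rewrite E.
have C2 k : C1_on G (partial k h) /\
    forall z k', G z -> partial k' (partial k h) z = DD k' k z.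
  apply: (@C1_on_intro G _ (fun k' => DD k' k) oG) => z Gz.
  have [_ _ cD dD cDD] := H z Gz; split.
  - exact: near_eq_continuous (near_E k z Gz) (cD k).
  - by move=> k'; exact: near_is_derive_line (near_E k z Gz) (dD k' k).
  - by move=> k'; exact: cDD.
split; first by split => // k; case: (C2 k).
move=> z Gz; rewrite -[RHS](tr z Gz); apply: eq_bigr => k _.
by case: (C2 k) => _ ->.
Qed.

Lemma harmonic_data_trace G h : harmonic_on G h -> exists D DD,
  harmonic_data G h D DD /\ (forall z, G z -> \sum_k DD k k z = 0).
Proof.
move=> H; exists (fun k => partial k h), (fun k k' => partial k (partial k' h)).
by split; [exact: harmonic_data_of|case: H].
Qed.

Lemma harmonic_sub G G' h : G' `<=` G -> harmonic_on G h -> harmonic_on G' h.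
Proof.
move=> GG [[C1 C2] tr]; split; last by move=> z /GG; exact: tr.
by split; [move=> z /GG; exact: C1|move=> k z /GG; exact: C2].
Qed.

Lemma harmonic_continuous G h z : harmonic_on G h -> G z -> {for z, continuous h}.
Proof. by move=> [[C1 _] _] /C1[]. Qed.

Lemma harmonicD G h1 h2 : open G -> harmonic_on G h1 -> harmonic_on G h2 ->
  harmonic_on G (fun z => h1 z + h2 z).
Proof.
move=> oG /harmonic_data_trace[D1 [DD1 [H1 t1]]] /harmonic_data_trace[D2 [DD2 [H2 t2]]].
apply: (@harmonic_intro _ _ (fun k z => D1 k z + D2 k z)
  (fun k k' z => DD1 k k' z + DD2 k k' z) oG).
  move=> z Gz; have [a1 b1 c1 d1 e1] := H1 z Gz; have [a2 b2 c2 d2 e2] := H2 z Gz.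
  split=> [|k|k|k k'|k k'].
  - exact: continuousD.
  - exact: is_deriveD.
  - exact: continuousD.
  - exact: is_deriveD.
  - exact: continuousD.
by move=> z Gz; rewrite big_split /= t1// t2// addr0.
Qed.

Lemma is_derive_cM (f : R -> R) (x c d : R) :
  is_derive x 1 f d -> is_derive x 1 (fun t => c * f t) (c * d).
Proof. exact: (@is_deriveZ R R^o R^o). Qed.

Lemma harmonicZ G (c : R) h : open G -> harmonic_on G h -> harmonic_on G (fun z => c * h z).
Proof.
move=> oG /harmonic_data_trace[D1 [DD1 [H1 t1]]].
apply: (@harmonic_intro _ _ (fun k z => c * D1 k z)
  (fun k k' z => c * DD1 k k' z) oG).
  move=> z Gz; have [a1 b1 c1 d1 e1] := H1 z Gz.
  split=> [|k|k|k k'|k k'].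
  - apply: continuousM => //; exact: cst_continuous.
  - exact: is_derive_cM.
  - apply: continuousM => //; exact: cst_continuous.
  - exact: is_derive_cM.
  - apply: continuousM => //; exact: cst_continuous.
by move=> z Gz; rewrite -big_distrr /= t1// mulr0.
Qed.

Lemma is_derive_quadratic (f : R -> R) (a b c : R) : (forall t, f t = a + t * b + t ^+ 2 * c) ->
  is_derive (0 : R) 1 f b.
Proof.
move=> fE; have -> : f = (fun t => a + t * b + t ^+ 2 * c) by apply/funext.
have h1 : is_derive (0 : R) 1 (fun t : R => t) 1 by exact: is_derive_id.
apply: is_derive_eq; rewrite /GRing.scale/=; ring.
Qed.

Lemma harmonic_affine G h (c : dir -> R) : open G -> continuous h ->
  (forall z k t, h (real_line z k t) = h z + t * c k) -> harmonic_on G h.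
Proof.
move=> oG ch E.
apply: (@harmonic_intro _ _ (fun k z => c k) (fun _ _ _ => 0) oG); last first.
  by move=> z Gz; rewrite big1.
move=> z Gz; split=> [|k|k|k k'|k k'].
- exact: ch.
- by apply: (@is_derive_quadratic _ (h z) _ 0) => t; rewrite E mulr0 addr0.
- exact: cst_continuous.
- exact: is_derive_cst.
- exact: cst_continuous.
Qed.

Lemma harmonic_cst G (a : R) : open G -> harmonic_on G (fun=> a).
Proof.
move=> oG; apply: (@harmonic_affine _ _ (fun=> 0) oG); first exact: cst_continuous.
by move=> z k t; rewrite mulr0 addr0.
Qed.

Lemma harmonicN G h : open G -> harmonic_on G h -> harmonic_on G (fun z => - h z).
Proof.
move=> oG H; have := harmonicZ (-1) oG H.
by congr harmonic_on; apply/funext => z; rewrite mulN1r.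
Qed.

(** The similarity of ratio s that sends z0 to p. The preimage of N under it, with ratio s^-1, is a
    copy of N around z0 shrunk by the factor s. *)
Definition rescale (p z0 : Cn R n) (s : R) (z : Cn R n) : Cn R n := p + (s%:C : R[i]) *: (z - z0).

Lemma rn_rescale p z0 s z w : rn (rescale p z0 s z - rescale p z0 s w) = `|s| * rn (z - w).
Proof. have E (a b c : Cn R n) : (a + b) - (a + c) = b - c by rewrite opprD addrACA subrr add0r.
rewrite /rescale E -scalerBr rnZ cabs_real; congr (_ * rn _).
by rewrite opprB addrA subrK. Qed.

Lemma rescale_real_line p z0 s z k t :
  rescale p z0 s (real_line z k t) = real_line (rescale p z0 s z) k (s * t).
Proof.
rewrite /rescale /real_line -[RHS]addrA; congr (_ + _).
by rewrite rmorphM -scalerA -scalerDr addrAC.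
Qed.

Lemma continuous_rescale p z0 s : continuous (rescale p z0 s).
Proof.
move=> z; apply/(@continuous_rnP R n _ _ (nbhs_filter z)) => e e0.
have s0 : 0 < 1 + `|s| by rewrite ltr_pwDl.
apply: filterS (near_rn z (_ : 0 < e / (1 + `|s|))); last by rewrite divr_gt0.
move=> w /=; rewrite ltr_pdivlMr// mulrC => wz; rewrite rn_rescale; apply: le_lt_trans wz.
by rewrite ler_wpM2r ?rn_ge0// lerDr.
Qed.

Lemma continuous_comp_rescale h p z0 s z : {for rescale p z0 s z, continuous h} ->
  {for z, continuous (h \o rescale p z0 s)}.
Proof. by move=> ch; apply: continuous_comp => //; exact: continuous_rescale. Qed.

Lemma open_rescale G p z0 s : open G -> open (rescale p z0 s @^-1` G).
Proof. by move=> oG; apply: open_comp => // z _; exact: continuous_rescale. Qed.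

Lemma is_derive_scale (f : R -> R) (s d : R) :
  is_derive (0 : R) 1 f d -> is_derive (0 : R) 1 (fun t => f (s * t)) (s * d).
Proof.
move=> df; rewrite mulrC; apply: (@is_derive1_comp R f (fun t => s * t)).
  by rewrite mulr0.
by apply: (@is_derive_quadratic _ 0 _ 0) => t; ring.
Qed.

Lemma harmonic_rescale G h p z0 s : open G -> harmonic_on G h ->
  harmonic_on (rescale p z0 s @^-1` G) (h \o rescale p z0 s).
Proof.
move=> oG /harmonic_data_trace[D1 [DD1 [H1 t1]]].
apply: (@harmonic_intro _ _ (fun k z => s * D1 k (rescale p z0 s z))
  (fun k k' z => s * (s * DD1 k k' (rescale p z0 s z)))); first exact: open_rescale.
  move=> z Gz; have [a1 b1 c1 d1 e1] := H1 _ Gz.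
  split=> [|k|k|k k'|k k'].
  - exact: continuous_comp_rescale.
  - under eq_fun do rewrite /= rescale_real_line.
    exact: (@is_derive_scale (fun t => h (real_line (rescale p z0 s z) k t))).
  - apply: continuousM; [exact: cst_continuous|exact: continuous_comp_rescale].
  - have E : (fun t : R => s * D1 k' (rescale p z0 s (real_line z k t))) =
        (fun t => s * D1 k' (real_line (rescale p z0 s z) k (s * t))).
      by apply/funext => t; rewrite rescale_real_line.
    rewrite E; exact: (@is_derive_cM (fun t => D1 k' (real_line (rescale p z0 s z) k (s * t))) 0 s _
      (@is_derive_scale (fun t => D1 k' (real_line (rescale p z0 s z) k t)) s _ (d1 k k'))).
  - apply: continuousM; first exact: cst_continuous.
    apply: continuousM; [exact: cst_continuous|].
    exact: (@continuous_comp_rescale (DD1 k k')).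
by move=> z Gz; rewrite -2!big_distrr /= t1// !mulr0.
Qed.

End HarmonicData.

(** * Second-order Taylor expansion along one complex coordinate *)

Section Taylor.
Context {R : realType}.

(** Mean value theorem for f minus the quadratic polynomial. It is applied with b = 0 to first
    derivatives and then, with the resulting errors as c, to h itself. *)
Lemma second_order_bound (f f' : R -> R) (a b c x : R) :
  (forall t : R, `|t| <= `|x| -> is_derive t 1 f (f' t)) ->
  (forall t : R, `|t| <= `|x| -> `|f' t - (a + b * t)| <= c) ->
  `|f x - f 0 - a * x - b * x ^+ 2 / 2| <= c * `|x|.
Proof.
move=> df f'c; pose g t := f t - (a * t + b * t ^+ 2 / 2).
have dg (t : R) : `|t| <= `|x| -> is_derive t 1 g (f' t - (a + b * t)).
  move=> tx; have h1 := df t tx; rewrite /g; apply: is_deriveB.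
  by apply: is_derive_eq; rewrite /GRing.scale/=; field.
have -> : f x - f 0 - a * x - b * x ^+ 2 / 2 = g x - g 0 by rewrite /g; field.
have [x0|x0|->] := ltgtP x 0; last by rewrite subrr !normr0 mulr0.
- have xE : `|x| = - x by rewrite ltr0_norm.
  have [||d] := @MVT R g (fun t => f' t - (a + b * t)) x 0 x0.
  + by move=> t; rewrite in_itv/= => /andP[xt t0]; apply: dg; rewrite xE ltr0_norm//; lra.
  + apply: derivable_within_continuous => t; rewrite in_itv/= => /andP[xt t0].
    by apply: ex_derive; apply: dg; rewrite xE ler0_norm//; lra.
  rewrite in_itv/= => /andP[xd d0] E.
  rewrite distrC E sub0r normrM normrN ler_wpM2r//; apply: f'c.
  by rewrite xE ltr0_norm//; lra.
- have xE : `|x| = x by rewrite gtr0_norm.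
  have [||d] := @MVT R g (fun t => f' t - (a + b * t)) 0 x x0.
  + by move=> t; rewrite in_itv/= => /andP[xt t0]; apply: dg; rewrite xE gtr0_norm//; lra.
  + apply: derivable_within_continuous => t; rewrite in_itv/= => /andP[xt t0].
    by apply: ex_derive; apply: dg; rewrite xE ger0_norm//; lra.
  rewrite in_itv/= => /andP[xd d0] E.
  rewrite E subr0 normrM ler_wpM2r//; apply: f'c.
  by rewrite xE gtr0_norm//; lra.
Qed.

Let regroup2 (u v w p q : R) : u - (w + p + q) = (u - v - q) + (v - w - p).
Proof. by ring. Qed.

Let regroup1 (u v w a b c d e x y : R) :
  u - (w + a * x + b * y + c * x ^+ 2 / 2 + d * x * y + e * y ^+ 2 / 2) =
  (u - v - (a + d * y) * x - c * x ^+ 2 / 2) + (v - w - b * y - e * y ^+ 2 / 2).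
Proof. by ring. Qed.

Context {n : nat}.
Local Notation dir := (bool * 'I_n)%type.

Lemma is_derive_line (f : Cn R n -> R) (d : R) (z : Cn R n) (k : dir) (t : R) :
  is_derive (0 : R) 1 (fun s => f (real_line (real_line z k t) k s)) d ->
  is_derive t 1 (fun s => f (real_line z k s)) d.
Proof.
move=> H.
have -> : (fun s => f (real_line z k s)) =
    (fun s => f (real_line (real_line z k t) k s)) \o (fun s => s - t).
  by apply/funext => s /=; rewrite -real_lineD addrCA subrr addr0.
rewrite -[d]mulr1; apply: is_derive1_comp; first by rewrite subrr.
by apply: is_derive_eq; rewrite ?subr0.
Qed.

(** The path from z runs first in the imaginary and then in the real direction of coordinate j, so
    the mixed coefficient is the derivative along the former of [D (false, j)]. *)
Lemma harmonic_taylor (G : set (Cn R n)) (h : Cn R n -> R) D DD (z : Cn R n) (j : 'I_n) (e : R) :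
  open G -> harmonic_data G h D DD -> G z -> 0 < e ->
  exists2 r : R, 0 < r & forall x y : R, `|x| < r -> `|y| < r ->
   `|h (real_line (real_line z (true, j) y) (false, j) x) -
     (h z + D (false, j) z * x + D (true, j) z * y
      + DD (false, j) (false, j) z * x ^+ 2 / 2 + DD (true, j) (false, j) z * x * y
      + DD (true, j) (true, j) z * y ^+ 2 / 2)| <= e * (x ^+ 2 + y ^+ 2).
Proof.
move=> oG H Gz e0; set kx := (false, j); set ky := (true, j).
have e30 : 0 < e / 2 by rewrite divr_gt0.
have [_ _ _ _ cDD] := H z Gz.
have [r0 r00 Hr0] := iffLR (open_rnP _) oG z Gz.
have [r1 r10 Hr1] := iffLR (real_continuousP _ _) (cDD kx kx) _ e30.
have [r2 r20 Hr2] := iffLR (real_continuousP _ _) (cDD ky kx) _ e30.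
have [r3 r30 Hr3] := iffLR (real_continuousP _ _) (cDD ky ky) _ e30.
pose r := Num.min (Num.min r0 r1) (Num.min r2 r3).
have rr0 : r <= r0 by rewrite /r !ge_min lexx.
have rr1 : r <= r1 by rewrite /r !ge_min lexx ?orbT.
have rr2 : r <= r2 by rewrite /r !ge_min lexx ?orbT.
have rr3 : r <= r3 by rewrite /r !ge_min lexx ?orbT.
exists (r / 2); first by rewrite divr_gt0// /r !lt_min r00 r10 r20.
move=> x y xr yr.
have clz (s t : R) : `|s| <= `|x| -> `|t| <= `|y| ->
    rn (real_line (real_line z ky t) kx s - z) < r.
  move=> sx ty; apply: le_lt_trans (rn_tri (real_line z ky t) _ _) _.
  have := rn_real_line (real_line z ky t) kx s; have := rn_real_line z ky t; lra.
have clz0 (t : R) : `|t| <= `|y| -> rn (real_line z ky t - z) < r.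
  by move=> ty; have := clz 0 t _ ty; rewrite real_line0; apply; rewrite normr0.
have Gl (s t : R) : `|s| <= `|x| -> `|t| <= `|y| -> G (real_line (real_line z ky t) kx s).
  by move=> sx ty; apply: Hr0; apply: lt_le_trans (clz _ _ sx ty) rr0.
have Gl0 (t : R) : `|t| <= `|y| -> G (real_line z ky t).
  by move=> ty; apply: Hr0; apply: lt_le_trans (clz0 _ ty) rr0.
have dh w k t : G (real_line w k t) -> is_derive t 1 (fun s => h (real_line w k s)) (D k (real_line w k t)).
  by move=> /H[_ dh _ _ _]; apply: is_derive_line; exact: dh.
have dD w k k' t : G (real_line w k t) -> is_derive t 1 (fun s => D k' (real_line w k s)) (DD k k' (real_line w k t)).
  by move=> /H[_ _ _ dD _]; apply: is_derive_line; exact: dD.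
have B1 t : `|t| <= `|y| -> `|D ky (real_line z ky t) - D ky z - DD ky ky z * t| <= e / 2 * `|t|.
  move=> ty.
  have := @second_order_bound (fun s => D ky (real_line z ky s)) (fun s => DD ky ky (real_line z ky s)) (DD ky ky z) 0 (e / 2) t.
  rewrite real_line0 !mul0r subr0; apply.
    by move=> s st; apply: dD; apply: Gl0; exact: le_trans ty.
  move=> s st; rewrite mul0r addr0; apply/ltW/Hr3; apply: lt_le_trans rr3; apply: clz0.
  exact: le_trans ty.
have B2 t : `|t| <= `|y| -> `|D kx (real_line z ky t) - D kx z - DD ky kx z * t| <= e / 2 * `|t|.
  move=> ty.
  have := @second_order_bound (fun s => D kx (real_line z ky s)) (fun s => DD ky kx (real_line z ky s)) (DD ky kx z) 0 (e / 2) t.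
  rewrite real_line0 !mul0r subr0; apply.
    by move=> s st; apply: dD; apply: Gl0; exact: le_trans ty.
  move=> s st; rewrite mul0r addr0; apply/ltW/Hr2; apply: lt_le_trans rr2; apply: clz0.
  exact: le_trans ty.
pose zy := real_line z ky y.
have B3 t : `|t| <= `|x| -> `|D kx (real_line zy kx t) - D kx zy - DD kx kx z * t| <= e / 2 * `|t|.
  move=> tx.
  have := @second_order_bound (fun s => D kx (real_line zy kx s)) (fun s => DD kx kx (real_line zy kx s)) (DD kx kx z) 0 (e / 2) t.
  rewrite real_line0 !mul0r subr0; apply.
    by move=> s st; apply: dD; apply: Gl => //; exact: le_trans tx.
  move=> s st; rewrite mul0r addr0; apply/ltW/Hr1; apply: lt_le_trans rr1; apply: clz => //.
  exact: le_trans tx.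
have C1 : `|h zy - h z - D ky z * y - DD ky ky z * y ^+ 2 / 2| <= e / 2 * `|y| * `|y|.
  have := @second_order_bound (fun s => h (real_line z ky s)) (fun s => D ky (real_line z ky s)) (D ky z) (DD ky ky z) (e / 2 * `|y|) y.
  rewrite real_line0; apply; first by move=> t ty; apply: dh; exact: Gl0.
  move=> t ty; rewrite opprD addrA; apply: le_trans (B1 t ty) _.
  by rewrite ler_wpM2l// ltW.
have C2 : `|h (real_line zy kx x) - h zy - (D kx z + DD ky kx z * y) * x - DD kx kx z * x ^+ 2 / 2|
    <= (e / 2 * `|x| + e / 2 * `|y|) * `|x|.
  have := @second_order_bound (fun s => h (real_line zy kx s)) (fun s => D kx (real_line zy kx s)) (D kx z + DD ky kx z * y) (DD kx kx z) (e / 2 * `|x| + e / 2 * `|y|) x.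
  rewrite real_line0; apply; first by move=> t tx; apply: dh; exact: Gl.
  move=> t tx.
  have -> : D kx (real_line zy kx t) - (D kx z + DD ky kx z * y + DD kx kx z * t) =
    (D kx (real_line zy kx t) - D kx zy - DD kx kx z * t) + (D kx zy - D kx z - DD ky kx z * y).
    exact: regroup2.
  apply: le_trans (ler_normD _ _) _; apply: lerD; last exact: B2.
  by apply: le_trans (B3 t tx) _; rewrite ler_wpM2l// ltW.
have -> : h (real_line zy kx x) - (h z + D kx z * x + D ky z * y + DD kx kx z * x ^+ 2 / 2 + DD ky kx z * x * y + DD ky ky z * y ^+ 2 / 2)
 = (h (real_line zy kx x) - h zy - (D kx z + DD ky kx z * y) * x - DD kx kx z * x ^+ 2 / 2)
  + (h zy - h z - D ky z * y - DD ky ky z * y ^+ 2 / 2).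
  exact: regroup1.
apply: le_trans (ler_normD _ _) _; apply: le_trans (lerD C2 C1) _.
rewrite -(real_normK (num_real x)) -(real_normK (num_real y)).
(* The mixed error e / 2 |x| |y| is absorbed by the two squares. *)
have : 0 <= e / 2 * (`|x| - `|y|) ^+ 2 by rewrite mulr_ge0 ?sqr_ge0// ltW.
have : 0 <= e * (`|x| ^+ 2 + `|y| ^+ 2) by rewrite mulr_ge0 ?addr_ge0 ?sqr_ge0// ltW.
lra.
Qed.

End Taylor.

(** * Derivatives and continuity of complex-valued functions, by real and imaginary parts *)

Section ComplexCalculus.
Context {R : realType}.
Implicit Types (g h : R -> R[i]).

Lemma cReD (x y : R[i]) : Re (x + y) = Re x + Re y.
Proof. by case: x => a b; case: y. Qed.

Lemma cImD (x y : R[i]) : Im (x + y) = Im x + Im y.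
Proof. by case: x => a b; case: y. Qed.

Lemma cReN (x : R[i]) : Re (- x) = - Re x.
Proof. by case: x. Qed.

Lemma cImN (x : R[i]) : Im (- x) = - Im x.
Proof. by case: x. Qed.

Lemma natC (k : nat) : (k%:R : R[i]) = (k%:R : R)%:C.
Proof. by rewrite rmorph_nat. Qed.

Lemma cReM (x y : R[i]) : Re (x * y) = Re x * Re y - Im x * Im y.
Proof. by case: x => a b; case: y. Qed.

Lemma cImM (x y : R[i]) : Im (x * y) = Re x * Im y + Im x * Re y.
Proof. by case: x => a b; case: y. Qed.

Lemma cReV (x : R[i]) : Re x^-1 = Re x / (Re x ^+ 2 + Im x ^+ 2).
Proof. by case: x. Qed.

Lemma cImV (x : R[i]) : Im x^-1 = - (Im x / (Re x ^+ 2 + Im x ^+ 2)).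
Proof. by case: x. Qed.

Lemma sqr_neq0 (x : R[i]) : x != 0 -> Re x ^+ 2 + Im x ^+ 2 != 0.
Proof. by rewrite -cabs_sqr sqrf_eq0 cabs_eq0. Qed.

(** Derivatives at 0 in one real variable are all that is needed: the partial derivatives defining
    harmonicity are taken along the lines [real_line z k]. *)
Definition cder g (d : R[i]) : Prop :=
  is_derive (0 : R) 1 (fun t => Re (g t)) (Re d) /\ is_derive (0 : R) 1 (fun t => Im (g t)) (Im d).

Lemma cder_affine (a d : R[i]) : cder (fun t => a + t%:C * d) d.
Proof.
split; [apply: (@is_derive_quadratic _ _ (Re a) _ 0)|apply: (@is_derive_quadratic _ _ (Im a) _ 0)] => t.
  by rewrite raddfD /= cReM /=; ring.
by rewrite raddfD /= cImM /=; ring.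
Qed.

Lemma cderM g h dg dh : cder g dg -> cder h dh ->
  cder (fun t => g t * h t) (dg * h 0 + g 0 * dh).
Proof.
move=> [g1 g2] [h1 h2]; split.
  rewrite (_ : (fun _ => _) = (fun t => Re (g t) * Re (h t) - Im (g t) * Im (h t))); last first.
    by apply/funext => t; rewrite cReM.
  apply: is_derive_eq; rewrite cReD !cReM /GRing.scale /=; ring.
rewrite (_ : (fun _ => _) = (fun t => Re (g t) * Im (h t) + Im (g t) * Re (h t))); last first.
  by apply/funext => t; rewrite cImM.
apply: is_derive_eq; rewrite cImD !cImM /GRing.scale /=; ring.
Qed.

Lemma cderV g dg : g 0 != 0 -> cder g dg -> cder (fun t => (g t)^-1) (- dg * ((g 0)^-1 * (g 0)^-1)).
Proof.
move=> g0 [g1 g2]; have n0 := sqr_neq0 g0.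
have dN : is_derive (0 : R) 1 (fun t => Re (g t) ^+ 2 + Im (g t) ^+ 2)
   (2 * Re (g 0) * Re dg + 2 * Im (g 0) * Im dg).
  by apply: is_derive_eq; rewrite /GRing.scale /=; ring.
have dV : is_derive (0 : R) 1 (fun t => (Re (g t) ^+ 2 + Im (g t) ^+ 2)^-1)
    (- (Re (g 0) ^+ 2 + Im (g 0) ^+ 2) ^- 2 * (2 * Re (g 0) * Re dg + 2 * Im (g 0) * Im dg)).
  exact: is_deriveV.
split.
  rewrite (_ : (fun _ => _) = (fun t => Re (g t) * (Re (g t) ^+ 2 + Im (g t) ^+ 2)^-1)); last first.
    by apply/funext => t; rewrite cReV.
  apply: is_derive_eq; rewrite !(cReM, cImM) cReN cImN !cReV !cImV /GRing.scale /=.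
  by field.
rewrite (_ : (fun _ => _) = (fun t => - (Im (g t) * (Re (g t) ^+ 2 + Im (g t) ^+ 2)^-1))); last first.
  by apply/funext => t; rewrite cImV.
apply: is_derive_eq; rewrite !(cReM, cImM) cReN cImN !cReV !cImV /GRing.scale /=.
by field.
Qed.

Context {T : topologicalType}.
Implicit Types (u v : T -> R[i]).

Lemma eq_continuous_at (f g : T -> R) z : f =1 g -> {for z, continuous f} -> {for z, continuous g}.
Proof. by move=> /funext ->. Qed.

Definition ccont u (z : T) : Prop :=
  {for z, continuous (fun w => Re (u w))} /\ {for z, continuous (fun w => Im (u w))}.

Lemma ccontM u v z : ccont u z -> ccont v z -> ccont (fun w => u w * v w) z.
Proof.
move=> [u1 u2] [v1 v2]; split.
  apply: (@eq_continuous_at (fun w => Re (u w) * Re (v w) - Im (u w) * Im (v w))).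
    by move=> w; rewrite cReM.
  by apply: continuousB; apply: continuousM.
apply: (@eq_continuous_at (fun w => Re (u w) * Im (v w) + Im (u w) * Re (v w))).
  by move=> w; rewrite cImM.
by apply: continuousD; apply: continuousM.
Qed.

Lemma ccont_cst (a : R[i]) z : ccont (fun=> a) z.
Proof. by split; exact: cst_continuous. Qed.

Lemma ccontB u v z : ccont u z -> ccont v z -> ccont (fun w => u w - v w) z.
Proof.
move=> [u1 u2] [v1 v2]; split.
  apply: (@eq_continuous_at (fun w => Re (u w) - Re (v w))); last exact: continuousB.
  by move=> w; rewrite cReD cReN.
apply: (@eq_continuous_at (fun w => Im (u w) - Im (v w))); last exact: continuousB.
by move=> w; rewrite cImD cImN.
Qed.

Lemma ccontV u z : u z != 0 -> ccont u z -> ccont (fun w => (u w)^-1) z.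
Proof.
move=> uz [u1 u2]; have n0 := sqr_neq0 uz.
have cV : {for z, continuous (fun w => (Re (u w) ^+ 2 + Im (u w) ^+ 2)^-1)}.
  apply: continuousV => //; apply: continuousD.
    by apply: (@eq_continuous_at (fun w => Re (u w) * Re (u w))); [move=> w; rewrite expr2|exact: continuousM].
  by apply: (@eq_continuous_at (fun w => Im (u w) * Im (u w))); [move=> w; rewrite expr2|exact: continuousM].
split.
  apply: (@eq_continuous_at (fun w => Re (u w) * (Re (u w) ^+ 2 + Im (u w) ^+ 2)^-1)); last exact: continuousM.
  by move=> w; rewrite cReV.
apply: (@eq_continuous_at (fun w => - (Im (u w) * (Re (u w) ^+ 2 + Im (u w) ^+ 2)^-1))).
  by move=> w; rewrite cImV.
by apply: continuousN; exact: continuousM.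
Qed.

End ComplexCalculus.

(** * The Poisson kernel and the Dirichlet problem on the unit disc *)

Section PoissonKernel.
Context {R : realType}.
Implicit Types (b c : R[i]) (l : Cn R 1).
Local Notation dir := (bool * 'I_1)%type.

Definition c1 l : R[i] := l ord0 ord0.
Definition v1 (a : R[i]) : Cn R 1 := \row_(j < 1) a.

Lemma v1K a : c1 (v1 a) = a.
Proof. by rewrite /c1 /v1 mxE. Qed.

Lemma rn_c1 l : rn l = cabs (c1 l).
Proof.
apply/eqP; rewrite eq_le rn_coord andbT; apply/rn_leP; first exact: cabs_ge0.
by move=> j; rewrite (ord1 j).
Qed.

Lemma c1B l l' : c1 (l - l') = c1 l - c1 l'.
Proof. by rewrite /c1 !mxE. Qed.

Definition cdir (k : dir) : R[i] := if k.1 then 'i else 1.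

Lemma c1_real_line l k (t : R) : c1 (real_line l k t) = c1 l + t%:C * cdir k.
Proof. by rewrite /c1 /real_line /real_dir !mxE (ord1 k.2) eqxx /= mulr1. Qed.

Lemma sum_dir1 (F : dir -> R) : \sum_k F k = F (true, ord0) + F (false, ord0).
Proof.
rewrite (eq_bigr (fun k => F (k.1, k.2))); last by case.
by rewrite -(pair_bigA _ (fun i j => F (i, j))) /= big_bool !big_ord1.
Qed.

Lemma ccont_c1 l : ccont c1 l.
Proof. by split; [exact: continuous_coordRe|exact: continuous_coordIm]. Qed.

Lemma open_c1_neq b : open [set l | c1 l != b].
Proof.
apply/open_rnP => l /= lb; exists (cabs (c1 l - b)).
  by rewrite lt_neqAle cabs_ge0 andbT eq_sym cabs_eq0 subr_eq0.
move=> w; rewrite rn_c1 c1B => H; apply/eqP => wb; move: H.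
by rewrite wb -opprB /cabs normrN ltxx.
Qed.

(** The function is holomorphic in l, so each derivative in direction [cdir k] produces a factor
    [cdir k], and the Laplacian contains 1 + i^2 = 0. *)
Lemma harmonic_inv c b : harmonic_on [set l | c1 l != b] (fun l => Re (c * (b - c1 l)^-1)).
Proof.
pose q l := (b - c1 l)^-1.
have cq l : c1 l != b -> ccont q l.
  move=> lb; apply: ccontV; first by rewrite subr_eq0 eq_sym.
  by apply: ccontB; [exact: ccont_cst|exact: ccont_c1].
have dq l k : c1 l != b -> cder (fun t => q (real_line l k t)) (cdir k * (q l * q l)).
  move=> lb; rewrite (_ : (fun _ => _) = (fun t => ((b - c1 l) + t%:C * (- cdir k))^-1)); last first.
    by apply/funext => t; rewrite /q c1_real_line mulrN opprD addrA.
  have := @cderV R _ _ _ (cder_affine (b - c1 l) (- cdir k)).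
  by rewrite mul0r addr0 opprK; apply; rewrite subr_eq0 eq_sym.
have dcst (a : R[i]) : cder (fun=> a) 0.
  by have := cder_affine a 0; congr cder; apply/funext => t; rewrite mulr0 addr0.
apply: (@harmonic_intro _ _ _ _ (fun k l => Re (c * (cdir k * (q l * q l))))
  (fun k k' l => Re (c * (cdir k' * (cdir k * (q l * q l) * q l + q l * (cdir k * (q l * q l))))))).
- exact: open_c1_neq.
- move=> l lb; have cql := cq l lb; split=> [|k|k|k k'|k k'].
  + by apply: (proj1 (ccontM (ccont_cst _ _) cql)).
  + by have [+ _] := cderM (dcst c) (dq l k lb); rewrite mul0r add0r.
  + by apply: (proj1 (ccontM (ccont_cst _ _) (ccontM (ccont_cst _ _) (ccontM cql cql)))).
  + have := cderM (dcst c) (cderM (dcst (cdir k')) (cderM (dq l k lb) (dq l k lb))).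
    by rewrite /= !real_line0 !mul0r !add0r => -[].
  + have h := ccontM (ccont_cst (cdir k) l) (ccontM cql cql).
    have h2 := ccontM h cql; have h3 := ccontM cql h.
    have h4 : ccont (fun l => cdir k * (q l * q l) * q l + q l * (cdir k * (q l * q l))) l.
      rewrite (_ : (fun _ => _) = (fun l => 2 * (cdir k * (q l * q l) * q l))).
        exact: (ccontM (ccont_cst _ _) h2).
      by apply/funext => w; ring.
    by apply: (proj1 (ccontM (ccont_cst _ _) (ccontM (ccont_cst _ _) h4))).
- move=> l lb; rewrite sum_dir1 -raddfD /= (_ : _ + _ = 0)//.
  have i2 : 'i%C * 'i%C = -1 :> R[i].
    by apply/eqP; rewrite eq_complex /= !(mul0r, mulr0, mul1r, addr0, add0r, sub0r) oppr0 !eqxx.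
  rewrite /cdir /=; set Q := q l.
  transitivity (c * (2 * ('i%C * 'i%C + 1) * (Q * Q * Q))); first by ring.
  by rewrite i2 addNr mulr0 mul0r mulr0.
Qed.

(* By [pkE] this is the Poisson kernel of the disc of radius |b|. *)
Definition pk b l : R := Re (2 * b * (b - c1 l)^-1) - 1.

Lemma pk0 b : b != 0 -> pk b 0 = 1.
Proof.
by move=> b0; rewrite /pk /c1 mxE subr0 mulfK// natC /=; ring.
Qed.

Lemma pkE b l : c1 l != b -> pk b l = (cabs b ^+ 2 - rn l ^+ 2) / cabs (b - c1 l) ^+ 2.
Proof.
move=> lb; have bl : b - c1 l != 0 by rewrite subr_eq0 eq_sym.
have := sqr_neq0 bl; rewrite /pk rn_c1 !cabs_sqr.
case: b {lb bl} => b1 b2; case: (c1 l) => x y /= H.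
by rewrite /=; field.
Qed.

Lemma pk_harmonic b : harmonic_on [set l | c1 l != b] (pk b).
Proof.
have h := harmonicD (@open_c1_neq b) (harmonic_inv (2 * b) b) (harmonic_cst (-1) (@open_c1_neq b)).
rewrite (_ : pk b = (fun l => Re (2 * b * (b - c1 l)^-1) + -1)) //.
Qed.

Lemma pk_ge0 b l : rn l < cabs b -> 0 <= pk b l.
Proof.
move=> lb; have lb' : c1 l != b by apply/eqP => E; move: lb; rewrite rn_c1 E ltxx.
rewrite pkE// divr_ge0 ?sqr_ge0// subr_ge0 ler_sqr ?nnegrE ?rn_ge0 ?cabs_ge0//.
exact: ltW.
Qed.

Lemma cabsB_ge (a b : R[i]) : cabs a - cabs b <= cabs (a - b).
Proof. by rewrite lerBlDr; have := cabsD (a - b) b; rewrite subrK. Qed.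

(** With B = |b| and r = |l| the kernel is at most (B^2 - r^2) / (B - r)^2 = (B + r) / (B - r),
    which is at most 3 for r <= 1/2 and B > 1. This is the source of the constant 3 in every Harnack
    inequality below. *)
Lemma pk_harnack b l : 1 < cabs b -> rn l <= 2^-1 -> pk b l <= 3.
Proof.
move=> b1 l2; have lb : c1 l != b.
  by apply/eqP => E; move: l2; rewrite rn_c1 E; lra.
have h := cabsB_ge b (c1 l); rewrite -rn_c1 in h.
have d0 : 0 < cabs (b - c1 l) by lra.
rewrite pkE// ler_pdivrMr ?exprn_gt0// subr_sqr.
have := rn_ge0 l.
have : 0 <= (cabs (b - c1 l) - (cabs b - rn l)) by lra.
move: (cabs (b - c1 l)) (cabs b) (rn l) b1 l2 d0 h => d B r *.
apply: (@le_trans _ _ (3 * (B - r) ^+ 2)); nra.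
Qed.

Lemma sum_inv_roots (s : seq R[i]) z : z \notin s ->
  ((\prod_(b <- s) ('X - b%:P))^`()).[z] = (\prod_(b <- s) ('X - b%:P)).[z] * \sum_(b <- s) (z - b)^-1.
Proof.
elim: s => [|b s IH]; first by rewrite !big_nil derivC !hornerE.
rewrite inE negb_or => /andP[zb zs]; rewrite !big_cons derivM derivXsubC mul1r.
rewrite hornerD !hornerM IH// !hornerXsubC mulrDr mulrAC divff ?subr_eq0// mul1r.
by rewrite mulrA.
Qed.

(* The roots of 'X^N - rho^N: the sum is a logarithmic derivative. *)
Lemma roots_of_radius (rho : R) (N : nat) : 0 < rho -> (0 < N)%N ->
  exists s : seq R[i], [/\ size s = N, (forall b, b \in s -> cabs b = rho) &
   forall z, z ^+ N != (rho ^+ N)%:C ->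
     \sum_(b <- s) (z - b)^-1 = N%:R * z ^+ N.-1 / (z ^+ N - (rho ^+ N)%:C)].
Proof.
move=> rho0 N0; pose p : {poly R[i]} := 'X^N - ((rho ^+ N)%:C)%:P.
have [s ps] := closed_field_poly_normal p.
have lp : lead_coef p = 1 by rewrite lead_coefXnsubC.
rewrite lp scale1r in ps.
exists s; split.
- have := size_prod_XsubC s id; rewrite -ps size_XnsubC//.
  by move=> [].
- move=> b bs; have : root p b by rewrite ps root_prod_XsubC.
  rewrite /root !hornerE subr_eq0 => /eqP E.
  have : cabs (b ^+ N) = rho ^+ N by rewrite E cabs_real ger0_norm// exprn_ge0// ltW.
  have -> : cabs (b ^+ N) = cabs b ^+ N.
    elim: (N) => [|k IH]; first by rewrite !expr0 cabs_def /= expr1n expr0n addr0 sqrtr1.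
    by rewrite !exprS cabsM IH.
  by move/eqP; rewrite eqrXn2 ?cabs_ge0 ?ltW// => /eqP.
- move=> z zN; have zs : z \notin s.
    apply/negP => zs; have : root p z by rewrite ps root_prod_XsubC.
    by rewrite /root !hornerE subr_eq0 (negbTE zN).
  have h := sum_inv_roots zs; rewrite -ps in h.
  have E1 : (p^`()).[z] = N%:R * z ^+ N.-1.
    by rewrite /p derivB derivXn derivC subr0 hornerMn hornerXn mulr_natl.
  have E2 : p.[z] = z ^+ N - (rho ^+ N)%:C by rewrite /p !hornerE.
  rewrite E1 E2 in h; rewrite h mulrAC divff ?mul1r//.
  by rewrite subr_eq0.
Qed.

Lemma bernoulli_ge (x : R) (N : nat) : 0 <= x -> 1 + N%:R * x <= (1 + x) ^+ N.
Proof.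
move=> x0; elim: N => [|N IH]; first by rewrite mul0r addr0 expr0.
rewrite exprS -natr1; have : 0 <= N%:R * x by rewrite mulr_ge0.
have : (1 + x) * (1 + N%:R * x) <= (1 + x) * (1 + x) ^+ N by rewrite ler_wpM2l//; lra.
move: (N%:R * x) ((1 + x) ^+ N) (N%:R : R) => a b c; nra.
Qed.

Lemma large_power (rho T : R) : 1 < rho -> exists2 N : nat, (0 < N)%N & T <= rho ^+ N.
Proof.
move=> rho1; have x0 : 0 < rho - 1 by lra.
have [N HN] : exists N : nat, T / (rho - 1) <= N%:R by eexists; exact/ltW/truncnS_gt.
exists N.+1 => //; have := @bernoulli_ge (rho - 1) N.+1 (ltW x0).
rewrite addrCA subrr addr0; apply: le_trans.
rewrite ler_pdivrMr// in HN; rewrite -natr1 mulrDl mul1r.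
lra.
Qed.

(** The total mass of the discretized kernel is almost 1. On the circle each kernel is 1 + Re(- 2 z
    / (z - b)), and the sum over the roots of X^N - rho^N has the closed form Re(- 2 z^N / (z^N -
    rho^N)) after division by N and subtraction of 1. *)
Lemma sum_pk (rho : R) (N : nat) (s : seq R[i]) l : 1 < rho -> (0 < N)%N -> size s = N ->
  (forall b, b \in s -> cabs b = rho) ->
  (forall z, z ^+ N != (rho ^+ N)%:C ->
     \sum_(b <- s) (z - b)^-1 = N%:R * z ^+ N.-1 / (z ^+ N - (rho ^+ N)%:C)) ->
  rn l = 1 -> 1 < rho ^+ N ->
  `|\sum_(b <- s) pk b l / N%:R - 1| <= 2 / (rho ^+ N - 1).
Proof.
move=> rho1 N0 sN sb sE l1 T1; set z := c1 l; set T := rho ^+ N.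
have z1 : cabs z = 1 by rewrite /z -rn_c1.
have zN : cabs (z ^+ N) = 1.
  elim: (N) => [|k IH]; first by rewrite expr0 cabs_def /= expr1n expr0n addr0 sqrtr1.
  by rewrite exprS cabsM IH z1 mulr1.
have zT : z ^+ N != T%:C.
  apply/eqP => E; have : cabs (z ^+ N) = T.
    by rewrite E cabs_real gtr0_norm// (lt_trans _ T1).
  by rewrite zN => E2; move: T1; rewrite -/T -E2 ltxx.
have E1 b : b \in s -> pk b l = 1 + Re (- 2 * z * (z - b)^-1).
  move=> bs; have bz : z - b != 0.
    by apply/eqP => /eqP; rewrite subr_eq0 => /eqP E; move: (sb b bs); rewrite -E z1; lra.
  have bz' : b - z != 0 by rewrite -opprB oppr_eq0.
  rewrite /pk -/z (_ : 2 * b * (b - z)^-1 = 2 + (- 2 * z * (z - b)^-1)).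
    by rewrite cReD natC /=; ring.
  have -> : (z - b)^-1 = - (b - z)^-1 by rewrite -opprB invrN.
  by field.
have -> : \sum_(b <- s) pk b l / N%:R - 1 = Re (- 2 * z ^+ N / (z ^+ N - T%:C)).
  rewrite big_seq (eq_bigr (fun b => (1 + Re (- 2 * z * (z - b)^-1)) / N%:R)); last first.
    by move=> b /E1 ->.
  rewrite -big_seq -mulr_suml big_split /= -raddf_sum /= -mulr_sumr sE//.
  rewrite big_const_seq count_predT sN iter_addr_0.
  have N0' : (N%:R : R) != 0 by rewrite pnatr_eq0 -lt0n.
  rewrite mulrDl divff// addrAC subrr add0r.
  have -> : - 2 * z * (N%:R * z ^+ N.-1 / (z ^+ N - T%:C)) = (N%:R)%:C * (- 2 * z ^+ N / (z ^+ N - T%:C)).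
    have zz : z ^+ N = z * z ^+ N.-1 by rewrite -exprS prednK.
    rewrite rmorph_nat; move: (_^-1) => X; rewrite zz; ring.
  by rewrite cReM /= mul0r subr0 mulrAC divff// mul1r.
apply: le_trans (Re_le_cabs _) _.
rewrite !cabsM zN mulr1.
have c2 : cabs (- 2 : R[i]) = 2.
  by rewrite /cabs normrN normr_nat natC.
have d0 : T - 1 <= cabs (z ^+ N - T%:C).
  have := cabsB_ge (T%:C) (z ^+ N); rewrite zN cabs_real gtr0_norm ?(lt_trans _ T1)//.
  by rewrite /cabs -normrN opprB.
have d1 : 0 < cabs (z ^+ N - T%:C) by apply: lt_le_trans d0; rewrite subr_gt0.
have cV : cabs (z ^+ N - T%:C)^-1 = (cabs (z ^+ N - T%:C))^-1.
  apply: (mulfI (lt0r_neq0 d1)); rewrite divff ?lt0r_neq0//.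
  rewrite -cabsM divff; first by rewrite cabs_def /= expr1n expr0n addr0 sqrtr1.
  by rewrite subr_eq0.
by rewrite c2 cV ler_wpM2l// lef_pV2 ?posrE ?subr_gt0.
Qed.

(* A Riemann sum of the Poisson integral, with poles at the N-th roots of
   rho^N for rho slightly above 1. *)
Lemma poisson_approx (f : Cn R 1 -> R) (L e : R) :
  (forall x y, `|f x - f y| <= L * rn (x - y)) -> (forall x, rn x = 1 -> 0 <= f x) -> 0 < e ->
  exists (s : seq R[i]) (a : R[i] -> R), (forall b, b \in s -> 0 <= a b /\ 1 < cabs b) /\
    forall l, rn l = 1 -> `|\sum_(b <- s) a b * pk b l - f l| <= e.
Proof.
move=> fL f0 e0.
wlog L0 : L fL / 0 <= L.
  move=> H; apply: (H `|L|) => // x y; apply: le_trans (fL x y) _.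
  by rewrite ler_wpM2r ?rn_ge0// ler_norm.
have L10 : 0 < L + 1 by lra.
pose M := `|f 0| + L.
have fM l : rn l = 1 -> f l <= M.
  move=> l1; have := fL l 0; rewrite subr0 l1 mulr1 ler_norml => /andP[_].
  have := ler_norm (f 0); rewrite /M; lra.
have M0 : 0 <= M by rewrite addr_ge0.
(* The mass S will be at most 2, so the variation of f costs at most L d S + 3 L d <= 5 L d <= e /
   2; the other half of e pays for f l (S - 1). *)
pose d := e / (10 * (L + 1)).
have d0 : 0 < d by rewrite divr_gt0// mulr_gt0.
have Ld : L * d <= e / 10.
  have -> : e / 10 = (L + 1) * d by rewrite /d; field; rewrite lt0r_neq0.
  by rewrite ler_wpM2r ?ltW//; lra.
(* The poles have modulus 1 + eta, and eta <= d^2 gives rho^2 - 1 <= 3 d^2. *)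
pose eta := Num.min 1 (d ^+ 2).
have eta0 : 0 < eta by rewrite /eta lt_min ltr01 exprn_gt0.
have eta1 : eta <= 1 by rewrite /eta ge_min lexx.
have etad : eta <= d ^+ 2 by rewrite /eta ge_min lexx orbT.
clearbody d M; pose rho := 1 + eta.
have rho1 : 1 < rho by rewrite /rho; lra.
have rhod : (rho ^+ 2 - 1) / d <= 3 * d.
  have nr x : 0 < x -> x <= 1 -> x <= d ^+ 2 -> (1 + x) ^+ 2 - 1 <= 3 * d * d by move=> *; nra.
  by rewrite ler_pdivrMr// /rho; exact: nr.
(* The summand 3 makes the mass at most 2, and 4 M / e makes M times the mass defect at most e /
   2. *)
have [N N0 HN] := large_power (3 + 4 * M / e) rho1.
have rho0 : 0 < rho by lra.
have Me0 : 0 <= 4 * M / e by rewrite divr_ge0 ?mulr_ge0// ltW.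
have T1 : 1 < rho ^+ N by apply: lt_le_trans HN; lra.
have [s [sN sb sE]] := roots_of_radius rho0 N0.
exists s, (fun b => f (v1 (b / rho%:C)) / N%:R).
have NR0 : (0 : R) < N%:R by rewrite ltr0n.
have cinv : cabs (rho%:C)^-1 = rho^-1.
  by rewrite -fmorphV cabs_real gtr0_norm// invr_gt0.
have v1b b : b \in s -> rn (v1 (b / rho%:C)) = 1.
  by move=> /sb bs; rewrite rn_c1 v1K cabsM bs cinv divff// lt0r_neq0.
split.
  move=> b bs; rewrite sb//; split => //; apply: divr_ge0; last exact: ltW.
  by apply: f0; exact: v1b.
move=> l l1; have SP := sum_pk rho1 N0 sN sb sE l1 T1.
set S := \sum_(b <- s) pk b l / N%:R in SP.
have -> : \sum_(b <- s) f (v1 (b / rho%:C)) / N%:R * pk b l - f l =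
  \sum_(b <- s) (f (v1 (b / rho%:C)) - f l) * pk b l / N%:R + f l * (S - 1).
  rewrite mulrBr mulr1 /S mulr_sumr addrA; congr (_ - _).
  rewrite -big_split /=; apply: eq_bigr => b _; ring.
have T2 : 2 / (rho ^+ N - 1) <= 1.
  by rewrite ler_pdivrMr ?subr_gt0//; lra.
have S2 : S <= 2 by move: SP; rewrite ler_norml => /andP[_]; lra.
(* As D >= eta, f varies by at most 2 L D between l and the projection of b to the circle. The
   inequality 2 / D <= d / D^2 + 1 / d then replaces the usual splitting of the circle into a near
   and a far arc. *)
have term b : b \in s -> `|(f (v1 (b / rho%:C)) - f l) * pk b l / N%:R| <=
    (L * d) * (pk b l / N%:R) + L * (3 * d) / N%:R.
  move=> bs; have bl : rn l < cabs b by rewrite l1 sb.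
  have pk0' := pk_ge0 bl.
  rewrite !normrM (ger0_norm pk0') (ger0_norm (_ : 0 <= N%:R^-1)) ?invr_ge0 ?ler0n//.
  rewrite [L * d * _]mulrA -mulrDl ler_wpM2r ?invr_ge0 ?ler0n//.
  set D := cabs (b - c1 l).
  have Dge : eta <= D.
    by have := cabsB_ge b (c1 l); rewrite sb// -rn_c1 l1 /rho -/D; lra.
  have D0 : 0 < D by lra.
  have pkD : pk b l = (rho ^+ 2 - 1) / D ^+ 2.
    have lb : c1 l != b by apply/eqP => E; move: bl; rewrite rn_c1 E ltxx.
    by rewrite pkE// sb// l1 expr1n.
  have fb : `|f (v1 (b / rho%:C)) - f l| <= L * (2 * D).
    apply: le_trans (fL _ _) _; rewrite ler_wpM2l// rn_c1 c1B v1K.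
    have -> : b / rho%:C - c1 l = (b / rho%:C - b) + (b - c1 l) by rewrite addrA subrK.
    apply: le_trans (cabsD _ _) _; rewrite -/D.
    have -> : b / rho%:C - b = b * (rho^-1 - 1)%:C.
      by rewrite rmorphB /= fmorphV rmorph1; ring.
    rewrite cabsM sb// cabs_real ler0_norm; last by rewrite subr_le0 invf_le1// ltW.
    rewrite opprB mulrBr mulr1 divff ?lt0r_neq0//.
    by rewrite /rho; lra.
  apply: (@le_trans _ _ (L * (2 * D) * pk b l)); first by rewrite ler_wpM2r.
  rewrite -(mulrA L (2 * D)) -(mulrA 2 D) -(mulrA L d) -mulrDr ler_wpM2l//.
  have rhoge : 0 <= rho ^+ 2 - 1 by rewrite subr_ge0 expr_ge1 ?ltW.
  apply: (@le_trans _ _ (d * pk b l + (rho ^+ 2 - 1) / d)); last first.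
    by move: rhod; rewrite lerD2l; exact.
  have -> : d * pk b l + (rho ^+ 2 - 1) / d = (rho ^+ 2 - 1) * (d / D ^+ 2 + d^-1).
    by rewrite pkD; ring.
  have -> : 2 * (D * pk b l) = (rho ^+ 2 - 1) * (2 / D).
    by rewrite pkD; field; rewrite lt0r_neq0.
  rewrite ler_wpM2l//.
  have -> : d / D ^+ 2 + d^-1 = (d ^+ 2 + D ^+ 2) / (D ^+ 2 * d).
    by field; rewrite !lt0r_neq0.
  have -> : 2 / D = (2 * D * d) / (D ^+ 2 * d) by field; rewrite !lt0r_neq0.
  have i0 : 0 <= (D ^+ 2 * d)^-1 by rewrite invr_ge0 mulr_ge0// ?exprn_ge0// ltW.
  apply: (ler_wpM2r i0); have := sqr_ge0 (d - D); nra.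
apply: le_trans (ler_normD _ _) _.
have B1 : `|\sum_(b <- s) (f (v1 (b / rho%:C)) - f l) * pk b l / N%:R| <= L * d * S + L * (3 * d).
  apply: le_trans (ler_norm_sum _ _ _) _.
  apply: (@le_trans _ _ (\sum_(b <- s) ((L * d) * (pk b l / N%:R) + L * (3 * d) / N%:R))).
    by rewrite big_seq [leRHS]big_seq; apply: ler_sum => b; exact: term.
  rewrite big_split /= -mulr_sumr big_const_seq count_predT sN iter_addr_0 -/S.
  by rewrite -mulrnAl -[_ *+ N]mulr_natr mulfK ?lt0r_neq0.
have B2 : `|f l * (S - 1)| <= e / 2.
  rewrite normrM (ger0_norm (f0 _ l1)).
  apply: (@le_trans _ _ (M * (2 / (rho ^+ N - 1)))); first by apply: ler_pM => //; [exact: f0|exact: fM].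
  rewrite mulrA ler_pdivrMr ?subr_gt0//.
  have : e / 2 * (4 * M / e) <= e / 2 * (rho ^+ N - 1).
    by rewrite ler_wpM2l ?divr_ge0 ?ltW//; lra.
  have -> : e / 2 * (4 * M / e) = 2 * M by field; rewrite lt0r_neq0.
  by rewrite [M * 2]mulrC.
have LdS : L * d * S <= L * d * 2 by rewrite ler_wpM2l// mulr_ge0// ltW.
have E3 : L * (3 * d) = 3 * (L * d) by ring.
rewrite E3 in B1; apply: le_trans (lerD B1 B2) _; lra.
Qed.

Definition unit_disc : set (Cn R 1) := [set l | rn l < 1].

(** All poles lie outside the closed disc, hence the continuity of H on the circle. Approximation up
    to e / 2 followed by adding e / 2 makes the error one-sided. As f >= 0 on the circle the weights
    are nonnegative, and the last bound follows termwise from [pk_harnack]. *)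
Lemma poisson_solution (f : Cn R 1 -> R) (e : R) : lipschitz_rn f ->
  (forall x, rn x = 1 -> 0 <= f x) -> 0 < e ->
  exists H : Cn R 1 -> R, [/\ harmonic_on unit_disc H,
    (forall l, rn l <= 1 -> {for l, continuous H}),
    (forall l, rn l = 1 -> f l <= H l <= f l + e) &
    (forall q, rn q <= 2^-1 -> H q <= 3 * H 0)].
Proof.
move=> [L fL] f0 e0; have e20 : 0 < e / 2 by lra.
have [s [a [Ha Hs]]] := poisson_approx fL f0 e20.
pose G l := forall b, b \in s -> rn l < cabs b.
pose H0 l := \sum_(b <- s) a b * pk b l.
have GN l : rn l <= 1 -> forall b, b \in s -> c1 l != b.
  move=> l1 b /Ha[_ b1]; apply/eqP => E; move: b1; rewrite -E -rn_c1; lra.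
have oG : open [set l : Cn R 1 | forall b, b \in s -> c1 l != b].
  elim: (s) => [|b t IH].
    by rewrite (_ : [set _ | _] = setT); [exact: openT|apply/seteqP; split].
  rewrite (_ : [set _ | _] = [set l | c1 l != b] `&` [set l | forall b, b \in t -> c1 l != b]).
    by apply: openI => //; exact: open_c1_neq.
  apply/seteqP; split => l /=.
    move=> H; split; first by apply: H; rewrite inE eqxx.
    by move=> c ct; apply: H; rewrite inE ct orbT.
  by move=> [h1 h2] c; rewrite inE => /orP[/eqP ->|] //; exact: h2.
have hH0 : harmonic_on [set l : Cn R 1 | forall b, b \in s -> c1 l != b] H0.
  suff H t : {subset t <= s} -> harmonic_on [set l : Cn R 1 | forall b, b \in s -> c1 l != b]
      (fun l => \sum_(b <- t) a b * pk b l) by exact: H.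
  elim: t => [|b t IH] ts.
    rewrite (_ : (fun _ => _) = (fun=> 0)); first exact: harmonic_cst.
    by apply/funext => l; rewrite big_nil.
  rewrite (_ : (fun _ => _) = (fun l => a b * pk b l + \sum_(j <- t) a j * pk j l)); last first.
    by apply/funext => l; rewrite big_cons.
  apply: (harmonicD oG); last by apply: IH => c ct; apply: ts; rewrite inE ct orbT.
  apply: (harmonicZ _ oG); apply: harmonic_sub (pk_harmonic b) => l /= H.
  by apply: H; apply: ts; rewrite inE eqxx.
exists (fun l => H0 l + e / 2); split.
- have oD : open unit_disc.
    apply/open_rnP => l l1; exists (1 - rn l); first by rewrite subr_gt0.
    move=> w wl; have := rnD (w - l) l; rewrite /unit_disc /= subrK; lra.
  apply: (harmonicD oD); last exact: harmonic_cst.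
  by apply: harmonic_sub hH0 => l l1 /=; apply: GN; exact: ltW.
- move=> l l1; apply: continuousD; last exact: cst_continuous.
  by apply: (harmonic_continuous hH0) => /=; exact: GN.
- by move=> l l1; have := Hs l l1; rewrite -/(H0 l) ler_norml => /andP[]; lra.
- move=> q q2; suff : H0 q <= 3 * H0 0 by lra.
  rewrite /H0 mulr_sumr big_seq [leRHS]big_seq; apply: ler_sum => b bs.
  have [ab b1] := Ha b bs; rewrite pk0; last first.
    by apply/eqP => b0; move: b1; rewrite b0 cabs0; lra.
  by rewrite mulr1 mulrC ler_wpM2r// pk_harnack.
Qed.

End PoissonKernel.

(** * Extended real arithmetic *)

Section ErealAux.
Context {R : realType}.
Implicit Types (x y : \bar R) (a r : R).

Lemma adde_lt_split x y a : (x < +oo)%E -> (y < +oo)%E -> (x + y < a%:E)%E ->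
  exists b c : R, [/\ (x < b%:E)%E, (y < c%:E)%E & b + c <= a].
Proof.
case: x => [r||] // _; case: y => [s||] // _.
- rewrite -EFinD lte_fin => h; exists (r + (a - r - s) / 2), (s + (a - r - s) / 2).
  by rewrite !lte_fin; split; lra.
- by move=> _; exists (r + 1), (a - (r + 1)); rewrite ltNyr lte_fin; split => //; lra.
- by move=> _; exists (a - (s + 1)), (s + 1); rewrite ltNyr lte_fin; split => //; lra.
- by move=> _; exists a, 0; rewrite !ltNyr addr0.
Qed.

Lemma adde_le_swap x y a : (x < +oo -> y < +oo -> (x + y <= a%:E) = (x <= a%:E - y))%E.
Proof.
case: x => [r||] // _; case: y => [s||] // _.
- by rewrite -EFinD -EFinB !lee_fin lerBrDr.
- by rewrite (_ : r%:E + -oo = -oo)%E // (_ : a%:E - -oo = +oo)%E // leNye leey.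
- by rewrite (_ : -oo + s%:E = -oo)%E // !leNye.
- by rewrite (_ : -oo + -oo = -oo :> \bar R)%E // !leNye.
Qed.

Lemma subre_le x a r : ((x - r%:E <= a%:E) = (x <= (a + r)%:E))%E.
Proof.
case: x => [s||].
- by rewrite -EFinB !lee_fin lerBlDr.
- by rewrite (_ : +oo - r%:E = +oo)%E.
- by rewrite (_ : -oo - r%:E = -oo)%E // !leNye.
Qed.

Lemma sube_swap x r : (x - r%:E = - (r%:E - x))%E.
Proof. by case: x => [s||] //; rewrite -!EFinB -EFinN opprB. Qed.

Lemma sub_add_le x y r a : (x < +oo)%E -> (-oo < y)%E -> (x <= y)%E -> r <= a ->
  (x + (- y + r%:E) <= a%:E)%E.
Proof.
case: x => [c||] // _; case: y => [d||] // _ xy ra.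
- by move: xy; rewrite -EFinN -!EFinD !lee_fin; lra.
- by rewrite (_ : (c%:E + (- +oo + r%:E) = -oo)%E)// leNye.
- by rewrite (_ : (-oo + (- d%:E + r%:E) = -oo)%E)// leNye.
- by rewrite (_ : (-oo + (- +oo + r%:E) = -oo)%E)// leNye.
Qed.

Lemma lee_real_ge x y : (forall e : R, 0 < e -> (x <= y + e%:E)%E) -> (x <= y)%E.
Proof. by move=> H; apply/lee_addgt0Pr. Qed.

End ErealAux.

(** * Subharmonic functions and the comparison principle *)

Section Subharmonic.
Context {R : realType} {n : nat}.
Implicit Types (A D G N : set (Cn R n)) (u v : Cn R n -> \bar R) (h : Cn R n -> R).

Lemma within_contP A h : {within A, continuous h} <->
  (forall z, A z -> forall e : R, 0 < e ->
    exists2 d : R, 0 < d & forall w, A w -> rn (w - z) < d -> `|h w - h z| < e).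
Proof.
split.
  move=> /subspace_continuousP H z Az e e0.
  have B : nbhs (h z) [set x : R | `|x - h z| < e].
    by apply/nbhs_ballP; exists e => // x; rewrite -ball_normE /= distrC.
  have /nbhs_rnP[d d0 Hd] := H z Az _ B.
  by exists d => // w Aw wz; exact: Hd.
move=> H; apply/subspace_continuousP => z Az B /nbhs_ballP[e e0 eB].
have [d d0 Hd] := H z Az e e0; apply/nbhs_rnP; exists d => // w wz Aw.
by apply: eB; rewrite -ball_normE /= distrC; exact: Hd.
Qed.

Lemma within_cont_at A h : (forall z, A z -> {for z, continuous h}) -> {within A, continuous h}.
Proof.
move=> H; apply/within_contP => z Az e e0.
by have [d d0 Hd] := iffLR (real_continuousP _ _) (H z Az) e e0; exists d => // w _; exact: Hd.
Qed.

Lemma within_contD A h1 h2 : {within A, continuous h1} -> {within A, continuous h2} ->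
  {within A, continuous (fun z => h1 z + h2 z)}.
Proof.
move=> /within_contP H1 /within_contP H2; apply/within_contP => z Az e e0.
have e2 : 0 < e / 2 by lra.
have [d1 d10 Hd1] := H1 z Az _ e2; have [d2 d20 Hd2] := H2 z Az _ e2.
exists (Num.min d1 d2); first by rewrite lt_min d10.
move=> w Aw; rewrite lt_min => /andP[w1 w2].
have := Hd1 w Aw w1; have := Hd2 w Aw w2; rewrite !ltr_norml; lra.
Qed.

Lemma within_contN A h : {within A, continuous h} -> {within A, continuous (fun z => - h z)}.
Proof.
move=> /within_contP H1; apply/within_contP => z Az e e0.
have [d1 d10 Hd1] := H1 z Az _ e0; exists d1 => // w Aw w1.
by have := Hd1 w Aw w1; rewrite -opprD normrN.
Qed.

Lemma usc_add A u v : (forall z, A z -> u z < +oo)%E -> (forall z, A z -> v z < +oo)%E ->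
  usc_on A u -> usc_on A v -> usc_on A (fun z => u z + v z)%E.
Proof.
move=> u1 v1 uu uv z Az a /(adde_lt_split (u1 z Az) (v1 z Az))[b [c [ub vc bca]]].
apply: filterS2 (uu z Az b ub) (uv z Az c vc) => w h1 h2.
by apply: lt_le_trans (lteD h1 h2) _; rewrite -EFinD lee_fin.
Qed.

Lemma usc_cont A h : {within A, continuous h} -> usc_on A (fun z => (h z)%:E).
Proof.
move=> /within_contP H z Az a; rewrite lte_fin => ha.
have [|d d0 Hd] := H z Az (a - h z); first lra.
apply/nbhs_rnP; exists d => // w wz Aw; have := Hd w Aw wz.
by rewrite lte_fin ltr_norml; lra.
Qed.

Lemma open_boundary D x : open D -> boundary D x -> closure D x /\ ~ D x.
Proof. by move=> oD [cx]; rewrite (iffLR (@interior_id _ D) oD). Qed.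

Lemma SH_ext D u v : (forall z, D z -> u z = v z) -> SH D u -> SH D v.
Proof.
move=> uv [u1 u2 u3]; split.
- by move=> z Dz; rewrite -uv//; exact: u1.
- move=> z Dz a; rewrite -uv// => za; have := u2 z Dz a za; rewrite !near_withinE.
  by apply: filterS => w H Dw; rewrite -uv//; exact: H.
- move=> G h GD ch hh H z Gz; case: (GD) => _ _ sub.
  rewrite -uv; last by apply: sub; exact: subset_closure.
  apply: (u3 G h) => // w bw; rewrite uv; first exact: H.
  by apply: sub; case: bw.
Qed.

Lemma SH_sub D G u : G `<=` D -> SH D u -> SH G u.
Proof.
move=> GD [u1 u2 u3]; split; first by move=> z /GD; exact: u1.
  exact: usc_onW u2.
move=> G' h [oG cG sub]; apply: u3; split => //; exact: subset_trans GD.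
Qed.

(** Here h need not extend continuously to the boundary of D. The inequality holds off a compact K,
    and the definition of [SH] is applied to a relatively compact open set around K. *)
Lemma SH_near_boundary D u h : open D -> compact (closure D) -> SH D u -> harmonic_on D h ->
  (forall x, boundary D x -> \forall z \near within D (nbhs x), (u z <= (h z)%:E)%E) ->
  forall z, D z -> (u z <= (h z)%:E)%E.
Proof.
move=> oD cD [_ _ u3] hh bd z Dz.
have [K [cK KD HK]] := near_boundary_compact oD cD bd.
have [Kz|] := pselect (K z); last exact: HK.
have [G KG GD] := rel_compact_nbhd cK oD KD; have [oG _ sub] := GD.
apply: (u3 G h) => //; last exact: KG.
- by apply: within_cont_at => w /sub; exact: harmonic_continuous hh.
- by apply: harmonic_sub hh => w Gw; apply: sub; exact: subset_closure.
- move=> w bw; have [cw nGw] := open_boundary oG bw.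
  by apply: HK; [exact: sub|move=> /KG].
Qed.

Lemma SH_subharm D u h : SH D u -> harmonic_on D h -> SH D (fun z => u z - (h z)%:E)%E.
Proof.
move=> [u1 u2 u3] hh; split.
- by move=> z Dz; apply: lte_add_pinfty; [exact: u1|rewrite -EFinN ltry].
- apply: usc_add => //; first by move=> z _; rewrite -EFinN ltry.
  apply: (@usc_cont _ (fun z => - h z)).
  by apply: within_contN; apply: within_cont_at => z; exact: harmonic_continuous hh.
- move=> G h' GD ch hh' H z Gz; have [oG cG sub] := GD.
  rewrite subre_le; apply: (u3 G (fun z => h' z + h z) GD _ _ _ z Gz).
  + by apply: (within_contD ch); apply: within_cont_at => w /sub; exact: harmonic_continuous hh.
  + apply: (harmonicD oG hh'); apply: harmonic_sub hh => w Gw; apply: sub; exact: subset_closure.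
  + by move=> w bw; rewrite -subre_le; exact: H.
Qed.

(** Solvability for Lipschitz data up to a one-sided error, which holds both for the disc, with
    finite sums of kernels, and for a Dirichlet-regular Omega. *)
Definition dirichlet_approx N : Prop :=
  [/\ open N, compact (closure N) & forall (f : Cn R n -> R) (e : R), lipschitz_rn f -> 0 < e ->
    exists h, [/\ {within closure N, continuous h}, harmonic_on N h &
      forall x, boundary N x -> f x <= h x <= f x + e]].

Lemma rescaleK (p z0 : Cn R n) (s : R) y : s != 0 -> rescale p z0 s^-1 (rescale z0 p s y) = y.
Proof.
move=> s0; rewrite /rescale (addrC z0) addrK scalerA -rmorphM mulVf// rmorph1 scale1r.
by rewrite addrC subrK.
Qed.

Lemma lipschitz_comp_rescale (f : Cn R n -> R) p z0 s : lipschitz_rn f ->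
  lipschitz_rn (fun y => f (rescale p z0 s y)).
Proof.
move=> [k Hk]; exists (k * `|s|) => x y; rewrite -mulrA -(rn_rescale p z0); exact: Hk.
Qed.

Lemma dirichlet_approx_rescale N p z0 (s : R) : 0 < s -> dirichlet_approx N ->
  dirichlet_approx (rescale p z0 s^-1 @^-1` N).
Proof.
move=> s0 [oN cN sol]; set T := rescale p z0 s^-1.
have rT z w : rn (T z - T w) = s^-1 * rn (z - w).
  by rewrite rn_rescale gtr0_norm// invr_gt0.
have oTN : open (T @^-1` N) by exact: open_rescale.
have clT x : closure (T @^-1` N) x -> closure N (T x).
  move=> /closure_rnP H; apply/closure_rnP => e e0.
  have [|w Nw wx] := H (s * e); first by rewrite mulr_gt0.
  by exists (T w) => //; rewrite rT mulrC ltr_pdivrMr// mulrC.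
have bdT x : boundary (T @^-1` N) x -> boundary N (T x).
  move=> /(open_boundary oTN)[cx nx]; split; first exact: clT.
  by rewrite (iffLR (@interior_id _ N) oN).
split => //.
- have [M HM] := compact_rn_bounded cN.
  apply: (@compact_closure_bounded _ _ _ (s * (M + rn p) + rn z0)) => z Nz.
  have h1 : rn (z - z0) <= s * (M + rn p).
    have -> : rn (z - z0) = s * rn (T z - T z0) by rewrite rT mulrA divff ?mul1r// lt0r_neq0.
    rewrite ler_wpM2l ?(ltW s0)//; rewrite {2}/T /rescale subrr scaler0 addr0.
    apply: le_trans (rnD _ _) _; rewrite rnN lerD2r; apply: HM; exact: subset_closure.
  have := rnD (z - z0) z0; rewrite subrK; lra.
- move=> f e lf e0.
  have [h [ch hh Hh]] := sol _ e (lipschitz_comp_rescale z0 p s lf) e0.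
  have TK x : rescale z0 p s (T x) = x.
    have := @rescaleK z0 p s^-1 x; rewrite invrK; apply; rewrite invr_neq0// lt0r_neq0//.
  exists (h \o T); split.
  + apply/within_contP => z /clT cz e' e'0.
    have [d d0 Hd] := iffLR (within_contP _ _) ch _ cz e' e'0.
    exists (s * d); first by rewrite mulr_gt0.
    move=> w /clT cw wz; apply: Hd => //.
    by rewrite rT mulrC ltr_pdivrMr// mulrC.
  + exact: harmonic_rescale.
  + by move=> x /bdT /Hh; rewrite TK.
Qed.

(** The Euclidean scalar product of C^n viewed as R^(2n): [rdot a] is harmonic and [rdot z z] is the
    strictly subharmonic |z|^2. *)
Definition rdot (a w : Cn R n) : R :=
  \sum_(j < n) (Re (a ord0 j) * Re (w ord0 j) + Im (a ord0 j) * Im (w ord0 j)).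

Lemma rdotD a w1 w2 : rdot a (w1 + w2) = rdot a w1 + rdot a w2.
Proof. by rewrite /rdot -big_split /=; apply: eq_bigr => j _; rewrite !mxE cReD cImD; ring. Qed.

Lemma rdotB a w1 w2 : rdot a (w1 - w2) = rdot a w1 - rdot a w2.
Proof.
by rewrite /rdot -sumrB; apply: eq_bigr => j _; rewrite !mxE cReD cImD cReN cImN; ring.
Qed.

Lemma rdotZ a (t : R) w : rdot a ((t%:C : R[i]) *: w) = t * rdot a w.
Proof.
rewrite /rdot mulr_sumr; apply: eq_bigr => j _; rewrite !mxE cReM cImM /=; ring.
Qed.

Lemma rdot_sqr z w : rdot z z = rdot w w + 2 * rdot w (z - w) + rdot (z - w) (z - w).
Proof.
rewrite /rdot mulr_sumr -!big_split /=; apply: eq_bigr => j _.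
by rewrite !mxE !cReD !cImD cReN cImN; ring.
Qed.

Lemma rdot_ge0 z : 0 <= rdot z z.
Proof. by apply: sumr_ge0 => j _; rewrite -!expr2 addr_ge0 ?sqr_ge0. Qed.

Lemma rn_sqr_le z : rn z ^+ 2 <= rdot z z.
Proof.
rewrite -[leRHS](sqr_sqrtr (rdot_ge0 z)) ler_sqr ?nnegrE ?rn_ge0 ?sqrtr_ge0//.
apply/rn_leP; first exact: sqrtr_ge0.
move=> j; rewrite cabs_def ler_wsqrtr// /rdot (bigD1 j)//= -!expr2 lerDl.
by apply: sumr_ge0 => i _; rewrite -!expr2 addr_ge0 ?sqr_ge0.
Qed.

Lemma continuous_sumf (I : Type) (s : seq I) (F : I -> Cn R n -> R) :
  (forall i, continuous (F i)) -> continuous (fun z => \sum_(i <- s) F i z).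
Proof.
move=> H; elim: s => [|i s IH] z.
  by apply: (@eq_continuous_at R _ (fun=> 0)); [move=> w; rewrite big_nil|exact: cst_continuous].
apply: (@eq_continuous_at R _ (fun w => F i w + \sum_(i <- s) F i w)).
  by move=> w; rewrite big_cons.
by apply: continuousD; [exact: H|exact: IH].
Qed.

Lemma continuous_rdot_sqr : continuous (fun z => rdot z z).
Proof.
apply: (@continuous_sumf _ _ (fun (j : 'I_n) z =>
  Re (z ord0 j) * Re (z ord0 j) + Im (z ord0 j) * Im (z ord0 j))) => j z.
have h1 := @continuous_coordRe R n j z; have h2 := @continuous_coordIm R n j z.
exact: cvgD (cvgM h1 h1) (cvgM h2 h2).
Qed.

Lemma continuous_rdot a : continuous (rdot a).
Proof.
apply: (@continuous_sumf _ _ (fun (j : 'I_n) z =>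
  Re (a ord0 j) * Re (z ord0 j) + Im (a ord0 j) * Im (z ord0 j))) => j z.
have h1 := @continuous_coordRe R n j z; have h2 := @continuous_coordIm R n j z.
exact: cvgD (cvgM (cvg_cst _) h1) (cvgM (cvg_cst _) h2).
Qed.

Lemma harmonic_rdot G a : open G -> harmonic_on G (rdot a).
Proof.
move=> oG; apply: (@harmonic_affine _ _ _ _ (fun k => rdot a (real_dir k)) oG).
  exact: continuous_rdot.
by move=> z k t; rewrite /real_line rdotD rdotZ.
Qed.

(* Maximize u - v + eta |z|^2 on a compact set outside of which u <= v. *)
Lemma usc_sub_max D u v (z1 : Cn R n) :
  open D -> compact (closure D) ->
  (forall z, D z -> (u z < +oo)%E) -> usc_on D u ->
  (forall z, D z -> (- v z < +oo)%E) -> usc_on D (fun z => - v z)%E ->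
  (forall x, boundary D x -> \forall z \near within D (nbhs x), (u z <= v z)%E) ->
  D z1 -> (v z1 < u z1)%E ->
  exists z0 eta (a b : R), [/\ D z0, 0 < eta, u z0 = a%:E, v z0 = b%:E &
    forall z, D z -> (u z <= v z + (a - b + eta * (rdot z0 z0 - rdot z z))%:E)%E].
Proof.
move=> oD cD u1 u2 v1 v2 bd Dz1 vu.
have vN z : D z -> (-oo < v z)%E by move=> /v1; rewrite lteNl.
have [K [cK KD HK]] := near_boundary_compact oD cD bd.
have Kz1 : K z1 by apply: contrapT => /(HK _ Dz1); rewrite leNgt vu.
have [c [d [uc vd dc]]] : exists c d : R, [/\ u z1 = c%:E, v z1 = d%:E & d < c].
  move: vu (u1 _ Dz1) (vN _ Dz1); case: (u z1) => [c||]; case: (v z1) => [d||] //.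
  by rewrite lte_fin => ? _ _; exists c, d.
have [M [M0 HM]] : exists M : R, 0 <= M /\ forall z, D z -> rdot z z <= M.
  have [|z cz Hz] := @compact_EVT_max _ _ (fun z : Cn R n => rdot z z) (closure D) _ cD (continuous_subspaceT continuous_rdot_sqr).
    by exists z1; exact: subset_closure.
  exists (rdot z z); split; first exact: rdot_ge0.
  by move=> w Dw; apply: Hz; rewrite inE; exact: subset_closure.
(* Chosen so that eta' |z|^2 stays below the excess c - d = u z1 - v z1 on D. Off K, where u <= v,
   the perturbed difference is then smaller than at z1, and the maximum over K is a maximum over
   D. *)
pose eta' := (c - d) / (2 * (M + 1)).
have eta0 : 0 < eta' by rewrite divr_gt0 ?subr_gt0// mulr_gt0//; lra.
have etaM : eta' * M < c - d.
  rewrite /eta' mulrAC ltr_pdivrMr; last by rewrite mulr_gt0//; lra.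
  have : 0 <= (c - d) * M by rewrite mulr_ge0// subr_ge0 ltW.
  lra.
pose W z := (u z + (- v z + (eta' * rdot z z)%:E))%E.
have usW : usc_on K W.
  apply: usc_onW KD _; apply: usc_add => //.
    by move=> z Dz; apply: lte_add_pinfty; [exact: v1|rewrite ltry].
  apply: usc_add => //; first by move=> z _; rewrite ltry.
  apply: usc_cont; apply: continuous_subspaceT => z.
  exact: cvgM (cvg_cst _) (@continuous_rdot_sqr z).
have [|z0 Kz0 Hz0] := usc_max cK _ usW; first by exists z1.
have Dz0 := KD _ Kz0.
have W1 : ((c - d)%:E <= W z0)%E.
  apply: le_trans (Hz0 z1 Kz1); rewrite /W uc vd -EFinN -!EFinD lee_fin.
  by have := mulr_ge0 (ltW eta0) (rdot_ge0 z1); lra.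
have WD z : D z -> (W z <= W z0)%E.
  move=> Dz; have [/Hz0//|nK] := pselect (K z).
  apply: le_trans W1; apply: (@le_trans _ _ (eta' * M)%:E); last by rewrite lee_fin ltW.
  apply: sub_add_le; [exact: u1|exact: vN|exact: HK|].
  by apply: ler_wpM2l; [exact: ltW|exact: HM].
have [a [b [ua vb]]] : exists a b : R, u z0 = a%:E /\ v z0 = b%:E.
  move: W1 (u1 _ Dz0) (vN _ Dz0); rewrite /W; case: (u z0) => [a||]; case: (v z0) => [b||] //.
  by move=> _ _ _; exists a, b.
exists z0, eta', a, b; split => // z Dz.
have := WD z Dz; rewrite /W ua vb -EFinN -!EFinD.
move: (u1 z Dz) (vN z Dz); case: (u z) => [a'||]; case: (v z) => [b'||] //= _ _.
- by rewrite -!EFinD !lee_fin; lra.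
- by move=> _; rewrite leNye.
Qed.

(** Expanding |z|^2 at the maximum point z0 gives u <= v + g - eta |z - z0|^2 with g affine and g z0
    = u z0 - v z0 = a - b. On the boundary of the small copy of N the last term is at most -del. A
    harmonic H squeezed there between u and v + g - del / 4 then satisfies a <= H z0 <= b + g z0 -
    del / 4 = a - del / 4, which is absurd. *)
Lemma comparison N p D u v : dirichlet_approx N -> N p ->
  open D -> compact (closure D) -> SH D u -> SH D (fun z => - v z)%E ->
  (forall x, boundary D x -> \forall z \near within D (nbhs x), (u z <= v z)%E) ->
  forall z, D z -> (u z <= v z)%E.
Proof.
move=> solN Np oD cD su sv bd z1 Dz1; rewrite leNgt; apply/negP => vu.
have [u1 u2 u3] := su; have [v1 v2 v3] := sv.
have [z0 [eta [a [b [Dz0 eta0 ua vb Hmax]]]]] := usc_sub_max oD cD u1 u2 v1 v2 bd Dz1 vu.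
have [oN cN _] := solN.
have [r r0 Hr] := iffLR (open_rnP _) oD z0 Dz0.
have [M HM] := compact_rn_bounded cN.
have M0 : 0 < M + rn p + 1.
  have := HM p (subset_closure Np); have := rn_ge0 p; lra.
(* Points of N are within M + |p| of p; the extra 1 leaves room s for passing to the closure of the
   copy. *)
pose s := r / (M + rn p + 1).
have s0 : 0 < s by rewrite divr_gt0.
pose T := rescale p z0 s^-1; pose N' := T @^-1` N.
have solN' : dirichlet_approx N' by exact: dirichlet_approx_rescale.
have [oN' cN' sol] := solN'.
have N'z0 : N' z0 by rewrite /N' /T /preimage /= /rescale subrr scaler0 addr0.
have N'D : closure N' `<=` D.
  move=> z /closure_rnP cz; apply: Hr.
  have [w Nw wz] := cz s s0.
  have h1 : rn (w - z0) <= s * (M + rn p).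
    have -> : rn (w - z0) = s * rn (T w - T z0).
      by rewrite rn_rescale gtr0_norm ?invr_gt0// mulrA divff ?mul1r// lt0r_neq0.
    rewrite ler_wpM2l ?(ltW s0)//; rewrite {2}/T /rescale subrr scaler0 addr0.
    apply: le_trans (rnD _ _) _; rewrite rnN lerD2r; apply: HM; exact: subset_closure.
  have h2 : s * (M + rn p) + s = r by rewrite /s; field; rewrite lt0r_neq0.
  by apply: le_lt_trans (rn_tri w _ _) _; rewrite rnC in wz; lra.
have rcN' : relatively_compact_open D N' by split.
have [d d0 Hd] := iffLR (open_rnP _) oN' z0 N'z0.
pose del := eta * d ^+ 2.
have del0 : 0 < del by rewrite mulr_gt0// exprn_gt0.
have bdN' x : boundary N' x -> closure N' x /\ d <= rn (x - z0).
  move=> /(open_boundary oN')[cx nx]; split => //.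
  by rewrite leNgt; apply/negP => /Hd.
have cS : compact (boundary N').
  apply: (@subclosed_compact _ _ (closure N')) => //; last by move=> x [].
  rewrite /boundary setDE; apply: closedI; first exact: closed_closure.
  apply: open_closedC; exact: open_interior.
have SD : boundary N' `<=` D by move=> x [/N'D].
pose g z := a - b - 2 * eta * rdot z0 (z - z0).
have cg : continuous g.
  move=> z; apply: (@eq_continuous_at R _ (fun z => (a - b + 2 * eta * rdot z0 z0) - 2 * eta * rdot z0 z)).
    by move=> w; rewrite /g rdotB; ring.
  apply: continuousB; first exact: cst_continuous.
  by apply: continuousM; [exact: cst_continuous|exact: continuous_rdot].
have hg : harmonic_on N' g.
  have := harmonicD oN' (harmonic_cst (a - b + 2 * eta * rdot z0 z0) oN') (harmonicZ (- (2 * eta)) oN' (harmonic_rdot z0 oN')).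
  rewrite (_ : (fun _ => _) = g)//; apply/funext => w.
  by rewrite /g rdotB; ring.
pose vv z := (v z + (g z - del / 2)%:E)%E.
have uvS z : boundary N' z -> (u z < vv z)%E.
  move=> bz; have [cz dz] := bdN' z bz; have Dz := N'D _ cz.
  have := Hmax z Dz; have := u1 z Dz; rewrite /vv.
  have q1 : d ^+ 2 <= rdot (z - z0) (z - z0).
    by apply: le_trans (rn_sqr_le _); rewrite ler_sqr ?nnegrE ?rn_ge0 ?(ltW d0).
  have q2 : a - b + eta * (rdot z0 z0 - rdot z z) <= g z - del.
    rewrite (rdot_sqr z z0) /g /del.
    have : eta * d ^+ 2 <= eta * rdot (z - z0) (z - z0) by rewrite ler_wpM2l// ltW.
    lra.
  move: (v1 z Dz); case: (v z) => [b'||] //=; case: (u z) => [a'||] // _ _.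
    by rewrite -!EFinD lee_fin lte_fin; lra.
  by rewrite -!EFinD ltNyr.
have lvv : lsc_on (boundary N') vv.
  have : usc_on (boundary N') (fun z => - v z + (- (g z - del / 2))%:E)%E.
    apply: usc_add; [by move=> z /SD; exact: v1|by move=> z _; rewrite ltry|exact: usc_onW SD v2|].
    apply: usc_cont; apply: continuous_subspaceT => z.
    exact: cvgN (cvgB (cg z) (cvg_cst _)).
  move=> /lsc_onN; rewrite (_ : (fun _ => _) = vv)//; apply/funext => z.
  by rewrite /vv EFinN fin_num_oppeD// !oppeK.
have [f [lf Hf]] := sandwich cS (usc_onW SD u2) lvv uvS.
have [|H [cH hH HH]] := sol f (del / 4) lf; first lra.
have aH : a <= H z0.
  rewrite -lee_fin -ua; apply: (u3 N' H) => // z bz.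
  have [/ltW h _] := Hf z bz; apply: (le_trans h); rewrite lee_fin.
  by have /andP[] := HH z bz.
have : (- v z0 <= (g z0 - del / 4 - H z0)%:E)%E.
  apply: (v3 N' (fun z => (g z - del / 4) - H z) rcN' _ _ _ z0 N'z0).
  - apply: within_contD; last exact: (within_contN cH).
    apply: continuous_subspaceT => z.
    exact: cvgB (cg z) (cvg_cst _).
  - apply: (harmonicD oN'); last exact: (harmonicN oN' hH).
    exact: (harmonicD oN' hg (harmonic_cst _ oN')).
  - move=> z bz; have /andP[_ h] := HH z bz; have [_] := Hf z bz.
    have := v1 z (SD _ bz); rewrite /vv; case: (v z) => [b'||] //= _.
      by rewrite -EFinD !lee_fin; lra.
    by rewrite leNye.
rewrite vb -EFinN lee_fin /g subrr.
have -> : rdot z0 0 = 0 by rewrite /rdot big1// => j _; rewrite !mxE /= !mulr0 addr0.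
rewrite mulr0 subr0; lra.
Qed.

(* If u1 + u2 <= h on the boundary, compare u1 with the superharmonic h - u2. *)
Lemma SH_add N p D u1 u2 : dirichlet_approx N -> N p ->
  open D -> SH D u1 -> SH D u2 -> SH D (fun z => u1 z + u2 z)%E.
Proof.
move=> solN Np oD s1 s2; have [a1 b1 _] := s1; have [a2 b2 _] := s2.
have us : usc_on D (fun z => u1 z + u2 z)%E by exact: usc_add.
split => //.
  by move=> z Dz; apply: lte_add_pinfty; [exact: a1|exact: a2].
move=> G h GD ch hh H z Gz; have [oG cG sub] := GD.
have GsD : G `<=` D by move=> w Gw; apply: sub; exact: subset_closure.
apply: lee_real_ge => e e0; rewrite -EFinD adde_le_swap; [|exact: a1 (GsD _ Gz)|exact: a2 (GsD _ Gz)].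
apply: (@comparison N p G u1 (fun z => (h z + e)%:E - u2 z)%E) => //.
- exact: SH_sub s1.
- have hhe : harmonic_on G (fun z => h z + e) by exact: (harmonicD oG hh (harmonic_cst e oG)).
  apply: SH_ext (SH_subharm (SH_sub GsD s2) hhe) => w Gw /=.
  exact: sube_swap.
- move=> x bx; have [cx nx] := open_boundary oG bx; have Dx := sub _ cx.
  have : (u1 x + u2 x < (h x + e / 2)%:E)%E.
    by apply: le_lt_trans (H x bx) _; rewrite lte_fin; lra.
  move=> /(us x Dx); rewrite !near_withinE => h1.
  have e2 : 0 < e / 2 by lra.
  have [d d0 Hd] := iffLR (within_contP _ _) ch x cx _ e2.
  apply: filterS2 (near_rn x d0) h1 => w wx h1 Gw; have Dw := GsD _ Gw.
  rewrite -adde_le_swap; [|exact: a1|exact: a2].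
  apply: le_trans (ltW (h1 Dw)) _; rewrite lee_fin.
  have := Hd w (subset_closure Gw) wx; rewrite ltr_norml; lra.
Qed.

End Subharmonic.

(** * The disc as a model domain in C *)

Section Disc.
Context {R : realType}.

Lemma dirichlet_approx_disc : dirichlet_approx (@unit_disc R).
Proof.
have oD : open (@unit_disc R).
  apply/open_rnP => l l1; exists (1 - rn l); first by rewrite subr_gt0.
  move=> w wl; have := rnD (w - l) l; rewrite /unit_disc /= subrK; lra.
have clD l : closure (@unit_disc R) l -> rn l <= 1.
  by apply: closure_ball_sub => z /ltW.
split => //.
  by apply: (@compact_closure_bounded R 1 _ 1) => l; exact: ltW.
(* [poisson_solution] needs data that are nonnegative on the circle: c is added to f and subtracted
   from the solution. *)
move=> f e [L fL] e0; pose c := `|f 0| + `|L|.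
have lf : lipschitz_rn (fun x => f x + c).
  by exists L => x y; rewrite opprD addrACA subrr addr0; exact: fL.
have [|H [h1 h2 h3 _]] := poisson_solution lf _ e0.
  move=> x x1; have := fL x 0; rewrite subr0 x1 mulr1 ler_norml => /andP[h _].
  have := ler_norm L; have := ler_norm (- f 0); rewrite normrN /c; lra.
exists (fun l => H l + - c); split.
- apply: within_contD; last by apply: continuous_subspaceT; exact: cst_continuous.
  by apply: within_cont_at => l /clD; exact: h2.
- exact: (harmonicD oD h1 (harmonic_cst _ oD)).
- move=> x /(open_boundary oD)[/clD x1 nx].
  have /h3 : rn x = 1 by apply/eqP; rewrite eq_le x1 leNgt; apply/negP.
  lra.
Qed.

Lemma SH1_add (D : set (Cn R 1)) u1 u2 : open D -> SH D u1 -> SH D u2 -> SH D (fun z => u1 z + u2 z)%E.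
Proof.
apply: (SH_add dirichlet_approx_disc (p := 0)).
by rewrite /unit_disc /= rn0.
Qed.

End Disc.

(** * Scaling and decreasing limits of subharmonic functions *)

Section SHClosure.
Context {R : realType} {n : nat}.
Implicit Types (A D G : set (Cn R n)) (u v : Cn R n -> \bar R) (h : Cn R n -> R).

Lemma within_contZ A (c : R) h : {within A, continuous h} ->
  {within A, continuous (fun z => c * h z)}.
Proof.
move=> /within_contP H; apply/within_contP => z Az e e0.
have c0 : 0 < 1 + `|c| by rewrite ltr_pwDl.
have [|d d0 Hd] := H z Az (e / (1 + `|c|)); first by rewrite divr_gt0.
exists d => // w Aw wz; have := Hd w Aw wz.
rewrite -mulrBr normrM ltr_pdivlMr// => h1; apply: le_lt_trans h1.
by rewrite mulrC ler_wpM2l// lerDr.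
Qed.

Lemma mule_lt_pinfty (c : R) (x : \bar R) : 0 < c -> (x < +oo)%E -> (c%:E * x < +oo)%E.
Proof. by move=> c0; case: x => [r||] // _; rewrite ?gt0_muleNy ?lte_fin// -EFinM ltry. Qed.

Lemma SH_scale D (c : R) u : 0 < c -> SH D u -> SH D (fun z => c%:E * u z)%E.
Proof.
move=> c0 [u1 u2 u3]; split.
- by move=> z /u1; exact: mule_lt_pinfty.
- move=> z Dz a; rewrite -lte_pdivlMl// => /(u2 z Dz).
  by apply: filterS => w; rewrite EFinM lte_pdivlMl.
- move=> G h GD ch hh H z Gz; have [oG _ _] := GD.
  rewrite -lee_pdivlMl//; apply: (u3 G (fun z => c^-1 * h z) GD _ _ _ z Gz).
  + exact: within_contZ.
  + exact: harmonicZ.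
  + by move=> w /H; rewrite -lee_pdivlMl.
Qed.

Lemma SH_addc D (c : R) u : open D -> SH D u -> SH D (fun z => u z + c%:E)%E.
Proof.
move=> oD su; have := SH_subharm su (harmonic_cst (- c) oD).
by apply: SH_ext => z _; rewrite EFinN oppeK.
Qed.

(** Dini: the sets {uk < h + e} increase with k and cover the compact boundary of G, so some uk is
    below h + e on all of it, and the property of uk passes to u <= uk. *)
Lemma SH_decreasing D (uk : nat -> Cn R n -> \bar R) u :
  (forall k, SH D (uk k)) -> (forall k z, D z -> (uk k.+1 z <= uk k z)%E) ->
  (forall k z, D z -> (u z <= uk k z)%E) ->
  (forall z (a : R), D z -> (u z < a%:E)%E -> exists k, (uk k z < a%:E)%E) -> SH D u.
Proof.
move=> sk dk le lt.
have mk k l z : (k <= l)%N -> D z -> (uk l z <= uk k z)%E.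
  move=> + Dz; elim: l => [|l IH]; first by rewrite leqn0 => /eqP ->.
  rewrite leq_eqVlt => /orP[/eqP ->//|]; rewrite ltnS => /IH; apply: le_trans.
  exact: dk.
split.
- by move=> z Dz; apply: le_lt_trans (le 0%N z Dz) _; have [+ _ _] := sk 0%N; apply.
- move=> z Dz a /(lt z a Dz)[k ka]; have [_ usk _] := sk k.
  have := usk z Dz a ka; rewrite !near_withinE.
  by apply: filterS => w H Dw; apply: le_lt_trans (le k w Dw) (H Dw).
- move=> G h GD ch hh H z Gz; have [oG cG sub] := GD.
  apply: lee_real_ge => e e0; have e2 : 0 < e / 2 by lra.
  have cB : compact (boundary G).
    apply: (@subclosed_compact _ _ (closure G)) => //; last by move=> x [].
    rewrite /boundary setDE; apply: closedI; first exact: closed_closure.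
    apply: open_closedC; exact: open_interior.
  pose U k := [set x : Cn R n | \forall w \near x, boundary G w -> (uk k w < (h w + e)%:E)%E].
  have [|||k Hk] := @compact_increasing R n _ U cB.
  + by move=> k; exact: open_near.
  + move=> k l kl x; apply: filterS => w Hw bw; apply: le_lt_trans (Hw bw).
    by apply: mk => //; apply: sub; case: bw.
  + move=> x bx; have cx : closure G x by case: bx.
    have Dx := sub _ cx.
    have : (u x < (h x + e / 2)%:E)%E by apply: le_lt_trans (H x bx) _; rewrite lte_fin; lra.
    move=> /(lt x _ Dx)[k ka]; exists k.
    have [_ usk _] := sk k; have := usk x Dx _ ka; rewrite near_withinE => h1.
    have [d d0 Hd] := iffLR (within_contP _ _) ch x cx _ e2.
    apply: filterS2 (near_rn x d0) h1 => w wx h1 [cw _].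
    apply: lt_le_trans (h1 (sub _ cw)) _; rewrite lee_fin.
    have := Hd w cw wx; rewrite ltr_norml; lra.
  have Dz : D z by apply: sub; exact: subset_closure.
  apply: le_trans (le k z Dz) _; have [_ _ k3] := sk k.
  rewrite -EFinD; apply: (k3 G (fun z => h z + e) GD _ _ _ z Gz).
  + by apply: (within_contD ch); apply: continuous_subspaceT; exact: cst_continuous.
  + exact: (harmonicD oG hh (harmonic_cst e oG)).
  + by move=> w bw; apply/ltW; exact: (nbhs_singleton (Hk w bw)).
Qed.

End SHClosure.

(** * Operations on plurisubharmonic functions: sums, limits, gluing, suprema *)

Section Lines.
Context {R : realType} {n : nat}.
Implicit Types (D G Om : set (Cn R n)) (u v w P : Cn R n -> \bar R) (a b t : Cn R n).

Lemma rn_complex_line a b l l' : rn (complex_line a b l - complex_line a b l') = rn (l - l') * rn b.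
Proof.
have E (x y z : Cn R n) : (x + y) - (x + z) = y - z by rewrite opprD addrACA subrr add0r.
by rewrite /complex_line E -scalerBl rnZ rn_c1 c1B.
Qed.

Lemma continuous_complex_line a b : continuous (complex_line a b).
Proof.
move=> l; apply/(@continuous_rnP R n _ _ (nbhs_filter l)) => e e0.
have b0 : 0 < 1 + rn b by have := rn_ge0 b; lra.
apply: filterS (near_rn l (_ : 0 < e / (1 + rn b))); last by rewrite divr_gt0.
move=> w /=; rewrite ltr_pdivlMr// => wl; rewrite rn_complex_line; apply: le_lt_trans wl.
by rewrite ler_wpM2l ?rn_ge0// lerDr.
Qed.

Lemma open_complex_line D a b : open D -> open (complex_line a b @^-1` D).
Proof. by move=> oD; apply: open_comp => // l _; exact: continuous_complex_line. Qed.

Lemma complex_line_translate a b t l : complex_line (a + t) b l = complex_line a b l + t.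
Proof. by rewrite /complex_line addrAC. Qed.

Lemma PSH_ext D u v : (forall z, D z -> u z = v z) -> PSH D u -> PSH D v.
Proof.
move=> uv [u1 u2 u3]; split.
- by move=> z Dz; rewrite -uv//; exact: u1.
- move=> z Dz a; rewrite -uv// => za; have := u2 z Dz a za; rewrite !near_withinE.
  by apply: filterS => w H Dw; rewrite -uv//; exact: H.
- by move=> a b; apply: SH_ext (u3 a b) => l Dl /=; rewrite uv.
Qed.

Lemma PSH_sub D G u : G `<=` D -> PSH D u -> PSH G u.
Proof.
move=> GD [u1 u2 u3]; split; first by move=> z /GD; exact: u1.
  exact: usc_onW u2.
by move=> a b; apply: SH_sub (u3 a b) => l; exact: GD.
Qed.

Lemma PSH_add D u v : open D -> PSH D u -> PSH D v -> PSH D (fun z => u z + v z)%E.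
Proof.
move=> oD [u1 u2 u3] [v1 v2 v3]; split.
- by move=> z Dz; apply: lte_add_pinfty; [exact: u1|exact: v1].
- exact: usc_add.
- move=> a b; exact: (SH1_add (@open_complex_line D a b oD) (u3 a b) (v3 a b)).
Qed.

Lemma PSH_scale D (c : R) u : 0 < c -> PSH D u -> PSH D (fun z => c%:E * u z)%E.
Proof.
move=> c0 [u1 u2 u3]; split.
- by move=> z /u1; exact: mule_lt_pinfty.
- move=> z Dz a; rewrite -lte_pdivlMl// => /(u2 z Dz).
  by apply: filterS => w; rewrite EFinM lte_pdivlMl.
- by move=> a b; exact: (SH_scale c0 (u3 a b)).
Qed.

Lemma PSH_addc D (c : R) u : open D -> PSH D u -> PSH D (fun z => u z + c%:E)%E.
Proof.
move=> oD [u1 u2 u3]; split.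
- by move=> z Dz; apply: lte_add_pinfty; [exact: u1|rewrite ltry].
- apply: usc_add => //; first by move=> z _; rewrite ltry.
  by apply: usc_cont; apply: continuous_subspaceT; exact: cst_continuous.
- by move=> a b; exact: (SH_addc c (@open_complex_line D a b oD) (u3 a b)).
Qed.

Lemma PSH_decreasing D (uk : nat -> Cn R n -> \bar R) u :
  (forall k, PSH D (uk k)) -> (forall k z, D z -> (uk k.+1 z <= uk k z)%E) ->
  (forall k z, D z -> (u z <= uk k z)%E) ->
  (forall z (a : R), D z -> (u z < a%:E)%E -> exists k, (uk k z < a%:E)%E) -> PSH D u.
Proof.
move=> sk dk le lt; split.
- by move=> z Dz; apply: le_lt_trans (le 0%N z Dz) _; have [+ _ _] := sk 0%N; apply.
- move=> z Dz a /(lt z a Dz)[k ka]; have [_ usk _] := sk k.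
  have := usk z Dz a ka; rewrite !near_withinE.
  by apply: filterS => w H Dw; apply: le_lt_trans (le k w Dw) (H Dw).
- move=> a b; apply: (@SH_decreasing R 1 _ (fun k => uk k \o complex_line a b)).
  + by move=> k; have [_ _] := sk k; apply.
  + by move=> k l /= Dl; exact: dk.
  + by move=> k l /= Dl; exact: le.
  + by move=> l c /= Dl; exact: lt.
Qed.

Definition glue_max G P v z : \bar R := if `[< G z >] then maxe (P z) (v z) else P z.

Lemma glue_ge G P v z : (P z <= glue_max G P v z)%E.
Proof. by rewrite /glue_max; case: asboolP => // _; rewrite le_max lexx. Qed.

Lemma glue_usc D G P v : open D -> open G -> usc_on D P -> usc_on G v ->
  (forall x, boundary G x -> (upper_reg G v x <= P x)%E) -> usc_on D (glue_max G P v).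
Proof.
move=> oD oG uP uv bd z Dz a za.
have Pa : (P z < a%:E)%E by apply: le_lt_trans za; exact: glue_ge.
have va : \forall w \near within G (nbhs z), (v w < a%:E)%E.
  have [Gz|nGz] := pselect (G z).
    apply: (uv z Gz); apply: le_lt_trans za.
    by rewrite /glue_max asboolT// le_max lexx orbT.
  have [cz|ncz] := pselect (closure G z).
    apply: upper_reg_lt; apply: le_lt_trans Pa; apply: bd; split => //.
    by rewrite (iffLR (@interior_id _ G) oG).
  rewrite near_withinE.
  have : nbhs z (~` closure G).
    by apply: open_nbhs_nbhs; split => //; apply: closed_openC; exact: closed_closure.
  by apply: filterS => w nw Gw; exfalso; apply: nw; exact: subset_closure.
move: va (uP z Dz a Pa); rewrite !near_withinE; apply: filterS2 => w h1 h2 Dw.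
rewrite /glue_max; case: asboolP => [Gw|_]; last exact: h2.
by rewrite gt_max h2// h1.
Qed.

(** On a line, P <= h is known first, as P lies below the glued function. For v one works on W, the
    part of the test set G1 that the line sends into G. A boundary point of W is either on the
    boundary of G1 and sent into G, where the maximum is at most h, or sent to the boundary of G,
    where v^* <= P <= h. *)
Lemma PSH_glue D G P v : open D -> open G -> closure G `<=` D -> PSH D P -> PSH G v ->
  (forall x, boundary G x -> (upper_reg G v x <= P x)%E) -> PSH D (glue_max G P v).
Proof.
move=> oD oG cGD sP sv bd; have [P1 P2 P3] := sP; have [v1 v2 v3] := sv.
have gusc : usc_on D (glue_max G P v) by exact: glue_usc.
have glt z : D z -> (glue_max G P v z < +oo)%E.
  move=> Dz; rewrite /glue_max; case: asboolP => [Gz|_]; last exact: P1.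
  by rewrite gt_max P1// v1.
split => // a b; set L := complex_line a b.
have cL : continuous L by exact: continuous_complex_line.
have oDL : open (L @^-1` D) by exact: open_complex_line.
split; first by move=> l; exact: glt.
  move=> l Dl c lc; have := gusc _ Dl c lc; rewrite !near_withinE => H.
  exact: (cL l _ H).
move=> G1 h G1D ch hh H l0 G1l0; have [oG1 cG1 sub] := G1D.
have PH l : G1 l -> (P (L l) <= (h l)%:E)%E.
  move=> G1l; have [_ _ p3] := P3 a b; apply: (p3 G1 h G1D ch hh _ l G1l).
  by move=> x bx; apply: le_trans (H x bx); exact: glue_ge.
rewrite /= /glue_max; case: asboolP => [Gl0|_]; last exact: PH.
rewrite ge_max PH//=; apply: lee_real_ge => e e0; have e2 : 0 < e / 2 by lra.
pose W := G1 `&` (L @^-1` G).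
have oW : open W by apply: openI => //; exact: open_complex_line.
have WG1 : W `<=` G1 by move=> x [].
have clW x : closure W x -> closure G1 x by exact: closureS.
have cW : compact (closure W).
  by apply: (@subclosed_compact _ _ (closure G1)) => //; exact: closed_closure.
rewrite -EFinD; apply: (@SH_near_boundary R 1 W (v \o L) (fun l => h l + e) oW cW _ _ _ l0 _).
- by apply: SH_sub (v3 a b) => x [].
- apply: (harmonicD oW); last exact: (harmonic_cst _ oW).
  exact: harmonic_sub hh.
- move=> x bx; have [cx nWx] := open_boundary oW bx; have cG1x := clW _ cx.
  have DLx : D (L x) by exact: sub.
  have cGLx : closure G (L x).
    move=> B /cL /cx[y [[_ Gy] By]]; by exists (L y).
  have key : \forall w \near within G (nbhs (L x)), (v w < (h x + e / 2)%:E)%E.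
    have lt1 (y : \bar R) : (y <= (h x)%:E)%E -> (y < (h x + e / 2)%:E)%E.
      by move=> yh; apply: le_lt_trans yh _; rewrite lte_fin; lra.
    have [GLx|nGLx] := pselect (G (L x)).
      apply: v2 => //; apply: lt1.
      have nG1x : ~ G1 x by move=> G1x; exact: nWx.
      have bG1 : boundary G1 x by split => //; rewrite (iffLR (@interior_id _ G1) oG1).
      apply: le_trans (H x bG1); rewrite /= /glue_max asboolT//.
      by rewrite le_max lexx orbT.
    apply: upper_reg_lt; apply: le_lt_trans (bd _ _) (lt1 _ _).
      by split => //; rewrite (iffLR (@interior_id _ G) oG).
    have [/PH//|nG1x] := pselect (G1 x).
    have bG1 : boundary G1 x by split => //; rewrite (iffLR (@interior_id _ G1) oG1).
    by apply: le_trans (H x bG1); exact: glue_ge.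
  have key2 : \forall y \near x, G (L y) -> (v (L y) < (h x + e / 2)%:E)%E.
    by move: key; rewrite near_withinE => /cL.
  have [d d0 Hd] := iffLR (within_contP _ _) ch x cG1x _ e2.
  apply: filterS2 (near_rn x d0) key2 => y yx h1 [G1y Gy].
  apply: le_trans (ltW (h1 Gy)) _; rewrite lee_fin.
  have := Hd y (subset_closure G1y) yx; rewrite ltr_norml; lra.
- by [].
Qed.

(** The regularization looks at neighbours in C^n, which leave the line. Hence every member of the
    family is tested on all translates L + t with t small: compactness of the boundary of G makes
    the bound h + e hold there uniformly in t, and it propagates to the interior for each member
    separately. *)
Lemma PSH_sup_reg Om (F : set (Cn R n -> \bar R)) : open Om ->
  (forall u, F u -> PSH Om u) ->
  (forall z, Om z -> (upper_reg Om (fun x => ereal_sup [set u x | u in F]) z < +oo)%E) ->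
  PSH Om (upper_reg Om (fun x => ereal_sup [set u x | u in F])).
Proof.
move=> oO FP; set S : Cn R n -> \bar R := (fun x => ereal_sup _) => finU; set U := upper_reg Om S.
have uU : usc_on Om U by exact: upper_reg_usc.
split; [exact: finU|exact: uU|move=> a b]; set L := complex_line a b.
have cL : continuous L by exact: continuous_complex_line.
split; first by move=> l; exact: finU.
  move=> l Dl c lc; have := uU _ Dl c lc; rewrite !near_withinE => H.
  exact: (cL l _ H).
move=> G h GO ch hh H l0 Gl0; have [oG cG sub] := GO.
apply: lee_real_ge => e e0; have e2 : 0 < e / 2 by lra.
have cLG : compact (L @` closure G).
  by apply: continuous_compact => //; apply: continuous_subspaceT.
have [|d0 d00 Hd0] := compact_nbhd_ball cLG oO.
  by move=> _ [l cl <-]; exact: sub.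
have cB : compact (boundary G).
  apply: (@subclosed_compact _ _ (closure G)) => //; last by move=> x [].
  rewrite /boundary setDE; apply: closedI; first exact: closed_closure.
  apply: open_closedC; exact: open_interior.
pose V (k : nat) := [set l : Cn R 1 | \forall l' \near l, boundary G l' ->
  forall t, rn t < k.+1%:R^-1 -> Om (L l' + t) -> (S (L l' + t)%R < (h l' + e)%:E)%E].
have [|||k Hk] := @compact_increasing R 1 _ V cB.
- by move=> k; exact: open_near.
- move=> k m km l; apply: filterS => l' Hl bl t tm; apply: Hl => //; apply: lt_le_trans tm _.
  by rewrite lef_pV2 ?posrE ?ltr0Sn// ler_nat.
- move=> x bx; have cx : closure G x by case: bx.
  have : (U (L x) < (h x + e / 2)%:E)%E.
    by apply: le_lt_trans (H x bx) _; rewrite lte_fin; lra.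
  move=> /upper_reg_lt; rewrite near_withinE => /nbhs_rnP[d1 d10 Hd1].
  have d12 : 0 < d1 / 2 by lra.
  have [d d_0 Hd] := iffLR (within_contP _ _) ch x cx _ e2.
  have [k Hk] : exists k : nat, k.+1%:R^-1 < d1 / 2.
    exists (Num.truncn (d1 / 2)^-1).
    rewrite invf_plt ?posrE ?ltr0Sn//; exact: truncnS_gt.
  exists k.
  apply: filterS2 (near_rn x d_0) (cL x _ (near_rn (L x) d12)) => l' l'x Ll' [cl' _] t tk Ot.
  apply: lt_le_trans (Hd1 _ _ Ot) _.
    have -> : L l' + t - L x = (L l' - L x) + t by rewrite addrAC.
    by apply: le_lt_trans (rnD _ _) _; have := lt_trans tk Hk; move: Ll'; rewrite /preimage/=; lra.
  rewrite lee_fin; have := Hd l' cl' l'x; rewrite ltr_norml; lra.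
pose dl := Num.min d0 k.+1%:R^-1.
have dl0 : 0 < dl by rewrite lt_min d00 invr_gt0 ltr0Sn.
have key t l : rn t < dl -> G l -> (S (L l + t)%R <= (h l + e)%:E)%E.
  rewrite lt_min => /andP[td0 tk] Gl; apply: ge_ereal_sup => _ [u Fu <-].
  have [_ _ u3] := FP u Fu; have [_ _ w3] := u3 (a + t) b.
  have Om_t x : closure G x -> Om (L x + t).
    by move=> cx; apply: (Hd0 (L x)); [exists x|rewrite addrC addKr].
  have -> : u (L l + t) = (u \o complex_line (a + t) b) l by rewrite /= complex_line_translate.
  apply: (w3 G (fun l => h l + e) _ _ _ _ l Gl).
  + by split => // x cx; rewrite /preimage /= complex_line_translate; exact: Om_t.
  + by apply: (within_contD ch); apply: continuous_subspaceT; exact: cst_continuous.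
  + exact: (harmonicD oG hh (harmonic_cst e oG)).
  + move=> x bx; rewrite /= complex_line_translate -/L.
    have cx : closure G x by case: bx.
    apply: le_trans (ltW (nbhs_singleton (Hk x bx) bx t tk (Om_t x cx))).
    by apply: ereal_sup_ubound; exists u.
rewrite -EFinD; apply: upper_reg_le; rewrite near_withinE.
apply: filterS (near_rn (L l0) dl0) => w wl _.
have -> : w = L l0 + (w - L l0) by rewrite addrC subrK.
exact: key.
Qed.

End Lines.

(** * Plurisubharmonic functions are subharmonic *)

Section PSHisSH.
Context {R : realType}.

Lemma harmonic_quad (G : set (Cn R 1)) (a A B P Q : R) : open G ->
  harmonic_on G (fun l => a + A * Re (c1 l) + B * Im (c1 l) +
    P * (Re (c1 l) ^+ 2 - Im (c1 l) ^+ 2) + Q * (Re (c1 l) * Im (c1 l))).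
Proof.
move=> oG.
pose D (k : bool * 'I_1) (l : Cn R 1) : R :=
  if k.1 then B - 2 * P * Im (c1 l) + Q * Re (c1 l) else A + 2 * P * Re (c1 l) + Q * Im (c1 l).
pose DD (k k' : bool * 'I_1) (l : Cn R 1) : R :=
  if k.1 then (if k'.1 then - 2 * P else Q) else (if k'.1 then Q else 2 * P).
have RL l k (t : R) : Re (c1 (real_line l k t)) = Re (c1 l) + t * (if k.1 then 0 else 1).
  rewrite c1_real_line cReD cReM /cdir; case: k.1 => /=; ring.
have IL l k (t : R) : Im (c1 (real_line l k t)) = Im (c1 l) + t * (if k.1 then 1 else 0).
  rewrite c1_real_line cImD cImM /cdir; case: k.1 => /=; ring.
have cR l : {for l, continuous (fun l : Cn R 1 => Re (c1 l))} by exact: continuous_coordRe.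
have cI l : {for l, continuous (fun l : Cn R 1 => Im (c1 l))} by exact: continuous_coordIm.
have cC (c : R) l : {for l, continuous (fun l : Cn R 1 => c)} by exact: cst_continuous.
apply: (@harmonic_intro R 1 _ _ D DD oG).
- move=> l Gl; split=> [|k|k|k k'|k k'].
  + apply: continuousD; last by apply: continuousM; [exact: cC|exact: continuousM].
    apply: continuousD.
      apply: continuousD; last by apply: continuousM; [exact: cC|exact: cI].
      by apply: continuousD; [exact: cC|apply: continuousM; [exact: cC|exact: cR]].
    apply: continuousM; first exact: cC.
    apply: (@eq_continuous_at R _ (fun l => Re (c1 l) * Re (c1 l) - Im (c1 l) * Im (c1 l))).
      by move=> w; rewrite !expr2.
    by apply: continuousB; exact: continuousM.
  + rewrite /D; case E : k.1.
      by apply: (@is_derive_quadratic _ _ (a + A * Re (c1 l) + B * Im (c1 l) +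
         P * (Re (c1 l) ^+ 2 - Im (c1 l) ^+ 2) + Q * (Re (c1 l) * Im (c1 l))) _ (- P)) => t; rewrite RL IL E; ring.
    by apply: (@is_derive_quadratic _ _ (a + A * Re (c1 l) + B * Im (c1 l) +
         P * (Re (c1 l) ^+ 2 - Im (c1 l) ^+ 2) + Q * (Re (c1 l) * Im (c1 l))) _ P) => t; rewrite RL IL E; ring.
  + rewrite /D; case E : k.1.
      apply: continuousD; last by apply: continuousM; [exact: cC|exact: cR].
      by apply: continuousB; [exact: cC|apply: continuousM; [exact: cC|exact: cI]].
    apply: continuousD; last by apply: continuousM; [exact: cC|exact: cI].
    by apply: continuousD; [exact: cC|apply: continuousM; [exact: cC|exact: cR]].
  + rewrite /DD /D; case E' : k'.1; case E : k.1.
    * by apply: (@is_derive_quadratic _ _ (B - 2 * P * Im (c1 l) + Q * Re (c1 l)) _ 0) => t; rewrite RL IL E; ring.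
    * by apply: (@is_derive_quadratic _ _ (B - 2 * P * Im (c1 l) + Q * Re (c1 l)) _ 0) => t; rewrite RL IL E; ring.
    * by apply: (@is_derive_quadratic _ _ (A + 2 * P * Re (c1 l) + Q * Im (c1 l)) _ 0) => t; rewrite RL IL E; ring.
    * by apply: (@is_derive_quadratic _ _ (A + 2 * P * Re (c1 l) + Q * Im (c1 l)) _ 0) => t; rewrite RL IL E; ring.
  + exact: cC.
- by move=> l _; rewrite sum_dir1 /DD /=; ring.
Qed.

Lemma open_disc (r : R) : open [set l : Cn R 1 | rn l < r].
Proof.
apply/open_rnP => l l1; exists (r - rn l); first by rewrite subr_gt0.
move=> w wl; have := rnD (w - l) l; rewrite /= subrK; lra.
Qed.

Lemma closure_disc (r : R) l : closure [set l : Cn R 1 | rn l < r] l -> rn l <= r.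
Proof. by apply: closure_ball_sub => z /ltW. Qed.

Lemma boundary_disc (r : R) l : boundary [set l : Cn R 1 | rn l < r] l -> rn l = r.
Proof.
move=> /(open_boundary (@open_disc r))[/closure_disc l1 l2].
by apply/eqP; rewrite eq_le l1 leNgt; apply/negP.
Qed.

Lemma compact_disc (r : R) : compact (closure [set l : Cn R 1 | rn l < r]).
Proof. by apply: (@compact_closure_bounded R 1 _ r) => l; exact: ltW. Qed.

(* At a maximum point of V - h + eta |z|^2 some coordinate direction has
   Laplacian of h at most 0; on that line the second-order Taylor polynomial of
   h lies below a harmonic one, which contradicts subharmonicity of V there. *)
Lemma PSH_SH (n : nat) (D : set (Cn R n)) (V : Cn R n -> \bar R) :
  (0 < n)%N -> open D -> PSH D V -> SH D V.
Proof.
move=> n0 oD [V1 V2 V3]; split => // G h GD ch hh H z1 Gz1; rewrite leNgt; apply/negP => hV.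
have [oG cG sub] := GD.
have [e0 [e0h e0V]] := ereal_between hV; rewrite lte_fin in e0h.
pose e := e0 - h z1.
have e_0 : 0 < e by rewrite subr_gt0.
have GsD : G `<=` D by move=> x Gx; apply: sub; exact: subset_closure.
have [||||||z0 [eta [a [b [Gz0 eta0 Va hb Hmax]]]]] :=
    @usc_sub_max R n G V (fun z => (h z + e)%:E) z1 oG cG _ _ _ _ _ Gz1.
- by move=> z /GsD; exact: V1.
- exact: usc_onW V2.
- by move=> z _; rewrite -EFinN ltry.
- apply: (@usc_cont _ _ _ (fun z => - (h z + e))); apply: within_contN.
  apply: within_contD; last by apply: continuous_subspaceT; exact: cst_continuous.
  by apply: within_cont_at => z; exact: harmonic_continuous hh.
- move=> x bx; have cx : closure G x by case: bx.
  have : (V x < (h x + e / 2)%:E)%E by apply: le_lt_trans (H x bx) _; rewrite lte_fin; lra.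
  move=> /(V2 x (sub _ cx)); rewrite !near_withinE => h1.
  have e2 : 0 < e / 2 by lra.
  have [d d0 Hd] := iffLR (within_contP _ _) ch x cx _ e2.
  apply: filterS2 (near_rn x d0) h1 => w wx h1 Gw.
  apply: le_trans (ltW (h1 (GsD _ Gw))) _; rewrite lee_fin.
  have := Hd w (subset_closure Gw) wx; rewrite ltr_norml; lra.
- by rewrite /e addrC subrK.
have [Dh [DDh [hd tr]]] := harmonic_data_trace hh.
have [j Hj] : exists j : 'I_n, DDh (false, j) (false, j) z0 + DDh (true, j) (true, j) z0 <= 0.
  apply: contrapT => Hn.
  have pos j : 0 < DDh (false, j) (false, j) z0 + DDh (true, j) (true, j) z0.
    by rewrite ltNge; apply/negP => h0; apply: Hn; exists j.
  have := tr z0 Gz0; rewrite (eq_bigr (fun k => DDh (k.1, k.2) (k.1, k.2) z0)); last by case.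
  rewrite -(pair_bigA _ (fun i j => DDh (i, j) (i, j) z0)) /= big_bool -big_split /= => E.
  have : 0 < \sum_(j < n) (DDh (true, j) (true, j) z0 + DDh (false, j) (false, j) z0).
    rewrite (bigD1 (Ordinal n0))//=; apply: ltr_pwDl; first by rewrite addrC.
    by apply: sumr_ge0 => i _; rewrite addrC ltW.
  by rewrite E ltxx.
have eta2 : 0 < eta / 2 by lra.
have [r r0 Hr] := harmonic_taylor j oG hd Gz0 eta2.
have [r' r'0 Hr'] := iffLR (open_rnP _) oG z0 Gz0.
pose s := Num.min r r' / 2.
have s0 : 0 < s by rewrite divr_gt0// lt_min r0.
have sr : s < r.
  have : Num.min r r' <= r by rewrite ge_min lexx.
  rewrite /s; lra.
have sr' : s < r'.
  have : Num.min r r' <= r' by rewrite ge_min lexx orbT.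
  rewrite /s; lra.
pose ej : Cn R n := delta_mx ord0 j.
pose L := complex_line z0 ej.
have Lreal l : L l = real_line (real_line z0 (true, j) (Im (c1 l))) (false, j) (Re (c1 l)).
  rewrite /L /complex_line /real_line /real_dir /= -addrA; congr (_ + _).
  rewrite scale1r scalerA -scalerDl; congr (_ *: _); rewrite -/(c1 l).
  by apply/eqP; rewrite eq_complex; apply/andP; split; apply/eqP; case: (c1 l) => x y /=; ring.
have rnej : rn ej = 1.
  apply/eqP; rewrite eq_le; apply/andP; split.
    have := @rn_real_dir R n (false, j); rewrite /real_dir /= scale1r; exact.
  have := rn_coord ej j; rewrite mxE !eqxx /=; apply: le_trans.
  by rewrite cabs_def /= expr1n expr0n addr0 sqrtr1.
have Lz0 l : rn (L l - z0) = rn l.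
  have -> : z0 = L 0 by rewrite /L /complex_line mxE scale0r addr0.
  by rewrite rn_complex_line rnej mulr1 subr0.
have GL l : rn l <= s -> G (L l).
  by move=> ls; apply: Hr'; rewrite Lz0; exact: le_lt_trans sr'.
have dotL l : rdot z0 (L l - z0) = Re (z0 ord0 j) * Re (c1 l) + Im (z0 ord0 j) * Im (c1 l).
  rewrite /L /complex_line addrC addKr /rdot (bigD1 j)//= big1 ?addr0; last first.
    by move=> i ij; rewrite !mxE (negbTE ij) andbF mulr0 /= !mulr0 addr0.
  by rewrite !mxE !eqxx mulr1.
have sqL l : rdot (L l - z0) (L l - z0) = Re (c1 l) ^+ 2 + Im (c1 l) ^+ 2.
  rewrite /L /complex_line addrC addKr /rdot (bigD1 j)//= big1 ?addr0; last first.
    by move=> i ij; rewrite !mxE (negbTE ij) andbF mulr0 /= !mulr0 addr0.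
  by rewrite !mxE !eqxx mulr1 -!expr2.
set al := DDh (false, j) (false, j) z0 in Hj Hr; set ga := DDh (true, j) (true, j) z0 in Hj Hr.
set be := DDh (true, j) (false, j) z0 in Hr.
(* On |l| = s the maximum property contributes - eta s^2 and the Taylor error at most eta / 2 s^2,
   whence the constant term. The non-harmonic part (al + ga) |l|^2 / 4 of the Taylor polynomial is
   nonpositive by the choice of j and is dropped. The contradiction is a <= q 0 = a - eta / 2
   s^2. *)
pose q l : R := (a - eta / 2 * s ^+ 2) + (Dh (false, j) z0 - 2 * eta * Re (z0 ord0 j)) * Re (c1 l)
  + (Dh (true, j) z0 - 2 * eta * Im (z0 ord0 j)) * Im (c1 l)
  + (al - ga) / 4 * (Re (c1 l) ^+ 2 - Im (c1 l) ^+ 2) + be * (Re (c1 l) * Im (c1 l)).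
have hq (G' : set (Cn R 1)) : open G' -> harmonic_on G' q.
  by move=> oG'; exact: harmonic_quad.
have [_ _ L3] := V3 z0 ej.
have : ((V \o L) 0%R <= (q 0%R)%:E)%E.
  apply: (L3 [set l | rn l < s] q _ _ _ _ 0 _).
  - split; [exact: open_disc|exact: compact_disc|].
    by move=> l /closure_disc ls; apply: GsD; exact: GL.
  - apply: within_cont_at => l _; exact: (harmonic_continuous (hq setT openT) I).
  - exact: (hq _ (@open_disc s)).
  - move=> l /boundary_disc ls; rewrite /= -/(L l).
    have GLl : G (L l) by apply: GL; rewrite ls.
    apply: le_trans (Hmax _ GLl) _; rewrite -EFinD lee_fin.
    have xr : `|Re (c1 l)| < r by apply: le_lt_trans (Re_le_cabs _) _; rewrite -rn_c1 ls.
    have yr : `|Im (c1 l)| < r by apply: le_lt_trans (Im_le_cabs _) _; rewrite -rn_c1 ls.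
    have := Hr _ _ xr yr; rewrite -Lreal ler_norml => /andP[_ T].
    have bE : b = h z0 + e by case: hb.
    have s2 : Re (c1 l) ^+ 2 + Im (c1 l) ^+ 2 = s ^+ 2 by rewrite -cabs_sqr -rn_c1 ls.
    rewrite (rdot_sqr (L l) z0) dotL sqL s2 /q bE; rewrite s2 in T.
    have c1' : (al + ga) * s ^+ 2 <= 0 by rewrite mulr_le0_ge0// ?sqr_ge0// addrC.
    have E1 : al * Re (c1 l) ^+ 2 / 2 + ga * Im (c1 l) ^+ 2 / 2 =
        (al - ga) / 4 * (Re (c1 l) ^+ 2 - Im (c1 l) ^+ 2) + (al + ga) * s ^+ 2 / 4.
      by rewrite -s2; field.
    move: T E1 c1'; rewrite -/al -/be -/ga.
    move: (h (L l)) (h z0) (Dh _ z0) (Dh _ z0) (Re (c1 l)) (Im (c1 l)) (Re (z0 ord0 j)) (Im (z0 ord0 j)).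
    move=> hl h0 d1 d2 x y p1 p2 T E1 c1'.
    lra.
  - by rewrite /= rn0.
have L0 : L 0 = z0 by rewrite /L /complex_line mxE scale0r addr0.
rewrite /= -/(L 0) L0 Va /q lee_fin /c1 mxE /=.
have : 0 < eta / 2 * s ^+ 2 by rewrite mulr_gt0// exprn_gt0.
rewrite !(mulr0, expr0n) /= !(subr0, mulr0, addr0); lra.
Qed.

End PSHisSH.

(** * Harnack's inequality and its consequences for pluripolar sets *)

Section Harnack.
Context {R : realType}.

Lemma lipschitz_max0 (n : nat) (f : Cn R n -> R) : lipschitz_rn f ->
  lipschitz_rn (fun x => Num.max (f x) 0).
Proof.
move=> [k Hk]; exists k => x y; apply: le_trans (Hk x y).
case: (leP (f x) 0) => fx; case: (leP (f y) 0) => fy; rewrite ?subrr ?normr0// ?sub0r ?subr0 ?normrN.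
- by rewrite gtr0_norm// ler0_norm; lra.
- by rewrite gtr0_norm// ger0_norm; lra.
Qed.

Lemma disc_rel_compact (D : set (Cn R 1)) : (forall l, rn l <= 1 -> D l) ->
  relatively_compact_open D (@unit_disc R).
Proof.
move=> HD; split; [exact: open_disc|exact: compact_disc|].
by move=> l /closure_disc /HD.
Qed.

(* On the circle put a Lipschitz f between u and v; on |q| <= 1/2 the sum of
   Poisson kernels solving for f is at most three times its value at 0. *)
Lemma harnack_disc (D : set (Cn R 1)) (u v : Cn R 1 -> \bar R) (c : R) q :
  (forall l, rn l <= 1 -> D l) -> SH D u -> SH D (fun l => - v l)%E ->
  (forall l, rn l = 1 -> (0 <= v l)%E) -> (forall l, rn l = 1 -> (u l <= v l)%E) ->
  (v 0%R <= c%:E)%E -> rn q <= 2^-1 -> (u q <= (3 * c)%:E)%E.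
Proof.
move=> HD [u1 u2 u3] [v1 v2 v3] v0 uv vc q2.
have rc := disc_rel_compact HD; have [oU cU sub] := rc.
have bd l : boundary (@unit_disc R) l -> rn l = 1 by exact: boundary_disc.
have bD : boundary (@unit_disc R) `<=` D by move=> l /bd l1; apply: HD; rewrite l1.
have cB : compact (boundary (@unit_disc R)).
  apply: (@subclosed_compact _ _ (closure unit_disc)) => //; last by move=> x [].
  rewrite /boundary setDE; apply: closedI; first exact: closed_closure.
  apply: open_closedC; exact: open_interior.
(* One d makes u < v + d strict, as [sandwich] requires, and one is the error of the Poisson
   solution; the factor 3 turns 2 d into e. *)
apply: lee_real_ge => e e0; pose d := e / 6.
have d0 : 0 < d by rewrite divr_gt0.
have lsv : lsc_on (boundary unit_disc) (fun l => v l + d%:E)%E.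
  have : usc_on (boundary unit_disc) (fun l => - v l + (- d)%:E)%E.
    apply: usc_add; [by move=> z /bD; exact: v1|by move=> z _; rewrite ltry|exact: usc_onW bD v2|].
    by apply: usc_cont; apply: continuous_subspaceT; exact: cst_continuous.
  move=> /lsc_onN; rewrite (_ : (fun _ => _) = (fun l => v l + d%:E)%E)//; apply/funext => z.
  by rewrite EFinN fin_num_oppeD// !oppeK.
have [|f [lf Hf]] := sandwich cB (usc_onW bD u2) lsv.
  move=> l bl; have := uv l (bd l bl); have := u1 l (bD l bl); have := v0 l (bd l bl).
  case: (u l) => [a||]; case: (v l) => [b||] //; rewrite ?ltry// ?ltNyr//.
    by rewrite -EFinD !lee_fin lte_fin; lra.
have f0 x : rn x = 1 -> 0 <= Num.max (f x) 0 by move=> _; rewrite le_max lexx orbT.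
have [H [hH cH bH qH]] := poisson_solution (lipschitz_max0 lf) f0 d0.
have wcH : {within closure unit_disc, continuous H}.
  by apply: within_cont_at => l /closure_disc; exact: cH.
have U0 : unit_disc (0 : Cn R 1) by rewrite /unit_disc /= rn0.
have H0 : H 0 <= c + 2 * d.
  have : (- v 0%R <= (2 * d - H 0%R)%:E)%E.
    apply: (v3 unit_disc (fun l => 2 * d - H l) rc _ _ _ 0 U0).
    - by apply: within_contD; [apply: continuous_subspaceT; exact: cst_continuous|exact: within_contN].
    - exact: (harmonicD oU (harmonic_cst _ oU) (harmonicN oU hH)).
    - move=> l bl; have /andP[_] := bH l (bd l bl); have [_] := Hf l bl; have := v0 l (bd l bl).
      case: (v l) => [b||] //; last by rewrite leNye.
      rewrite -EFinD -EFinN !lee_fin; case: (leP (f l) 0); lra.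
  have D0 : D 0 by apply: HD; rewrite rn0.
  move: vc (v1 0 D0); case: (v 0) => [b||] // + _; rewrite -EFinN !lee_fin; lra.
have Uq : unit_disc q by rewrite /unit_disc /=; lra.
apply: (@le_trans _ _ (H q)%:E).
  apply: (u3 unit_disc H rc wcH hH _ q Uq) => l bl.
  have [/ltW h _] := Hf l bl; apply: (le_trans h); rewrite lee_fin.
  have /andP[h2 _] := bH l (bd l bl); apply: le_trans h2.
  by rewrite le_max lexx.
rewrite -EFinD lee_fin; have := qH q q2; rewrite /d in H0; lra.
Qed.

(** If v were +oo on an arc around b, take a Poisson kernel with pole [be] just outside b: it is at
    most 1/2 off the arc and equal to 1 at 0. For every N > 0, N (1/2 - pk) is then a harmonic
    majorant of -v on the circle, so v 0 >= N / 2. *)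
Lemma circle_finite_dense (D : set (Cn R 1)) (v : Cn R 1 -> \bar R) b (s : R) :
  (forall l, rn l <= 1 -> D l) -> SH D (fun l => - v l)%E ->
  (forall l, rn l = 1 -> (0 <= v l)%E) -> (v 0%R < +oo)%E -> rn b = 1 -> 0 < s ->
  exists l, [/\ rn l = 1, rn (l - b) < s & (v l < +oo)%E].
Proof.
move=> HD [v1 v2 v3] v0 vfin b1 s0; apply: contrapT => Hn.
have Hinf l : rn l = 1 -> rn (l - b) < s -> v l = +oo%E.
  move=> l1 lb; apply/eqP; rewrite -leye_eq leNgt; apply/negP => h.
  by apply: Hn; exists l.
have rc := disc_rel_compact HD; have [oU cU sub] := rc.
have s20 : 0 < s ^+ 2 by rewrite exprn_gt0.
(* With [t <= s / 2], points off the arc are at distance at least s / 2 from the pole; with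
   [t <= s ^+ 2 / 24], the numerator 2 t + t^2 <= 3 t is at most half of (s / 2)^2. *)
pose t := Num.min 1 (Num.min (s / 2) (s ^+ 2 / 24)).
have t0 : 0 < t by rewrite !lt_min ltr01 !divr_gt0.
have t1 : t <= 1 by rewrite ge_min lexx.
have ts : t <= s / 2 by rewrite !ge_min lexx !orbT.
have ts2 : t <= s ^+ 2 / 24 by rewrite !ge_min lexx !orbT.
clearbody t.
pose be := (1 + t)%:C * c1 b.
have cbe : cabs be = 1 + t.
  by rewrite /be cabsM cabs_real -rn_c1 b1 mulr1 ger0_norm; lra.
have nbe l : rn l <= 1 -> c1 l != be.
  by move=> l1; apply/eqP => E; move: l1; rewrite rn_c1 E cbe; lra.
have K2 l : rn l = 1 -> s <= rn (l - b) -> pk be l <= 2^-1.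
  move=> l1 sl; rewrite pkE; last by apply: nbe; rewrite l1.
  rewrite l1 cbe expr1n.
  have db : s / 2 <= cabs (be - c1 l).
    have h1 : cabs (be - c1 b) = t.
      have -> : be - c1 b = t%:C * c1 b by rewrite /be rmorphD rmorph1; ring.
      by rewrite cabsM cabs_real -rn_c1 b1 mulr1 gtr0_norm.
    have := cabsD (be - c1 l) (c1 b - be).
    have -> : be - c1 l + (c1 b - be) = c1 b - c1 l by ring.
    have -> : cabs (c1 b - be) = t by rewrite -opprB /cabs normrN -/(cabs _) h1.
    by rewrite -c1B -rn_c1 rnC; lra.
  have db0 : 0 < cabs (be - c1 l) by lra.
  rewrite ler_pdivrMr ?exprn_gt0//.
  apply: (@le_trans _ _ (2^-1 * (s / 2) ^+ 2)).
    have -> : (s / 2) ^+ 2 = s ^+ 2 / 4 by field.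
    have : t * t <= t by rewrite ler_piMr// ltW.
    by rewrite expr2; lra.
  by rewrite ler_wpM2l// ler_sqr ?nnegrE; lra.
have be0 : be != 0 by rewrite -cabs_eq0 cbe gt_eqF//; lra.
have key N : 0 < N -> (- v 0%R <= (- (N / 2))%:E)%E.
  move=> N0; have hK : harmonic_on unit_disc (fun l => N * 2^-1 + - N * pk be l).
    apply: (harmonicD oU (harmonic_cst _ oU)); apply: (harmonicZ _ oU).
    by apply: harmonic_sub (pk_harmonic be) => l l1; apply: nbe; exact: ltW.
  have U0 : unit_disc (0 : Cn R 1) by rewrite /unit_disc /= rn0.
  have -> : - (N / 2) = N * 2^-1 + - N * pk be 0 by rewrite pk0//; field.
  apply: (v3 unit_disc (fun l => N * 2^-1 + - N * pk be l) rc _ hK _ 0 U0).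
    apply: within_cont_at => l /closure_disc l1.
    have hc := harmonic_continuous (pk_harmonic be) (nbe l l1).
    apply: continuousD; first exact: cst_continuous.
    by apply: continuousM => //; exact: cst_continuous.
  move=> l /boundary_disc l1; have [/(Hinf l l1) ->|sl] := ltP (rn (l - b)) s.
    by rewrite leNye.
  apply: (@le_trans _ _ 0%E); first by rewrite leeNl oppe0 v0.
  rewrite lee_fin mulNr -mulrBr; apply: mulr_ge0; [exact: ltW|rewrite subr_ge0; exact: K2].
have D0 : D 0 by apply: HD; rewrite rn0.
move: vfin (v1 0 D0); case: (v 0) key => [r||] // key _ _.
have := key (2 * (`|r| + 1)); rewrite -EFinN lee_fin => /(_ _) h.
have : 0 < 2 * (`|r| + 1) by have := normr_ge0 r; lra.
by move=> /h; have := ler_norm r; lra.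
Qed.

Context {n : nat}.
Implicit Types (D V B Om E : set (Cn R n)) (u v w g : Cn R n -> \bar R).

(** The direction 2 (q - p) places q at the parameter 1/2, the edge of the range allowed by
    [harnack_disc]. *)
Lemma harnack_line B u v p q (c : R) : PSH B u -> PSH B (fun z => - v z)%E ->
  (forall z, B z -> (0 <= v z)%E) -> (forall z, B z -> (u z <= v z)%E) ->
  (forall l : Cn R 1, rn l <= 1 -> B (complex_line p ((2%:R : R[i]) *: (q - p)) l)) ->
  (v p <= c%:E)%E -> (u q <= (3 * c)%:E)%E.
Proof.
move=> [_ _ u3] [_ _ v3] v0 uv HB vp; set L := complex_line _ _ in HB.
have L0 : L 0 = p by rewrite /L /complex_line mxE scale0r addr0.
have Lq : L (v1 (2^-1)) = q.
  rewrite /L /complex_line /v1 mxE scalerA mulVf ?scale1r; last by rewrite pnatr_eq0.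
  by rewrite addrC subrK.
rewrite -Lq; apply: (@harnack_disc _ (u \o L) (v \o L) c (v1 2^-1) HB).
- exact: u3.
- exact: v3.
- by move=> l l1; apply: v0; apply: HB; rewrite l1.
- by move=> l l1; apply: uv; apply: HB; rewrite l1.
- by rewrite /= L0.
- rewrite rn_c1 v1K (_ : (2^-1 : R[i]) = (2^-1 : R)%:C) ?cabs_real; last first.
    by rewrite fmorphV rmorph_nat.
  by rewrite ger0_norm// invr_ge0.
Qed.

(** Origin of the factor 5: the disc reaches up to 2 |q - p| < 4 r from p, and p is within r of
    z0. *)
Lemma ball_line (z0 p q : Cn R n) (r : R) (l : Cn R 1) : rn (p - z0) < r -> rn (q - z0) < r ->
  rn l <= 1 -> rn (complex_line p ((2%:R : R[i]) *: (q - p)) l - z0) < 5 * r.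
Proof.
move=> pr qr l1; apply: le_lt_trans (rn_tri p _ _) _.
have E : rn (complex_line p ((2%:R : R[i]) *: (q - p)) l - p) = rn l * (2 * rn (q - p)).
  have := rn_complex_line p ((2%:R : R[i]) *: (q - p)) l 0.
  have -> : complex_line p ((2%:R : R[i]) *: (q - p)) 0 = p by rewrite /complex_line mxE scale0r addr0.
  by rewrite subr0 rnZ natC cabs_real normr_nat.
rewrite E.
have h1 : rn (q - p) < 2 * r by have := rn_tri z0 q p; rewrite (rnC z0 p); lra.
have h2 : rn l * (2 * rn (q - p)) <= 1 * (2 * rn (q - p)).
  by rewrite ler_wpM2r// mulr_ge0 ?rn_ge0.
lra.
Qed.

Lemma harnack_ball B u v z0 p q (r c : R) : (forall z, rn (z - z0) < 5 * r -> B z) ->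
  PSH B u -> PSH B (fun z => - v z)%E ->
  (forall z, B z -> (0 <= v z)%E) -> (forall z, B z -> (u z <= v z)%E) ->
  rn (p - z0) < r -> rn (q - z0) < r -> (v p <= c%:E)%E -> (u q <= (3 * c)%:E)%E.
Proof.
move=> HB Pu Pv v0 uv pr qr; apply: (harnack_line Pu Pv v0 uv) => l l1.
by apply: HB; exact: ball_line.
Qed.

Lemma open_ball_rn (z0 : Cn R n) (r : R) : open [set z | rn (z - z0) < r].
Proof.
apply/open_rnP => z zr; exists (r - rn (z - z0)); first by rewrite subr_gt0.
move=> w wz /=; have := rn_tri z w z0; lra.
Qed.

(** The set of limits of points with w finite is closed in V, and it is also open. For q near such a
    limit, choose p nearby with w p finite and take the disc centred at p with q on its rim;
    [circle_finite_dense] gives points of that rim arbitrarily close to q where w is finite.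
    Connectedness of V finishes. *)
Lemma PSHs_finite_dense V w z (e : R) : open V -> connected V -> PSHs V w -> V z -> 0 < e ->
  exists p, [/\ V p, w p != -oo%E & rn (p - z) < e].
Proof.
move=> oV cV [Pw [p0 Vp0 wp0]] Vz e0.
pose F := [set p | V p /\ w p != -oo%E].
suff HT : V `&` closure F = V.
  have : (V `&` closure F) z by rewrite HT.
  by move=> [_ /closure_rnP /(_ e e0)[p [Vp wp] pz]]; exists p.
apply: cV.
- by exists p0; split => //; apply: subset_closure.
- have [_ uw _] := Pw.
  pose O := [set z : Cn R n | \forall x \near z, V x -> closure F x].
  exists O; first exact: open_near.
  apply/seteqP; split => x [Vx cx]; split => //; last exact: (nbhs_singleton cx Vx).
  have [M [wM _]] : exists M : R, (w x < M%:E)%E /\ True.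
    have [w1 _ _] := Pw; have [M [h _]] := ereal_between (w1 x Vx); by exists M.
  have := uw x Vx M wM; rewrite near_withinE => /nbhs_rnP[d1 d10 Hd1].
  have [d2 d20 Hd2] := iffLR (open_rnP _) oV x Vx.
  pose r := Num.min d1 d2 / 5.
  have r0 : 0 < r by rewrite divr_gt0// lt_min d10.
  have r5 y : rn (y - x) < 5 * r -> V y /\ (w y < M%:E)%E.
    have -> : 5 * r = Num.min d1 d2 by rewrite /r; field.
    rewrite lt_min => /andP[h1 h2]; have Vy := Hd2 _ h2; split => //; exact: Hd1.
  have [p [Vp wp] px] := iffLR (closure_rnP _ _) cx r r0.
  rewrite /O /=; apply: filterS (near_rn x r0) => q qx Vq.
  apply/closure_rnP => eps eps0.
  have [->|qp] := eqVneq q p; first by exists p => //; rewrite subrr rn0.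
  pose L := complex_line p (q - p).
  have L0 : L 0 = p by rewrite /L /complex_line mxE scale0r addr0.
  have L1 : L (v1 1) = q by rewrite /L /complex_line /v1 mxE scale1r addrC subrK.
  have LB l : rn l <= 1 -> rn (L l - x) < 5 * r.
    move=> l1; apply: le_lt_trans (rn_tri p _ _) _.
    have : rn (L l - p) <= rn (q - p).
      have := rn_complex_line p (q - p) l 0; rewrite -/L L0 subr0 => ->.
      by rewrite ler_piMl ?rn_ge0.
    have := rn_tri x q p; rewrite (rnC x p); lra.
  pose B := [set y | rn (y - x) < 5 * r].
  have oB : open B by exact: open_ball_rn.
  have PB : PSH B (fun y => w y + (- M)%:E)%E.
    by apply: (PSH_addc _ oB); apply: PSH_sub Pw => y /r5[].
  have SL : SH (L @^-1` B) (fun l => - (M%:E - w (L l)))%E.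
    have [_ _ h] := PB; apply: SH_ext (h p (q - p)) => l _ /=.
    by rewrite -/(L l) -sube_swap.
  have [||||l [l1 lb vl]] := @circle_finite_dense (L @^-1` B) (fun l => M%:E - w (L l))%E (v1 1)
    (eps / (rn (q - p) + 1)) LB SL _ _ _ _.
  - move=> l l1; have [|_] := r5 (L l); first by apply: LB; rewrite l1.
    by case: (w (L l)) => [a||] // h; rewrite -?EFinB ?lee_fin ?leey//; rewrite lte_fin in h; lra.
  - rewrite L0; case: (w p) wp => [a||] // _; by rewrite -EFinB ltry.
  - by rewrite rn_c1 v1K cabs_def /= expr1n expr0n addr0 sqrtr1.
  - by rewrite divr_gt0//; have := rn_ge0 (q - p); lra.
  - exists (L l).
      split; first by have [] := r5 _ (LB l _); rewrite ?l1.
      by apply/eqP => E; move: vl; rewrite E.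
    rewrite (_ : rn (L l - q) = rn (l - v1 1) * rn (q - p)); last by rewrite -(rn_complex_line p) -/L L1.
    have q1 : 0 < rn (q - p) + 1 by have := rn_ge0 (q - p); lra.
    rewrite ltr_pdivlMr// in lb; apply: le_lt_trans lb.
    by rewrite ler_wpM2l ?rn_ge0// lerDl.
- by exists (closure F) => //; exact: closed_closure.
Qed.

(* Off {w = -oo}, u - c <= - eps (w - M) near z for every eps > 0; Harnack carries
   the bound from one point where w is finite to z, and eps -> 0. *)
Lemma PSH_le_off_polar D V u g w z : open D -> open V -> connected V -> PSH D u ->
  usc_on D g -> PSHs V w -> D z -> V z ->
  (forall x, D x -> V x -> w x != -oo%E -> (u x <= g x)%E) -> (u z <= g z)%E.
Proof.
move=> oD oV cV Pu ug Pw Dz Vz H; apply: lee_real_lt => c gc.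
have [[w1 uw _] _] := Pw.
have [M [wM _]] := ereal_between (w1 z Vz).
have := uw z Vz M wM; rewrite near_withinE => /nbhs_rnP[d1 d10 Hd1].
have := ug z Dz c gc; rewrite near_withinE => /nbhs_rnP[d2 d20 Hd2].
have [d3 d30 Hd3] := iffLR (open_rnP _) oV z Vz.
have [d4 d40 Hd4] := iffLR (open_rnP _) oD z Dz.
pose r := Num.min (Num.min d1 d2) (Num.min d3 d4) / 5.
have r0 : 0 < r by rewrite divr_gt0// !lt_min d10 d20 d30.
pose B := [set y | rn (y - z) < 5 * r].
have HB y : B y -> [/\ D y, V y, (w y < M%:E)%E & (g y < c%:E)%E].
  have : 5 * r = Num.min (Num.min d1 d2) (Num.min d3 d4) by rewrite /r; field.
  rewrite /B /= => ->; rewrite !lt_min => /andP[/andP[h1 h2] /andP[h3 h4]].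
  have Dy := Hd4 _ h4; have Vy := Hd3 _ h3.
  by split => //; [exact: Hd1|exact: Hd2].
have oB : open B by exact: open_ball_rn.
have [p [Vp wp pz]] := PSHs_finite_dense oV cV Pw Vz r0.
have Bp : B p by rewrite /B /=; lra.
have [k [k0 wk]] : exists k : R, 0 <= k /\ w p = (M - k)%:E.
  have [_ _ + _] := HB p Bp; case: (w p) wp => [a||] // _; rewrite lte_fin => aM.
  exists (M - a); split; first lra.
  by rewrite opprB addrCA subrr addr0.
have PuB : PSH B (fun y => u y + (- c)%:E)%E.
  by apply: (PSH_addc _ oB); apply: PSH_sub Pu => y /HB[].
have main e : 0 < e -> (u z + (- c)%:E <= (3 * (e * k))%:E)%E.
  move=> e0.
  apply: (@harnack_ball B (fun y => u y + (- c)%:E)%E (fun y => e%:E * (M%:E - w y))%E z p z r) => //.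
  - have PwB : PSH B (fun y => w y + (- M)%:E)%E.
      by apply: (PSH_addc _ oB); apply: PSH_sub Pw.1 => y /HB[].
    apply: PSH_ext (PSH_scale e0 PwB) => y By /=.
    by rewrite -muleN; congr (_ * _)%E; rewrite -sube_swap.
  - move=> y /HB[_ _ wy _]; apply: mule_ge0; first by rewrite lee_fin ltW.
    by case: (w y) wy => [a||] // h; rewrite -?EFinB ?lee_fin ?leey//; rewrite lte_fin in h; lra.
  - move=> y By; have [Dy Vy wy gy] := HB y By.
    have [wI|wI] := eqVneq (w y) -oo%E.
      by rewrite wI (_ : (M%:E - -oo)%E = +oo%E)// gt0_muley ?lte_fin// leey.
    apply: (@le_trans _ _ 0%E); last first.
      apply: mule_ge0; first by rewrite lee_fin ltW.
      by case: (w y) wy => [a||] // h; rewrite -?EFinB ?lee_fin ?leey//; rewrite lte_fin in h; lra.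
    have := le_trans (H y Dy Vy wI) (ltW gy).
    case: (u y) => [a||] //; rewrite ?leNye// lee_fin => h.
    by rewrite -EFinD lee_fin; lra.
  - by rewrite subrr rn0.
  - rewrite wk -EFinB -EFinM lee_fin.
    by rewrite opprB addrCA subrr addr0.
have := fun e e0 => main e e0.
case: (u z) => [a||] // main'; last by rewrite leNye.
  rewrite lee_fin; apply/ler_addgt0Pr => e e0.
  have k1 : 0 < 3 * (k + 1) by rewrite mulr_gt0//; lra.
  have := main' (e / (3 * (k + 1))); rewrite divr_gt0// => /(_ isT).
  rewrite -EFinD lee_fin.
  have -> : 3 * (e / (3 * (k + 1)) * k) = e * (k / (k + 1)) by field; rewrite lt0r_neq0//; lra.
  have : e * (k / (k + 1)) <= e * 1.
    by apply: ler_wpM2l; [exact: ltW|rewrite ler_pdivrMr; lra].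
  lra.
by have := main' 1 ltr01.
Qed.

Lemma PSH_le_off_pluripolar D u g E : open D -> PSH D u -> usc_on D g -> pluripolar E ->
  (forall x, D x -> ~ E x -> (u x <= g x)%E) -> forall x, D x -> (u x <= g x)%E.
Proof.
move=> oD Pu ug pE H x Dx; have [Ex|] := pselect (E x); last exact: H.
have [V [w [oV cV Vx Pw wE]]] := pE x Ex.
apply: (PSH_le_off_polar oD oV cV Pu ug Pw Dx Vx) => y Dy Vy wy.
by apply: H => // Ey; move: wy; rewrite wE// eqxx.
Qed.

(* The constants are chosen one by one so that the partial sums stay > -1 somewhere in a fixed ball;
   compactness then gives a point where the infinite sum is finite. *)
Lemma PSHs_sequence Om (w : nat -> Cn R n -> \bar R) : open Om -> connected Om -> Om !=set0 ->
  (forall j, PSHs Om (w j)) -> (forall j z, Om z -> (w j z < 0)%E) ->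
  exists W, [/\ PSHs Om W, (forall z, Om z -> (W z < 0)%E) &
    forall j, exists2 c : R, 0 < c & forall z, Om z -> (W z <= c%:E * w j z)%E].
Proof.
move=> oO cO [z0 Oz0] Pw w0.
have [r0 r00 Hr0] := iffLR (open_rnP _) oO z0 Oz0.
pose r := r0 / 2.
have rpos : 0 < r by rewrite divr_gt0.
pose B := [set z | rn (z - z0) < r].
have oB : open B by exact: open_ball_rn.
have BO : B `<=` Om by move=> z zr; apply: Hr0; rewrite /B /= /r in zr; lra.
pose good (s : Cn R n -> \bar R) := [/\ PSH Om s, (forall z, Om z -> (s z <= 0)%E) &
  exists2 z, B z & ((-1)%:E < s z)%E].
(* The choice of c spends at most half of the margin a + 1, because - b / (1 - b) <= 1. *)
have pick_c (a b : R) : -1 < a -> b < 0 -> exists2 c : R, 0 < c & -1 < a + c * b.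
  move=> a1 b0; exists ((a + 1) / (2 * (1 - b))); first by rewrite divr_gt0//; lra.
  have -> : (a + 1) / (2 * (1 - b)) * b = - ((a + 1) / 2 * (- b / (1 - b))) by field; lra.
  have : (a + 1) / 2 * (- b / (1 - b)) <= (a + 1) / 2 * 1.
    by rewrite ler_wpM2l//; [lra|rewrite ler_pdivrMr; lra].
  lra.
have cw_lt0 c j z : 0 < c -> Om z -> (c%:E * w j z < 0)%E.
  by move=> c0 Oz; rewrite pmule_rlt0 ?lte_fin// w0.
have step j s : good s -> exists s', good s' /\ exists2 c : R, 0 < c &
    s' = (fun z => s z + c%:E * w j z)%E.
  move=> [Ps s0 [z Bz sz]].
  (* Otherwise s <= -1 on B off the poles of [w j], hence on all of B by [PSH_le_off_polar], against
     the invariant at z. *)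
  have [z' [Bz' wz' sz']] : exists z', [/\ B z', w j z' != -oo%E & ((-1)%:E < s z')%E].
    apply: contrapT => Hn.
    have : (s z <= (-1)%:E)%E.
      apply: (@PSH_le_off_polar B Om s (fun=> (-1)%:E) (w j) z) => //.
      - exact: PSH_sub Ps.
      - by apply: usc_cont; apply: continuous_subspaceT; exact: cst_continuous.
      - exact: BO.
      - by move=> x Bx _ wx; rewrite leNgt; apply/negP => sx; apply: Hn; exists x.
    by rewrite leNgt sz.
  have Oz' := BO _ Bz'.
  have [a [sa a1]] : exists a : R, s z' = a%:E /\ -1 < a.
    move: sz' (s0 _ Oz'); case: (s z') => [a||] //; rewrite lte_fin => ? _; by exists a.
  have [b [wb b0]] : exists b : R, w j z' = b%:E /\ b < 0.
    move: wz' (w0 j _ Oz'); case: (w j z') => [b||] // _; rewrite lte_fin => ?; by exists b.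
  have [c c0 Hc] := pick_c a b a1 b0.
  exists (fun z => s z + c%:E * w j z)%E; split; last by exists c.
  split.
  - by apply: (PSH_add oO Ps); apply: PSH_scale => //; case: (Pw j).
  - by move=> x Ox; apply: adde_le0; [exact: s0|apply/ltW; exact: cw_lt0].
  - by exists z' => //; rewrite sa wb -EFinM -EFinD lte_fin.
have [c00 c00pos good0] : exists2 c, 0 < c & good (fun z => c%:E * w 0%N z)%E.
  have [p [Op wp pz]] := PSHs_finite_dense oO cO (Pw 0%N) Oz0 rpos.
  have [b [wb b0]] : exists b : R, w 0%N p = b%:E /\ b < 0.
    move: wp (w0 0%N _ Op); case: (w 0%N p) => [b||] // _; rewrite lte_fin => ?; by exists b.
  have [c c0 Hc] := pick_c 0 b (ltrN10 R) b0.
  exists c => //; split.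
  - by apply: PSH_scale => //; case: (Pw 0%N).
  - by move=> x Ox; apply/ltW; exact: cw_lt0.
  - by exists p => //; rewrite wb -EFinM lte_fin; lra.
(* The index travels with the partial sum so that the relation knows which [w j] to add next. *)
pose St := {x : nat * (Cn R n -> \bar R) | good x.2}.
pose Rel (x y : St) := (sval y).1 = (sval x).1.+1 /\ exists2 c : R, 0 < c &
  (sval y).2 = (fun z => (sval x).2 z + c%:E * w (sval x).1 z)%E.
have stepR (x : St) : {y : St | Rel x y}.
  apply: cid; have [s' [gs' [c c0 E]]] := step (sval x).1 (sval x).2 (svalP x).
  have gs'' : good (((sval x).1.+1, s') : nat * (Cn R n -> \bar R)).2 by [].
  by exists (exist (fun x => good x.2) _ gs''); split => //; exists c.
have good0' : good ((0%N, (fun z => c00%:E * w 0%N z)%E) : nat * (Cn R n -> \bar R)).2 by [].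
have [f [f0 Hf]] := dependent_choice stepR (exist (fun x => good x.2) _ good0').
have f1 k : (sval (f k)).1 = k.
  by elim: k => [|k IH]; [rewrite f0|have [-> _] := Hf k; rewrite IH].
pose s k := (sval (f k)).2.
have gs k : good (s k) := svalP (f k).
have sS k : exists2 c : R, 0 < c & s k.+1 = (fun z => s k z + c%:E * w k z)%E.
  by have [_ [c c0 E]] := Hf k; exists c => //; rewrite /s E f1.
have sdec k z : Om z -> (s k.+1 z <= s k z)%E.
  move=> Oz; have [c c0 ->] := sS k; rewrite -[leRHS]adde0; apply: leeD2l.
  by apply/ltW; exact: cw_lt0.
have sle k l z : (k <= l)%N -> Om z -> (s l z <= s k z)%E.
  move=> + Oz; elim: l => [|l IH]; first by rewrite leqn0 => /eqP ->.
  rewrite leq_eqVlt => /orP[/eqP ->//|]; rewrite ltnS => /IH; apply: le_trans.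
  exact: sdec.
pose W z := ereal_inf (range (fun k => s k z)).
have Wle k z : (W z <= s k z)%E by apply: ereal_inf_lbound; exists k.
have Wlt z (a : R) : (W z < a%:E)%E -> exists k, (s k z < a%:E)%E.
  by move=> /ereal_inf_lt[_ [k _ <-] ka]; exists k.
have Ws j : exists2 c : R, 0 < c & forall z, Om z -> (W z <= c%:E * w j z)%E.
  have [c c0 E] := sS j; exists c => // z Oz; apply: le_trans (Wle j.+1 z) _.
  rewrite E; have [_ h _] := gs j; have := h z Oz => sj; rewrite -[leRHS]add0e.
  exact: leeD2r.
exists W; split => //; last first.
  by move=> z Oz; have [c c0 Hc] := Ws 0%N; apply: le_lt_trans (Hc z Oz) _; exact: cw_lt0.
split.
  apply: (@PSH_decreasing R n Om s) => //.
  - by move=> k; have [] := gs k.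
  - by move=> z a _; exact: Wlt.
pose K := [set z | rn (z - z0) <= r].
have KO : K `<=` Om by move=> z zr; apply: Hr0; rewrite /K /= /r in zr; lra.
have cK : compact K.
  have clK : closed K.
    move=> z /closure_rnP cz; apply/ler_addgt0Pr => e e0.
    have [x Kx xz] := cz e e0; have := rn_tri x z z0; rewrite rnC in xz.
    rewrite /K /= in Kx; lra.
  apply: (@compact_rn R n K (r + rn z0) clK) => z zr.
  have := rnD (z - z0) z0; rewrite subrK; rewrite /K /= in zr; lra.
apply: contrapT => Hn.
have WK z : K z -> (W z < (-1)%:E)%E.
  move=> Kz; have : W z = -oo%E.
    by apply/eqP; apply: contrapT => /negP h; apply: Hn; exists z => //; exact: KO.
  by move=> ->; rewrite ltNyr.
pose U k := [set z : Cn R n | \forall x \near z, K x -> (s k x < (-1)%:E)%E].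
have [|||k Hk] := @compact_increasing R n K U cK.
- by move=> k; exact: open_near.
- move=> k l kl z; apply: filterS => x Hx Kx; apply: le_lt_trans (Hx Kx).
  by apply: sle => //; exact: KO.
- move=> z Kz; have [k ka] := Wlt z (-1) (WK z Kz); exists k.
  have [[_ us _] _ _] := gs k; have := us z (KO _ Kz) (-1) ka; rewrite near_withinE.
  by apply: filterS => x Hx Kx; apply: Hx; exact: KO.
have [_ _ [z Bz sz]] := gs k.
have Kz : K z by rewrite /K /=; apply: ltW.
by have := nbhs_singleton (Hk z Kz) Kz; rewrite ltNge (ltW sz).
Qed.

(** The inequality W <= c w_j on Om survives regularization, so W has the poles of every w_j, also
    those on the boundary. *)
Lemma pluripolar_in_bigcup Om (A : nat -> set (Cn R n)) : open Om -> connected Om -> Om !=set0 ->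
  (forall j, pluripolar_in Om (A j)) -> pluripolar_in Om (\bigcup_j A j).
Proof.
move=> oO cO O0 H; split.
  by move=> z [j _ Az]; have [sub _] := H j; exact: sub.
have /choice[w Hw] : forall j, exists w, [/\ PSHs Om w, (forall z, Om z -> (w z < 0)%E) &
    forall z, A j z -> upper_reg Om w z = -oo%E] by move=> j; have [_] := H j.
have [||W [PW W0 HW]] := @PSHs_sequence Om w oO cO O0.
- by move=> j; have [] := Hw j.
- by move=> j; have [] := Hw j.
exists W; split => // z [j _ Az]; have [c c0 Hc] := HW j.
have [_ _ h] := Hw j; have wz := h z Az.
apply/eqP; rewrite -leeNy_eq; apply: lee_real_lt => a _.
have : (upper_reg Om (w j) z < (c^-1 * a)%:E)%E by rewrite wz ltNyr.
move=> /upper_reg_lt h2; apply: upper_reg_le; move: h2; rewrite !near_withinE.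
apply: filterS => x hx Ox; apply: le_trans (Hc x Ox) _.
by rewrite -lee_pdivlMl// -EFinM ltW// hx.
Qed.

End Harnack.

(** * Perturbation by functions with poles, and domination by maximal functions *)

Section Perturbation.
Context {R : realType} {n : nat}.
Implicit Types (D G Om A E : set (Cn R n)) (u v w g phi : Cn R n -> \bar R).

Lemma lee_perturb (a b w : \bar R) : (a < +oo)%E -> (w < 0)%E -> w != -oo%E ->
  (forall e : R, 0 < e -> (a + (e%:E * w + (- e)%:E) <= b)%E) -> (a <= b)%E.
Proof.
case: w => [s||] // a1; rewrite lte_fin => s0 _ H; apply: lee_real_ge => e e0.
have s1 : 0 < 1 - s by lra.
(* With this parameter the perturbation equals exactly - e. *)
have /H : 0 < e / (1 - s) by rewrite divr_gt0.
rewrite -EFinM -EFinD (_ : e / (1 - s) * s + - (e / (1 - s)) = - e); last by field; exact: lt0r_neq0.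
case: a a1 {H} => [r||] // _; case: b => [t||] //; rewrite ?leNye ?leey//.
by rewrite -!EFinD !lee_fin; lra.
Qed.

Lemma cvgn_le (f : nat -> \bar R) (l p : \bar R) : f @ \oo --> l ->
  (forall j, (f j <= p)%E) -> (l <= p)%E.
Proof.
move=> fl fp; rewrite leNgt; apply/negP => /open_ereal_gt' pl.
have [N _ HN] := fl _ pl.
by have := HN N (leqnn N); rewrite /= ltNge fp.
Qed.

Lemma nondecreasing_cvgn_ge (f : nat -> \bar R) (l : \bar R) j :
  (forall j, (f j <= f j.+1)%E) -> f @ \oo --> l -> (f j <= l)%E.
Proof.
move=> fS fl; rewrite leNgt; apply/negP => /open_ereal_lt' lj.
have [N _ HN] := fl _ lj.
have mono k : (f j <= f (j + k)%N)%E.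
  by elim: k => [|k IH]; [rewrite addn0|rewrite addnS; apply: le_trans IH _].
have := HN (j + N)%N (leq_addl j N); rewrite /= ltNge.
by rewrite mono.
Qed.

Lemma near_cvg_lt (F : set_system (Cn R n)) u (l : \bar R) (a : \bar R) : u @ F --> l -> (l < a)%E ->
  \forall z \near F, (u z < a)%E.
Proof. by move=> ul /open_ereal_lt' la; exact: (ul _ la). Qed.

Lemma near_cvg_gt (F : set_system (Cn R n)) u (l : \bar R) (a : \bar R) : u @ F --> l -> (a < l)%E ->
  \forall z \near F, (a < u z)%E.
Proof. by move=> ul /open_ereal_gt' la; exact: (ul _ la). Qed.

Lemma PSH_perturb Om u w (e : R) : open Om -> PSH Om u -> PSH Om w -> 0 < e ->
  PSH Om (fun z => u z + (e%:E * w z + (- e)%:E))%E.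
Proof.
move=> oO Pu Pw e0; apply: (PSH_add oO Pu); apply: (PSH_addc _ oO).
exact: PSH_scale.
Qed.

(** Small sets are crossed three times: uj <= u extends over E, so uj is an admissible v; letting e
    -> 0 gives uj <= g off the poles of w and then everywhere; finally uj -> u gives u <= g off E
    and then everywhere. *)
Lemma quasi_upper_bounded_le Om u w g : open Om -> connected Om ->
  quasi_upper_bounded Om u -> usc_on Om g -> PSHs Om w -> (forall z, Om z -> (w z < 0)%E) ->
  (forall v (M e : R), PSH Om v -> (forall z, Om z -> (v z <= M%:E)%E) ->
     (forall z, Om z -> (v z <= u z)%E) -> 0 < e ->
     forall z, Om z -> (v z + (e%:E * w z + (- e)%:E) <= g z)%E) ->
  forall z, Om z -> (u z <= g z)%E.
Proof.
move=> oO cO [Pu [uj [E [Pj bj EO pE cj]]]] ug Pw w0 H.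
have uju j z : Om z -> (uj j z <= u z)%E.
  move: z; apply: (PSH_le_off_pluripolar oO (Pj j) _ pE); first by have [] := Pu.
  move=> z Oz nEz; have [mono lim] := cj z Oz nEz.
  exact: (@nondecreasing_cvgn_ge (fun j => uj j z)).
have ujg j z : Om z -> (uj j z <= g z)%E.
  move=> Oz; apply: (PSH_le_off_polar oO oO cO (Pj j) ug Pw Oz Oz) => x Ox _ wx.
  have [M HM] := bj j; have [u1 _ _] := Pj j.
  apply: (@lee_perturb _ _ (w x)) => //; [exact: u1|exact: w0|].
  by move=> e e0; apply: (H _ M) => // y; exact: uju.
apply: (PSH_le_off_pluripolar oO Pu ug pE) => z Oz nEz.
have [_ lim] := cj z Oz nEz; apply: (cvgn_le lim) => j; exact: ujg.
Qed.

Lemma upper_reg_sub_le Om G v x : G `<=` Om -> usc_on Om v -> Om x -> (upper_reg G v x <= v x)%E.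
Proof.
move=> GO uv Ox; apply: lee_real_lt => a va; apply: upper_reg_le.
have := uv x Ox a va; rewrite !near_withinE; apply: filterS => y H /GO Oy.
exact/ltW/H.
Qed.

Lemma pluripolar_inU Om A1 A2 : open Om -> connected Om -> Om !=set0 ->
  pluripolar_in Om A1 -> pluripolar_in Om A2 -> pluripolar_in Om (A1 `|` A2).
Proof.
move=> oO cO O0 h1 h2.
have := @pluripolar_in_bigcup R n Om (fun j => if j == 0%N then A1 else A2) oO cO O0.
rewrite (_ : \bigcup_j _ = A1 `|` A2); first by apply; case.
apply/seteqP; split => z; first by move=> [[|j] _ /=]; [left|right].
by move=> [Az|Az]; [exists 0%N|exists 1%N].
Qed.

Lemma pluripolar_in_sub Om A1 A2 : A1 `<=` A2 -> pluripolar_in Om A2 -> pluripolar_in Om A1.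
Proof.
move=> s12 [sub [w [Pw w0 Hw]]]; split; first exact: subset_trans sub.
by exists w; split => // z /s12; exact: Hw.
Qed.

(** For use near exceptional points, where w is eventually below any real: this combines an upper
    bound M of the competitor with a lower bound m of the other function. *)
Lemma perturb_le_pole (v w : \bar R) (e M m : R) : 0 < e -> (v <= M%:E)%E ->
  (w < ((m - M) / e)%:E)%E -> (v + (e%:E * w + (- e)%:E) <= m%:E)%E.
Proof.
move=> e0; case: v => [a||] //; case: w => [b||] //; rewrite ?lee_fin ?lte_fin.
- by move=> aM; rewrite ltr_pdivlMr//; lra.
- by move=> _ _; rewrite gt0_muleNy ?lte_fin//= leNye.
- by move=> _ _; rewrite -EFinM -EFinD leNye.
- by move=> _ _; rewrite gt0_muleNy ?lte_fin//= leNye.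
Qed.

(** For use near non-exceptional points, where only w < 0 is known and the constant supplies the gap
    e. *)
Lemma perturb_le_shift (v w : \bar R) (e a : R) : 0 < e -> (v <= a%:E)%E -> (w < 0)%E ->
  (v + (e%:E * w + (- e)%:E) <= (a - e)%:E)%E.
Proof.
move=> e0; case: v => [b||] //; case: w => [c||] //; rewrite ?lee_fin ?lte_fin.
- move=> ba c0; have : e * c < 0 by rewrite pmulr_rlt0.
  by lra.
- by move=> _ _; rewrite gt0_muleNy ?lte_fin//= leNye.
- by move=> _ _; rewrite -EFinM -EFinD leNye.
- by move=> _ _; rewrite gt0_muleNy ?lte_fin//= leNye.
Qed.

(** Bounded competitors below u1, once perturbed, lie below u2 near the whole boundary, hence off a
    compact K. Maximality of u2 on a relatively compact neighbourhood of K gives the rest.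
    Exchanging u1 and u2 yields uniqueness. *)
Lemma maximal_domination Om u1 u2 (f : Cn R n -> \bar R) A1 A2 :
  open Om -> connected Om -> Om !=set0 -> compact (closure Om) ->
  quasi_upper_bounded Om u1 -> MPSH Om u2 -> (-oo < ereal_inf (u2 @` Om))%E ->
  pluripolar_in Om A1 -> pluripolar_in Om A2 ->
  (forall x, boundary Om x -> ~ A1 x -> u1 @ within Om (nbhs x) --> f x) ->
  (forall x, boundary Om x -> ~ A2 x -> u2 @ within Om (nbhs x) --> f x) ->
  forall z, Om z -> (u1 z <= u2 z)%E.
Proof.
move=> oO cO O0 cc Q1 [[P2 _] max2] inf2 pA1 pA2 l1 l2.
have [_ [w [Pw w0 Hw]]] := pluripolar_inU oO cO O0 pA1 pA2.
have [m [_ mi]] := ereal_between inf2.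
have m2 z : Om z -> (m%:E <= u2 z)%E.
  by move=> Oz; apply: le_trans (ltW mi) _; apply: ereal_inf_lbound; exists z.
have [_ u2c _] := P2.
apply: (quasi_upper_bounded_le oO cO Q1 u2c Pw w0) => v M e Pv vM vu e0.
pose V z := (v z + (e%:E * w z + (- e)%:E))%E.
suff : forall z, Om z -> (V z <= u2 z)%E by [].
have PV : PSH Om V by apply: PSH_perturb => //; case: Pw.
have bd x : boundary Om x -> \forall z \near within Om (nbhs x), (V z <= u2 z)%E.
  move=> bx; have [Ax|nAx] := pselect ((A1 `|` A2) x).
    have : (upper_reg Om w x < ((m - M) / e)%:E)%E by rewrite Hw// ltNyr.
    move=> /upper_reg_lt; rewrite !near_withinE; apply: filterS => z Hz Oz.
    apply: le_trans (m2 z Oz); apply: perturb_le_pole => //; first exact: vM.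
    exact: Hz.
  have nA1 : ~ A1 x by move=> h; apply: nAx; left.
  have nA2 : ~ A2 x by move=> h; apply: nAx; right.
  have h1 := l1 x bx nA1; have h2 := l2 x bx nA2.
  (* Boundary values may be infinite: at +oo the function u2 exceeds the bound M of v, and at -oo
     the function u1 drops below the lower bound m of u2. *)
  case: (f x) h1 h2 => [r||] h1 h2.
  - have e2 : 0 < e / 2 by lra.
    have k1 : \forall z \near within Om (nbhs x), (u1 z < (r + e / 2)%:E)%E.
      by apply: (near_cvg_lt h1); rewrite lte_fin; lra.
    have k2 : \forall z \near within Om (nbhs x), ((r - e / 2)%:E < u2 z)%E.
      by apply: (near_cvg_gt h2); rewrite lte_fin; lra.
    move: k1 k2; rewrite !near_withinE; apply: filterS2 => z a1 a2 Oz.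
    apply: le_trans (ltW (a2 Oz)).
    have -> : r - e / 2 = (r + e / 2) - e by field.
    apply: perturb_le_shift => //; last exact: w0.
    by apply: le_trans (vu z Oz) _; exact/ltW/a1.
  - have : \forall z \near within Om (nbhs x), (M%:E < u2 z)%E.
      by apply: (near_cvg_gt h2); rewrite ltry.
    rewrite !near_withinE; apply: filterS => z a2 Oz.
    apply: le_trans (ltW (a2 Oz)); apply: le_trans (perturb_le_shift e0 (vM z Oz) (w0 z Oz)) _.
    by rewrite lee_fin; lra.
  - have : \forall z \near within Om (nbhs x), (u1 z < m%:E)%E.
      by apply: (near_cvg_lt h1); rewrite ltNyr.
    rewrite !near_withinE; apply: filterS => z a1 Oz.
    apply: le_trans (m2 z Oz).
    have vm : (v z <= m%:E)%E by apply: le_trans (vu z Oz) _; exact/ltW/a1.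
    apply: le_trans (perturb_le_shift e0 vm (w0 z Oz)) _.
    by rewrite lee_fin; lra.
have [K [cK KO HK]] := near_boundary_compact oO cc bd.
have [G KG GO] := rel_compact_nbhd cK oO KO; have [oG _ sub] := GO.
have GsO : G `<=` Om by move=> y Gy; apply: sub; exact: subset_closure.
move=> z Oz; have [Kz|] := pselect (K z); last exact: HK.
apply: (max2 G V GO) => //; [exact: PSH_sub PV| |exact: KG].
move=> x bx; have [cx nGx] := open_boundary oG bx; have Ox := sub _ cx.
have [_ uV _] := PV; apply: le_trans (upper_reg_sub_le GsO uV Ox) _.
by apply: HK => // /KG.
Qed.

End Perturbation.

(** * The envelope: regularity, maximality and boundary values *)

Section Envelope.
Context {R : realType} {n : nat}.

Lemma bounded_domain_compact (Om : set (Cn R n)) : bounded_domain Om -> compact (closure Om).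
Proof.
move=> [_ _ _ [M HM]].
apply: (@compact_closure_bounded _ _ _ `|M|) => z Oz; apply/rn_leP => // j.
apply: le_trans (ler_norm M); rewrite -lecR -cabsE; exact: HM.
Qed.

Hypothesis n_gt0 : (0 < n)%N.
Variables (Om : set (Cn R n)) (phi v theta : Cn R n -> \bar R) (m0 : R).
Hypothesis Om_qB : quasi_B_regular Om.
Hypothesis phi_nc : nearly_continuous Om phi.
Hypothesis v_ge : forall z, closure Om z -> (upper_reg Om phi z <= v z)%E.
Hypothesis v_strong : strong_psuperh_majorant Om (upper_reg Om phi) v.
Hypothesis theta_psh : PSHs Om theta.
Hypothesis theta_ge : forall z, Om z -> (m0%:E <= theta z)%E.
Hypothesis theta_le : forall z, Om z -> (theta z <= phi z)%E.
Hypothesis phi_sh : superharmonic Om phi.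

Local Notation phis := (upper_reg Om phi).
Local Notation P := (envelope Om (upper_reg Om phi)).

Let oO : open Om. Proof. by have [[]] := Om_qB. Qed.
Let cO : connected Om. Proof. by have [[]] := Om_qB. Qed.
Let O0 : Om !=set0. Proof. by have [[]] := Om_qB. Qed.
Let O_cl z : Om z -> closure Om z. Proof. exact: subset_closure. Qed.

Let cc : compact (closure Om).
Proof. by have [bO _ _] := Om_qB; exact: bounded_domain_compact. Qed.

Let approx : dirichlet_approx Om.
Proof.
have [_ reg _] := Om_qB; split => // f e lf e0.
have [|h [ch hh Hh]] := reg f.
  by apply: continuous_subspaceT; exact: lipschitz_rn_continuous.
exists h; split => // x bx; rewrite Hh// lexx /=; lra.
Qed.

Lemma psh_le_superharmonic (D : set (Cn R n)) V : open D -> compact (closure D) -> D `<=` Om ->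
  PSH D V -> (forall x, boundary D x -> \forall z \near within D (nbhs x), (V z <= phi z)%E) ->
  forall z, D z -> (V z <= phi z)%E.
Proof.
move=> oD cD DO PV bd; have [p Op] := O0.
apply: (comparison approx Op oD cD) => //.
- exact: PSH_SH.
- exact: SH_sub phi_sh.
Qed.

Let phi_gt z : Om z -> (-oo < phi z)%E.
Proof. by have [h _ _] := phi_sh; move=> /h; rewrite lteNl. Qed.

Let phi_lsc : lsc_on Om phi.
Proof.
have [_ h _] := phi_sh; have := lsc_onN h.
by rewrite (_ : (fun _ => _) = phi)//; apply/funext => z; rewrite oppeK.
Qed.

Let phi_le z : Om z -> (phi z <= phis z)%E. Proof. exact: le_upper_reg. Qed.

Let m0_phi z : Om z -> (m0%:E <= phi z)%E.
Proof. by move=> Oz; apply: le_trans (theta_ge Oz) (theta_le Oz). Qed.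

(** At a point of Om the value of phi lies between phi_* and phi^*, so all three agree off the
    discontinuity set, whose points in Om are poles of w. *)
Lemma nearly_continuous_weight : exists w, [/\ PSHs Om w, (forall z, Om z -> (w z < 0)%E) &
  forall z, Om z -> w z != -oo%E -> phis z = phi z].
Proof.
have [_ [w [Pw w0 Hw]]] := phi_nc; exists w; split => // z Oz wz.
have [[_ uw _] _] := Pw.
have E : phis z = lower_reg Om phi z.
  apply: contrapT => ne; have /Hw : disc_set Om phi z by split => //; exact: O_cl.
  by rewrite upper_reg_id// => E; move: wz; rewrite E eqxx.
by apply/eqP; rewrite eq_le phi_le// andbT E lower_reg_le.
Qed.

Let F := [set u | PSH Om u /\ forall x, closure Om x -> (upper_reg Om u x <= phis x)%E].

Lemma subsolution_in u : PSH Om u -> (forall z, Om z -> (u z <= phis z)%E) -> F u.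
Proof.
move=> Pu up; split => // x _; apply: le_trans (upper_reg_idem Om phi x).
exact: upper_reg_mono.
Qed.

Lemma subsolution_le u z : F u -> Om z -> (u z <= phis z)%E.
Proof.
by move=> [_ h] Oz; apply: le_trans (h z (O_cl Oz)); exact: le_upper_reg.
Qed.

Lemma le_envelope u z : F u -> (u z <= P z)%E.
Proof. by move=> Fu; apply: ereal_sup_ubound; exists u. Qed.

Lemma envelope_le z : Om z -> (P z <= phis z)%E.
Proof. by move=> Oz; apply: ge_ereal_sup => _ [u Fu <-]; exact: subsolution_le. Qed.

Let v_bound : exists m : R, forall z, closure Om z -> (m%:E <= v z)%E.
Proof. by have [v1 v2 _ _ _] := v_strong; exact: lsc_bounded_below. Qed.

Let Pv : PSHs Om (fun z => - v z)%E. Proof. by have [] := v_strong. Qed.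

Let PvB (m : R) : PSH Om (fun z => - (v z - m%:E))%E.
Proof.
apply: PSH_ext (PSH_addc m oO Pv.1) => z _.
by case: (v z) => [a||] //; rewrite -EFinN -EFinB -EFinD -EFinN; congr (_%:E); ring.
Qed.

Lemma envelope_reg_lt z : Om z -> (upper_reg Om P z < +oo)%E.
Proof.
move=> Oz; have [m Hm] := v_bound.
have [d d0 Hd] := iffLR (open_rnP _) oO z Oz.
pose r := d / 5; have r0 : 0 < r by rewrite divr_gt0.
pose B := [set y | rn (y - z) < 5 * r].
have BO : B `<=` Om by move=> y yB; apply: Hd; rewrite /B /= /r in yB; lra.
have oB : open B by exact: open_ball_rn.
have [p [Op vp pz]] := PSHs_finite_dense oO cO Pv Oz r0.
have [c Hc] : exists c : R, (v p - m%:E <= c%:E)%E.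
  have := Hm p (O_cl Op); case: (v p) vp => [b||] // _ _.
  by exists (b - m); rewrite -EFinB.
apply: (@le_lt_trans _ _ (3 * c + m)%:E); last by rewrite ltry.
apply: upper_reg_le; rewrite near_withinE; apply: filterS (near_rn z r0) => q qz Oq.
apply: ge_ereal_sup => _ [u Fu <-].
have : (u q - m%:E <= (3 * c)%:E)%E; last by rewrite subre_le.
apply: (@harnack_ball _ _ B (fun y => u y - m%:E)%E (fun y => v y - m%:E)%E z p q r c) => //.
- have Pu : PSH B u by apply: PSH_sub BO _; case: Fu.
  by apply: PSH_ext (PSH_addc (- m) oB Pu) => y _ /=; rewrite EFinN.
- by apply: PSH_sub BO _; exact: PvB.
- move=> y By; have := Hm y (O_cl (BO _ By)).
  by case: (v y) => [b||] // h; rewrite -?EFinB ?lee_fin ?subr_ge0 ?leey.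
- move=> y By; apply: leeD2r; apply: le_trans (subsolution_le Fu (BO _ By)) _.
  exact/v_ge/O_cl/BO.
Qed.

Lemma envelope_reg z : Om z -> upper_reg Om P z = P z.
Proof.
move=> Oz; apply/eqP; rewrite eq_le le_upper_reg// andbT; apply: le_envelope.
apply: subsolution_in.
  by apply: (@PSH_sup_reg R n Om F oO) => [u []//|x]; exact: envelope_reg_lt.
move=> x Ox; apply: le_trans (upper_reg_idem Om phi x).
by apply: upper_reg_mono; exact: envelope_le.
Qed.

Lemma envelope_PSH : PSH Om P.
Proof.
apply: (@PSH_ext R n Om (upper_reg Om P)); first exact: envelope_reg.
by apply: (@PSH_sup_reg R n Om F oO) => [u []//|x]; exact: envelope_reg_lt.
Qed.

Lemma envelope_ge z : Om z -> (m0%:E <= P z)%E.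
Proof.
move=> Oz; apply: le_trans (theta_ge Oz) _; apply: le_envelope; apply: subsolution_in.
  by case: theta_psh.
by move=> x Ox; apply: le_trans (theta_le Ox) (phi_le Ox).
Qed.

Lemma envelope_fin z : Om z -> exists a : R, P z = a%:E.
Proof.
move=> Oz; have [h _ _] := envelope_PSH.
move: (envelope_ge Oz) (h z Oz); case: (P z) => [a||] // _ _; by exists a.
Qed.

Lemma envelope_PSHs : PSHs Om P.
Proof.
split; first exact: envelope_PSH.
by have [z Oz] := O0; exists z => //; have [a ->] := envelope_fin Oz.
Qed.

Lemma envelope_quasi_upper_bounded : quasi_upper_bounded Om P.
Proof.
split; first exact: envelope_PSH.
have [m Hm] := v_bound; have [_ _ _ _ strong] := v_strong.
have e0 (j : nat) : 0 < j.+1%:R^-1 :> R by rewrite invr_gt0 ltr0Sn.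
exists (fun j z => P z + (j.+1%:R^-1)%:E * - (v z - m%:E))%E, [set z | Om z /\ v z = +oo%E].
split.
- by move=> j; apply: (PSH_add oO envelope_PSH); exact: (PSH_scale (e0 j) (PvB m)).
(* Where phi^* <= N, the bound N suffices because the subtracted term is nonnegative. Where phi^* >
   N, the strong majorant with constant j + 1 gives P <= phi^* <= v / (j + 1), so only m / (j + 1)
   remains. *)
- move=> j; have [N N0 HN] := strong j.+1%:R (ltr0Sn _ j).
  exists (N + `|m|) => z Oz; have [a Pa] := envelope_fin Oz.
  have := Hm z (O_cl Oz); have := envelope_le Oz; rewrite Pa.
  case Ev : (v z) => [b||] //; last first.
    by move=> _ _; rewrite (_ : - (+oo - m%:E) = -oo)%E// gt0_muleNy ?lte_fin//= leNye.
  rewrite -EFinB -EFinN -EFinM -EFinD !lee_fin => ap mb.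
  have bm : j.+1%:R^-1 * - (b - m) <= 0.
    by rewrite mulrN oppr_le0 mulr_ge0 ?subr_ge0// ltW.
  have m_ge0 := normr_ge0 m.
  have [phN|phN] := leP (phis z) N%:E.
    by have := le_trans ap phN; rewrite lee_fin => aN; rewrite lerD// (le_trans bm).
  have := HN z (O_cl Oz) phN; rewrite Ev => Hb.
  have : (j.+1%:R%:E * a%:E <= b%:E)%E.
    by apply: le_trans Hb; apply: lee_wpmul2l => //; rewrite lee_fin.
  rewrite -EFinM lee_fin mulrC -ler_pdivlMr ?ltr0Sn// => Hab.
  have jm : j.+1%:R^-1 * m <= `|m|.
    apply: le_trans (ler_norm _) _; rewrite normrM (ger0_norm (ltW (e0 j))) ler_piMl//.
    by rewrite invf_le1 ?ltr0Sn// ler1n.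
  rewrite mulrC in Hab; rewrite mulrN mulrBr opprB addrCA.
  by rewrite (addrC N) lerD// (le_trans _ (ltW N0))// subr_le0.
- by move=> z [].
- move=> x [Ox vx]; exists Om, (fun z => - v z)%E; split => //.
  by move=> z [_ ->].
- move=> z Oz nE; have [a Pa] := envelope_fin Oz.
  have [b vb] : exists b : R, v z = b%:E.
    move: (Hm z (O_cl Oz)); case Ev : (v z) => [b||] // _; first by exists b.
    by exfalso; apply: nE; split.
  have := Hm z (O_cl Oz); rewrite Pa vb lee_fin => mb.
  have E j : (a%:E + (j.+1%:R^-1)%:E * - (b%:E - m%:E) = (a - (b - m) / j.+1%:R)%:E)%E.
    by rewrite -EFinB -EFinN -EFinM -EFinD; congr (_%:E); rewrite mulrN mulrC.
  have bm : 0 <= b - m by rewrite subr_ge0.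
  split.
    move=> j; rewrite !E lee_fin lerD2l lerN2 ler_wpM2l// lef_pV2 ?posrE ?ltr0Sn//.
    by rewrite ler_nat.
  apply: cvg_ereal => c; rewrite lte_fin => ac.
    have [N HN] : exists N : nat, (b - m) / (a - c) < N%:R by eexists; exact: truncnS_gt.
    exists N => // j /= Nj; rewrite E lte_fin ltrBrDr -ltrBrDl.
    rewrite ltr_pdivrMr ?subr_gt0// in HN.
    rewrite ltr_pdivrMr ?ltr0Sn//; apply: lt_le_trans HN _.
    rewrite mulrC; apply: ler_wpM2l; [by rewrite subr_ge0 ltW|by rewrite ler_nat; exact: leqW].
  exists 0%N => // j _; rewrite /= E lte_fin; apply: le_lt_trans ac.
  by rewrite lerBlDr lerDl divr_ge0.
Qed.

(** The comparison is with phi, which is superharmonic, rather than with phi^*. On the boundary of G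
    one has u^* <= P <= phi^*, and phi^* = phi off the poles of w, while at the poles the
    perturbation wins. In the limit u <= phi off the poles, so u <= phi^* on G, and the gluing of P
    and u is itself a competitor in the supremum. *)
Lemma envelope_maximal : MPSH Om P.
Proof.
split; first exact: envelope_PSHs.
move=> G u GO Pu bd z Gz; have [oG cG sub] := GO.
have GsO : G `<=` Om by move=> y Gy; apply: sub; exact: subset_closure.
have [w [Pw w0 Hw]] := nearly_continuous_weight; have [[_ uw _] _] := Pw.
have [P1 _ _] := envelope_PSH.
have step e y : 0 < e -> G y -> (u y + (e%:E * w y + (- e)%:E) <= phi y)%E.
  move=> e0; move: y; apply: (psh_le_superharmonic oG cG GsO).
    by apply: (PSH_perturb oG Pu) => //; apply: PSH_sub GsO _; case: Pw.
  move=> x bx; have [cx nGx] := open_boundary oG bx; have Ox := sub _ cx.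
  have ux := bd x bx.
  have [wx|wx] := eqVneq (w x) -oo%E.
    have [M [uM _]] := ereal_between (le_lt_trans ux (P1 x Ox)).
    have [c [_ cphi]] := ereal_between (phi_gt Ox).
    have h1 := upper_reg_lt uM.
    have h2 := uw x Ox ((c - M) / e); rewrite wx ltNyr in h2.
    have h3 := phi_lsc Ox cphi.
    move: h1 (h2 isT) h3; rewrite !near_withinE; apply: filterS3 => y a1 a2 a3 Gy.
    have Oy := GsO _ Gy; apply: le_trans (ltW (a3 Oy)).
    by apply: perturb_le_pole => //; [exact/ltW/a1|exact: a2].
  have [a Pa] := envelope_fin Ox.
  have aphi : (a%:E <= phi x)%E by rewrite -Hw// -Pa; exact: envelope_le.
  have e2 : 0 < e / 2 by lra.
  have h1 : \forall y \near within G (nbhs x), (u y < (a + e / 2)%:E)%E.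
    by apply: upper_reg_lt; apply: le_lt_trans ux _; rewrite Pa lte_fin; lra.
  have h2 : \forall y \near within Om (nbhs x), ((a - e / 2)%:E < phi y)%E.
    by apply: (phi_lsc Ox); apply: lt_le_trans aphi; rewrite lte_fin; lra.
  move: h1 h2; rewrite !near_withinE; apply: filterS2 => y a1 a2 Gy.
  have Oy := GsO _ Gy; apply: le_trans (ltW (a2 Oy)).
  have -> : a - e / 2 = (a + e / 2) - e by field.
  by apply: perturb_le_shift => //; [exact/ltW/a1|exact: w0].
have uphis y : G y -> (u y <= phis y)%E.
  move=> Gy; apply: (@PSH_le_off_polar R n G Om u phis w y) => //.
  - exact: upper_reg_usc.
  - exact: GsO.
  - move=> x Gx Ox wx; apply: le_trans (phi_le Ox); have [u1 _ _] := Pu.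
    apply: (@lee_perturb R _ _ (w x)) => //; [exact: u1|exact: w0|].
    by move=> e e0; exact: step.
have Fg : F (glue_max G P u).
  apply: subsolution_in.
    by apply: (PSH_glue oO oG sub envelope_PSH Pu) => x; exact: bd.
  move=> x Ox; rewrite /glue_max; case: asboolP => [Gx|_]; last exact: envelope_le.
  by rewrite ge_max envelope_le// uphis.
apply: le_trans (le_envelope z Fg); rewrite /glue_max asboolT//.
by rewrite le_max lexx orbT.
Qed.

(** Perturbed bounded functions below u are under f, hence under phi, near non-exceptional boundary
    points, and under the lower bound m0 of phi near exceptional ones. Comparison with phi then
    makes them competitors in the supremum. *)
Lemma boundary_data_le_envelope (f : Cn R n -> R) A u : lipschitz_rn f ->
  (forall z, Om z -> ((f z)%:E <= phi z)%E) -> pluripolar_in Om A -> quasi_upper_bounded Om u ->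
  (forall x, boundary Om x -> ~ A x -> u @ within Om (nbhs x) --> (f x)%:E) ->
  forall z, Om z -> (u z <= P z)%E.
Proof.
move=> lf fphi [_ [w [Pw w0 Hw]]] Qu lim.
have [_ uP _] := envelope_PSH.
apply: (quasi_upper_bounded_le oO cO Qu uP Pw w0) => u' M e Pu' uM uu e0 z Oz.
pose V z := (u' z + (e%:E * w z + (- e)%:E))%E.
have PV : PSH Om V by apply: (PSH_perturb oO Pu') => //; case: Pw.
apply: (@le_envelope V); apply: subsolution_in => // y Oy.
apply: le_trans (phi_le Oy); move: y Oy; apply: (psh_le_superharmonic oO cc) => // x bx.
have [Ax|nAx] := pselect (A x).
  have : (upper_reg Om w x < ((m0 - M) / e)%:E)%E by rewrite Hw// ltNyr.
  move=> /upper_reg_lt; rewrite !near_withinE; apply: filterS => y Hy Oy.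
  apply: le_trans (m0_phi Oy); apply: perturb_le_pole => //; first exact: uM.
  exact: Hy.
have e2 : 0 < e / 2 by lra.
have k1 : \forall z \near within Om (nbhs x), (u z < (f x + e / 2)%:E)%E.
  by apply: (near_cvg_lt (lim x bx nAx)); rewrite lte_fin; lra.
have cf : {for x, continuous f} by exact: lipschitz_rn_continuous.
have [d d0 Hd] := iffLR (real_continuousP _ _) cf _ e2.
move: k1; rewrite !near_withinE; apply: filterS2 (near_rn x d0) => y yx a1 Oy.
apply: le_trans (fphi y Oy).
apply: (@le_trans _ _ ((f x + e / 2) - e)%:E).
  apply: perturb_le_shift => //; last exact: w0.
  by apply: le_trans (uu y Oy) _; exact/ltW/a1.
by rewrite lee_fin; have := Hd y yx; rewrite ltr_norml; lra.
Qed.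

(** Quasi B-regularity is applied to the Lipschitz regularizations of phi over Om. The resulting
    solutions lie below P and, off a countable union of exceptional sets, have limits exceeding any
    real below phi_* x. The upper estimate is P <= phi^*, and the two meet off the discontinuity
    set. *)
Lemma envelope_boundary : exists A, [/\ A `<=` boundary Om, pluripolar_in Om A,
  boundary Om `&` disc_set Om phi `<=` A &
  forall x, boundary Om x -> ~ A x -> P @ within Om (nbhs x) --> phis x].
Proof.
have [_ _ qB] := Om_qB; pose f k := lipreg Om phi k.
have lf k : lipschitz_rn (f k) by exists k%:R; exact: (lipreg_lip O0 m0_phi).
have /choice[Au HAu] : forall k, exists Au : set (Cn R n) * (Cn R n -> \bar R),
    [/\ Au.1 `<=` boundary Om, pluripolar_in Om Au.1, quasi_upper_bounded Om Au.2 &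
        forall x, boundary Om x -> ~ Au.1 x -> Au.2 @ within Om (nbhs x) --> (f k x)%:E].
  move=> k; have [|A [u H]] := qB (f k); last by exists (A, u).
  by apply: continuous_subspaceT; exact: lipschitz_rn_continuous.
have uP k z : Om z -> ((Au k).2 z <= P z)%E.
  have [_ pA Qu lim] := HAu k.
  apply: (boundary_data_le_envelope (lf k) _ pA Qu lim) => x Ox.
  exact: (lipreg_le m0_phi).
exists ((\bigcup_k (Au k).1) `|` (boundary Om `&` disc_set Om phi)); split.
- by move=> x [[k _ Ax]|[]//]; have [sub _ _ _] := HAu k; exact: sub.
- apply: pluripolar_inU => //.
    by apply: pluripolar_in_bigcup => // k; have [] := HAu k.
  by apply: pluripolar_in_sub phi_nc => x [].
- by move=> x h; right.
- move=> x bx nA; have cx : closure Om x by case: bx.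
  have E : phis x = lower_reg Om phi x.
    by apply: contrapT => ne; apply: nA; right.
  apply: cvg_ereal => a.
    rewrite E => /ereal_between[b [ab /lower_reg_gt bphi]].
    have [k bk] := lipreg_cvg O0 m0_phi bphi.
    have [_ _ _ lim] := HAu k.
    have : \forall z \near within Om (nbhs x), (a%:E < (Au k).2 z)%E.
      apply: (near_cvg_gt (lim x bx _)); first by move=> Ax; apply: nA; left; exists k.
      by apply: lt_le_trans ab _; rewrite lee_fin.
    rewrite !near_withinE; apply: filterS => z h Oz.
    exact: lt_le_trans (h Oz) (uP k z Oz).
  move=> pa; apply: upper_reg_lt; apply: le_lt_trans pa.
  by apply: le_trans (upper_reg_idem Om phi x); apply: upper_reg_mono; exact: envelope_le.
Qed.

End Envelope.

Unset Implicit Arguments.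

Theorem theorem1p9 (R : realType) (n : nat) (n_gt0 : (0 < n)%N)
    (Om : set (Cn R n)) (phi : Cn R n -> \bar R)
    (Om_qBreg : quasi_B_regular Om)
    (phi_nc : nearly_continuous Om phi)
    (phi_maj : exists v : Cn R n -> \bar R,
      [/\ superharmonic_majorant Om (upper_reg Om phi) v,
          (exists2 z, closure Om z & v z != +oo%E) &
          strong_psuperh_majorant Om (upper_reg Om phi) v])
    (phi_min : exists theta : Cn R n -> \bar R,
      [/\ PSHs Om theta,
          (exists m : R, forall z, Om z -> (m%:E <= theta z)%E) &
          forall z, Om z -> (theta z <= phi z)%E])
    (phi_sh : superharmonic Om phi) :
  let P := envelope Om (upper_reg Om phi) in
  [/\ quasi_upper_bounded Om P,
      dirichlet_solution Om phi P &
      forall u : Cn R n -> \bar R,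
        quasi_upper_bounded Om u -> dirichlet_solution Om phi u ->
        forall z, Om z -> u z = P z].
Proof.
move=> P.
have [v [[_ _ _ v_ge] _ v_strong]] := phi_maj.
have [theta [theta_psh [m0 theta_ge] theta_le]] := phi_min.
have [bO _ _] := Om_qBreg; have [oO cO O0 _] := bO.
have cc := bounded_domain_compact bO.
have QP : quasi_upper_bounded Om P.
  exact: (envelope_quasi_upper_bounded Om_qBreg v_ge v_strong
    theta_psh theta_ge theta_le).
have DP : dirichlet_solution Om phi P.
  split.
  - exact: (envelope_maximal n_gt0 Om_qBreg phi_nc v_ge v_strong
      theta_psh theta_ge theta_le phi_sh).
  - apply: (@lt_le_trans _ _ m0%:E); first exact: ltNyr.
    apply: le_ereal_inf_tmp => _ [z Oz <-].
    exact: (envelope_ge theta_psh theta_ge theta_le).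
  - exact: (envelope_boundary n_gt0 Om_qBreg phi_nc v_ge v_strong
      theta_ge theta_le phi_sh).
split=> // u Qu [Mu iu [A1 [_ pA1 _ l1]]] z Oz.
have [MP iP [A2 [_ pA2 _ l2]]] := DP.
apply/eqP; rewrite eq_le; apply/andP; split.
- exact: (maximal_domination oO cO O0 cc Qu MP iP pA1 pA2 l1 l2).
- exact: (maximal_domination oO cO O0 cc QP Mu iu pA2 pA1 l2 l1).
Qed.
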